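(* Let $N\ge 1$, $0<s\le 1$ and $1<p<\infty$ be such that $s\,p>N$. Then \[ \mathfrak{m}_{s,p}(\mathbb{R}^N)=\inf_{\varphi\in \mathcal{W}^{s,p}(\mathbb{R}^N)} \Big\{[\varphi]_{W^{s,p}(\mathbb{R}^N)}^p\, : \, [\varphi]_{C^{0,\alpha_{s,p}}(\mathbb{R}^N)}=1\Big\}, \] and the infimum on the right-hand side is attained.
   Context: For $0<s<1$, $[\varphi]_{W^{s,p}(\mathbb{R}^N)}=\left(\iint_{\mathbb{R}^N\times\mathbb{R}^N}\frac{|\varphi(x)-\varphi(y)|^p}{|x-y|^{N+s\,p}}dx\,dy\right)^{1/p}$, and for $s=1$, $[\varphi]_{W^{1,p}(\mathbb{R}^N)}=\|\nabla\varphi\|_{L^p(\mathbb{R}^N)}$. $[\varphi]_{C^{0,\alpha}(\mathbb{R}^N)}=\sup_{x\ne y}\frac{|\varphi(x)-\varphi(y)|}{|x-y|^\alpha}$ and $\alpha_{s,p}=s-N/p$. $\mathfrak{m}_{s,p}(\mathbb{R}^N)=\inf\{[\varphi]^p_{W^{s,p}(\mathbb{R}^N)}:\varphi\in C^\infty_0(\mathbb{R}^N),\ [\varphi]_{C^{0,\alpha_{s,p}}(\mathbb{R}^N)}=1\}$. The space $\mathcal{W}^{s,p}(\mathbb{R}^N)$ consists of all continuous $\varphi:\mathbb{R}^N\to\mathbb{R}$ with $[\varphi]_{C^{0,\alpha_{s,p}}(\mathbb{R}^N)}<\infty$ and $[\varphi]_{W^{s,p}(\mathbb{R}^N)}<\infty$.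 *)

(* Defs.v *)
From HB Require Import structures.
From mathcomp Require Import all_boot all_order all_algebra.
From mathcomp Require Import all_classical all_reals all_analysis.
Set Implicit Arguments. Unset Strict Implicit. Unset Printing Implicit Defensive.
Import Order.TTheory GRing.Theory Num.Theory.
Import numFieldNormedType.Exports.
Local Open Scope classical_set_scope.
Local Open Scope ring_scope.

Section Defs.
Variable R : realType.

(* Euclidean norm on R^n = 'rV[R]_n (the library norm on matrices is the max
   norm; it induces the same topology, but the paper's formulas use |.|_2). *)
Definition eucl (n : nat) (x : 'rV[R]_n) : R :=
  Num.sqrt (\sum_(i < n) x ord0 i ^+ 2).

(* Lebesgue integral over R^n of an extended-real valued function, defined as
   the iterated one-dimensional Lebesgue integral (Tonelli/Fubini). *)
Fixpoint intN (n : nat) : ('rV[R]_n -> \bar R) -> \bar R :=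
  match n return ('rV[R]_n -> \bar R) -> \bar R with
  | 0 => fun f => f 0
  | n'.+1 => fun f =>
      (\int[@lebesgue_measure R]_(t in setT)
         intN (fun v : 'rV[R]_n' => f (row_mx (const_mx t : 'rV[R]_1) v)))%E
  end.

Fixpoint Diter (N : nat) (vs : seq 'rV[R]_N) (f : 'rV[R]_N -> R) : 'rV[R]_N -> R :=
  match vs with
  | [::] => f
  | v :: vs' => fun x => derive (Diter vs' f) x v
  end.

Definition smooth (N : nat) (f : 'rV[R]_N -> R) : Prop :=
  forall (vs : seq 'rV[R]_N) (x : 'rV[R]_N), differentiable (Diter vs f) x.

Definition compact_support (N : nat) (f : 'rV[R]_N -> R) : Prop :=
  exists r : R, forall x, r < eucl x -> f x = 0.

Definition Cc_inf (N : nat) (f : 'rV[R]_N -> R) : Prop :=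
  smooth f /\ compact_support f.

Definition alpha_sp (N : nat) (s p : R) : R := s - N%:R / p.

Definition holder_semi (N : nat) (a : R) (f : 'rV[R]_N -> R) : \bar R :=
  ereal_sup [set z | exists x y : 'rV[R]_N,
                       x != y /\ z = (`|f x - f y| / (eucl (x - y) `^ a))%:E].

Definition gagliardo_p (N : nat) (s p : R) (f : 'rV[R]_N -> R) : \bar R :=
  intN (fun x => intN (fun y =>
     ((`|f x - f y| `^ p) / (eucl (x - y) `^ (N%:R + s * p)))%:E)).

Definition grad (N : nat) (f : 'rV[R]_N -> R) (x : 'rV[R]_N) : 'rV[R]_N :=
  \row_(i < N) derive f x (delta_mx ord0 i).

Definition Lp_p (N : nat) (p : R) (g : 'rV[R]_N -> 'rV[R]_N) : \bar R :=
  intN (fun x => (eucl (g x) `^ p)%:E).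

Definition Wsp_smooth_p (N : nat) (s p : R) (f : 'rV[R]_N -> R) : \bar R :=
  if s == 1 then Lp_p p (grad f) else gagliardo_p s p f.

Definition m_sp (N : nat) (s p : R) : \bar R :=
  ereal_inf [set Wsp_smooth_p s p f | f in
               [set f : 'rV[R]_N -> R | Cc_inf f /\ holder_semi (alpha_sp N s p) f = 1%E]].

Definition borel_fun (N : nat) (g : 'rV[R]_N -> R) : Prop :=
  forall B : set R, open B ->
    <<s [set A : set 'rV[R]_N | open A] >> (g @^-1` B).

Definition weak_grad (N : nat) (f : 'rV[R]_N -> R) (g : 'rV[R]_N -> 'rV[R]_N) : Prop :=
  (forall i : 'I_N, borel_fun (fun x => g x ord0 i)) /\
  (forall (i : 'I_N) (r : R),
      (intN (fun x => (if eucl x <= r then `|g x ord0 i| else 0)%:E) < +oo)%E) /\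
  (forall psi : 'rV[R]_N -> R, Cc_inf psi -> forall i : 'I_N,
      intN (fun x => (f x * derive psi x (delta_mx ord0 i))%:E) =
      (- intN (fun x => (g x ord0 i * psi x)%:E))%E).

Definition Wsp_val (N : nat) (s p : R) (f : 'rV[R]_N -> R) (v : \bar R) : Prop :=
  if s == 1 then exists g, weak_grad f g /\ v = Lp_p p g
  else v = gagliardo_p s p f.

Definition calW (N : nat) (s p : R) (f : 'rV[R]_N -> R) : Prop :=
  continuous f /\ (holder_semi (alpha_sp N s p) f < +oo)%E /\
  exists v, Wsp_val s p f v /\ (v < +oo)%E.

Definition inf_calW (N : nat) (s p : R) : \bar R :=
  ereal_inf [set v | exists f : 'rV[R]_N -> R,
    calW s p f /\ holder_semi (alpha_sp N s p) f = 1%E /\ Wsp_val s p f v].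

End Defs.

(* Main.v *)
Require Import Defs.
From HB Require Import structures.
From mathcomp Require Import all_boot all_order all_algebra.
From mathcomp Require Import all_classical all_reals all_analysis.
From mathcomp Require Import measurable_realfun.
From mathcomp Require Import ring lra.
Set Implicit Arguments. Unset Strict Implicit. Unset Printing Implicit Defensive.
Import Order.TTheory GRing.Theory Num.Theory.
Import numFieldNormedType.Exports.
Local Open Scope classical_set_scope.
Local Open Scope ring_scope.

(** Every [f] in the class [calW] is approximated by test functions: multiply [f - f 0] by a
    Cesaro average of dilated cutoffs, then mollify. The dilated cutoffs alone only have bounded
    energy (the scaling [s p - n = alpha p] is critical), but their errors tend to 0 pointwise
    and are bounded in [L^p] with [p > 1], so suitable averages have small energy.
    Mollification does not increase the energy, by Jensen's inequality. Since the increment of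
    the approximation at a nearly optimal pair of points is kept, the two infima agree.

    A minimising sequence is normalised by translation and dilation so that the Hoelder
    quotient is nearly attained between 0 and a point of the unit sphere. Equi-Hoelder
    continuity gives a pointwise convergent subsequence whose limit still has seminorm 1. For
    [s < 1] Fatou's lemma concludes. For [s = 1] midpoints of the sequence are again nearly
    admissible, so uniform convexity of the [L^p] norm makes the gradients Cauchy in [L^p]. *)

(** * Lebesgue measure on row vectors *)

(** With [alpha = s - N / p], the maps [f -> lambda^(- alpha) f (lambda x + a)] preserve both the
    Hoelder seminorm and the energy, so a minimising sequence may concentrate, spread or drift away.
    Placing a nearly optimal pair at 0 and at a unit vector removes this freedom and keeps the
    Hoelder quotient from being lost in the limit.

    Elements of [calW] need not decay: after subtraction of [f 0] one only has [|f y| <= |y|^alpha].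
    Cutoff errors are therefore compared with one kernel weighted by this growth, which bounds all
    dilations alike.

    For [s = 1] Fatou's lemma alone is not enough, because a weak gradient of the limit has to be
    produced; strong convergence of the gradients provides it. Midpoints are good competitors
    because both functions are nearly extremal at the same pair of points.

    The definitions use iterated one-dimensional integrals. These are rewritten as integrals against
    the measures [muN] and [muP], to which Tonelli, Fatou and dominated convergence apply. *)

Lemma sigma_finite_product d1 d2 (T1 : measurableType d1) (T2 : measurableType d2)
    (R : realType) (m1 : {sigma_finite_measure set T1 -> \bar R})
    (m2 : {sigma_finite_measure set T2 -> \bar R}) : sigma_finite setT (m1 \x m2)%E.
Proof.
have [F TF Foo] := sigma_finiteT m1; have [G TG Goo] := sigma_finiteT m2.
(* An enumeration of all pairs; numbers that code no pair are sent to [(0, 0)], which only repeats a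
   set of the cover. *)
pose h k : nat * nat := odflt (0, 0)%N (unpickle k).
exists (fun i => F (h i).1 `*` G (h i).2).
  apply/seteqP; split => // -[x y] _.
  have [i _ Fx] : (\bigcup_i F i) x by rewrite -TF.
  have [j _ Gy] : (\bigcup_i G i) y by rewrite -TG.
  by exists (pickle (i, j)) => //; rewrite /h pickleK.
move=> k; have [? ?] := Foo (h k).1; have [? ?] := Goo (h k).2.
split; first exact: measurableX.
by rewrite product_measure1E // lte_mul_pinfty // ge0_fin_numE.
Qed.

Section BorelRow.
Variable R : realType.

(** Generated by the open sets, exactly as in [borel_fun]. That the coordinates generate the same
    sigma-algebra is the content of [measurable_rVP]. *)
Definition rVB (n : nat) : measurableType _ := g_sigma_algebraType (@open 'rV[R]_n).

Lemma open_measurable_rV n (A : set 'rV[R]_n) : open A -> measurable (A : set (rVB n)).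
Proof. by move=> oA; apply: sub_sigma_algebra. Qed.

Lemma continuous_measurable_rV n (f : 'rV[R]_n -> R) :
  continuous f -> measurable_fun setT (f : rVB n -> R).
Proof.
move=> /continuousP cf; apply: (measurability _ (RGenOpens.measurableE R)).
move=> _ [_ [a [b ->] <-]]; rewrite setTI.
by apply: open_measurable_rV; apply: cf; exact: interval_open.
Qed.

Lemma borel_funP n (g : 'rV[R]_n -> R) :
  borel_fun g <-> measurable_fun setT (g : rVB n -> R).
Proof.
split => [bg|mg B oB].
  apply: (measurability _ (RGenOpens.measurableE R)).
  move=> _ [_ [a [b ->] <-]]; rewrite setTI.
  by apply: bg; exact: interval_open.
rewrite -[X in <<s _ >> X]setTI; apply: mg => //.
exact: open_measurable.
Qed.

(** An open set is the countable union of the rational balls it contains, and a ball of the max norm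
    is a finite intersection of conditions on single coordinates. *)
Lemma measurable_rVP d (T : measurableType d) n (f : T -> rVB n) :
  (forall i, measurable_fun setT (fun t => f t ord0 i)) -> measurable_fun setT f.
Proof.
move=> mf; apply: (@measurability _ _ _ _ _ f (@open 'rV[R]_n)) => //.
move=> _ [U oU <-]; rewrite setTI.
pose I := ('rV[rat]_n * rat)%type.
pose B (i : I) : set 'rV[R]_n := ball (map_mx ratr i.1 : 'rV[R]_n) (ratr i.2).
pose F (i : I) : set T := if `[< B i `<=` U >] then f @^-1` B i else set0.
have -> : f @^-1` U = \bigcup_i F i.
  apply/seteqP; split => [t /= Ut|t [i _]]; last first.
    by rewrite /F; case: asboolP => // BU Bt; exact: BU.
  have /nbhs_ballP[e /= e0 eU] : nbhs (f t) U by exact: open_nbhs_nbhs.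
  have /rat_in_itvoo[q] : 0 < e / 2 by rewrite divr_gt0.
  rewrite in_itv /= => /andP[q0 qe].
  have /(_ _)/cid-/all_sig[h hP] : forall j, exists x, ratr x \in `](f t ord0 j - ratr q), (f t ord0 j + ratr q)[ .
    by move=> j; apply: rat_in_itvoo; rewrite ltrBlDr -addrA ltrDl addr_gt0.
  pose c : 'rV[rat]_n := \row_j h j.
  have cb : ball (map_mx ratr c : 'rV[R]_n) (ratr q) (f t).
    split => // i j; rewrite !mxE ord1.
    have := hP j; rewrite in_itv/= => /andP[h1 h2].
    by rewrite /ball /= ltr_norml; apply/andP; split; lra.
  exists (c, q) => //; rewrite /F; case: asboolP => // nBU; exfalso; apply: nBU.
  apply: subset_trans eU => y /= yB.
  have -> : e = e / 2 + e / 2 by field.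
  apply: (@ball_triangle R 'rV[R]_n (map_mx ratr c)).
    by apply: ball_sym; apply: le_ball cb; exact: ltW.
  by apply: le_ball yB; exact: ltW.
apply: countable_bigcupT_measurable; first exact: countableP.
move=> i; rewrite /F; case: asboolP => // _.
case: (lerP (ratr i.2 : R) 0) => [q0|q0].
  rewrite (_ : _ @^-1` _ = set0) //.
  by apply/seteqP; split => // t /= [] /lt_geF; rewrite q0.
rewrite (_ : _ @^-1` _ = \bigcap_(j in [set: 'I_n])
   ((fun t => f t ord0 j) @^-1` ball (ratr (i.1 ord0 j) : R) (ratr i.2))).
  apply: fin_bigcap_measurable; first exact: finite_finset.
  move=> j _; rewrite -[X in measurable X]setTI; apply: mf => //.
  exact: measurable_ball.
apply/seteqP; split => [t /= [_ H] j _ /=|t H /=]; first by have := H ord0 j; rewrite !mxE.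
by split => // k j; rewrite !mxE ord1; exact: H.
Qed.

Lemma measurable_coord n (i : 'I_n) : measurable_fun setT (fun x : rVB n => x ord0 i).
Proof. by apply: continuous_measurable_rV; exact: coord_continuous. Qed.

Lemma measurable_rV_coord d (T : measurableType d) n (f : T -> rVB n) i :
  measurable_fun setT f -> measurable_fun setT (fun t => f t ord0 i).
Proof. by move=> mf; exact: (measurableT_comp (measurable_coord i)). Qed.

(** The argument of the integrand in the recursive clause of [intN], as a function of a pair, so
    that one step of [intN] is an iterated integral along [consrV]. *)
Definition consrV n (z : R * 'rV[R]_n) : 'rV[R]_n.+1 :=
  row_mx (const_mx z.1 : 'rV[R]_1) z.2.

Lemma consrV0 n (z : R * 'rV[R]_n) : consrV z ord0 ord0 = z.1.
Proof.
have e : (ord0 : 'I_n.+1) = lshift n (ord0 : 'I_1) by apply/val_inj.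
rewrite /consrV [X in _ _ X = _]e.
by etransitivity; [exact: (row_mxEl (const_mx z.1 : 'rV_1) z.2 ord0 ord0)|rewrite mxE].
Qed.

Lemma consrVS n (z : R * 'rV[R]_n) i : consrV z ord0 (lift ord0 i) = z.2 ord0 i.
Proof.
have e : lift ord0 i = rshift 1 i by apply/val_inj.
by rewrite /consrV e; exact: (row_mxEr (const_mx z.1 : 'rV_1) z.2 ord0 i).
Qed.

Definition tailrV n (x : 'rV[R]_n.+1) : 'rV[R]_n := \row_i x ord0 (lift ord0 i).

Lemma measurable_consrV n : measurable_fun setT (@consrV n : (R * rVB n)%type -> rVB n.+1).
Proof.
apply: measurable_rVP => i; case: (unliftP ord0 i) => [j|] ->.
  under eq_fun do rewrite consrVS.
  exact: (measurable_rV_coord j measurable_snd).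
by under eq_fun do rewrite consrV0; exact: measurable_fst.
Qed.

Lemma measurable_tailrV n : measurable_fun setT (@tailrV n : rVB n.+1 -> rVB n).
Proof.
apply: measurable_rVP => i; under eq_fun do rewrite mxE.
exact: measurable_coord.
Qed.

Definition leb : {sigma_finite_measure set (measurableTypeR R) -> \bar R} := @lebesgue_measure R.

Lemma consrV_affine n (c t : R) (v : 'rV[R]_n) (a : 'rV[R]_n.+1) :
  consrV (c * t + a ord0 ord0, c *: v + tailrV a) = c *: consrV (t, v) + a.
Proof.
apply/rowP => i; rewrite [RHS]mxE [X in _ = X + _]mxE.
by case: (unliftP ord0 i) => [j|] ->; rewrite ?consrVS ?consrV0 /= ?mxE.
Qed.

Section muS.
Variables (n : nat) (m : {sigma_finite_measure set (rVB n) -> \bar R}).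
Let c_mixin := @isMeasurableFun.Build _ _ (measurableTypeR R * rVB n)%type (rVB n.+1) _
  (@measurable_consrV n).
Let c : {mfun (measurableTypeR R * rVB n)%type >-> rVB n.+1} := HB.pack (@consrV n) c_mixin.

(** One step of [intN] as a measure: by Tonelli, integrating against this pushforward is integrating
    over [v], then over [t]. *)
Definition muS : set (rVB n.+1) -> \bar R := pushforward (leb \x m)%E c.

Let muS0 : muS set0 = 0%E.
Proof. exact: measure0. Qed.

Let muS_ge0 A : (0 <= muS A)%E.
Proof. exact: measure_ge0. Qed.

Let muS_sigma_additive : semi_sigma_additive muS.
Proof. exact: measure_semi_sigma_additive. Qed.

HB.instance Definition _ := isMeasure.Build _ _ _ muS muS0 muS_ge0 muS_sigma_additive.

Let muS_sigma_finite : sigma_finite setT muS.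
Proof.
have [F FT Ffin] := sigma_finite_product leb m.
pose k (x : rVB n.+1) : (measurableTypeR R * rVB n)%type := (x ord0 ord0, tailrV x).
have mk : measurable_fun setT k.
  by apply: measurable_fun_pair; [exact: measurable_coord|exact: measurable_tailrV].
exists (fun i => k @^-1` F i).
  by rewrite -preimage_bigcup -FT preimage_setT.
move=> i; have [mF Foo] := Ffin i; split.
  by rewrite -[X in measurable X]setTI; exact: mk.
rewrite /muS /pushforward -comp_preimage (_ : k \o c = id) //.
apply/funext => -[t v] /=; rewrite /k; congr pair; first exact: consrV0.
by apply/rowP => j; rewrite mxE consrVS.
Qed.

HB.instance Definition _ := @Measure_isSigmaFinite.Build _ _ _ muS muS_sigma_finite.

Lemma ge0_integral_muS (f : 'rV[R]_n.+1 -> \bar R) :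
  measurable_fun setT (f : rVB n.+1 -> \bar R) -> (forall x, 0 <= f x)%E ->
  (\int[muS]_x f x = \int[leb]_t \int[m]_v f (consrV (t, v)))%E.
Proof.
move=> mf f0; rewrite ge0_integral_pushforward // preimage_setT fubini_tonelli1 //.
  exact: measurableT_comp.
by move=> x; exact: f0.
Qed.

Lemma integral_muS (f : 'rV[R]_n.+1 -> \bar R) : muS.-integrable setT (f : rVB n.+1 -> \bar R) ->
  (\int[muS]_x f x = \int[leb]_t \int[m]_v f (consrV (t, v)))%E /\
  (leb \x m)%E.-integrable setT (fun z => f (consrV z)).
Proof.
move=> fi; have mf : measurable_fun setT (f : rVB n.+1 -> \bar R) by exact: measurable_int fi.
have fi' : (leb \x m)%E.-integrable setT (fun z => f (consrV z)).
  apply/integrableP; split; first exact: (measurableT_comp mf (@measurable_consrV n)).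
  move/integrableP : fi => [_].
  rewrite ge0_integral_pushforward // ?preimage_setT //; exact: measurableT_comp.
split => //; rewrite integral_pushforward //.
by rewrite preimage_setT -integral12_prod_meas1.
Qed.
End muS.

Fixpoint muN (n : nat) : {sigma_finite_measure set (rVB n) -> \bar R} :=
  match n return {sigma_finite_measure set (rVB n) -> \bar R} with
  | 0 => \d_(0 : rVB 0)
  | n'.+1 => muS (muN n')
  end.

Lemma ge0_intN n (f : 'rV[R]_n -> \bar R) :
  measurable_fun setT (f : rVB n -> \bar R) -> (forall x, 0 <= f x)%E ->
  intN f = (\int[muN n]_x f x)%E.
Proof.
elim: n f => [|n IH] f mf f0 /=.
  by rewrite integral_dirac // diracT mul1e.
rewrite ge0_integral_muS //; apply: eq_integral => t _; rewrite IH //.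
exact: (measurableT_comp mf (measurable_fun_pair2 t (@measurable_consrV n))).
Qed.

Lemma measurable_intN d (X : measurableType d) n (f : X * 'rV[R]_n -> \bar R) :
  measurable_fun setT (f : (X * rVB n)%type -> \bar R) ->
  measurable_fun setT (fun x => intN (fun v => f (x, v))).
Proof.
elim: n d X f => [|n IH] d X f mf /=; first exact: (measurable_fun_pair1 _ mf).
have mg : measurable_fun setT (fun z : (X * measurableTypeR R)%type =>
    intN (fun v : 'rV[R]_n => f (z.1, consrV (z.2, v)))).
  pose g (w : (X * measurableTypeR R)%type * 'rV[R]_n) := f (w.1.1, consrV (w.1.2, w.2)).
  apply: (IH _ _ g); apply: (measurableT_comp mf); apply: measurable_fun_pair.
    by apply: measurableT_comp => //; exact: measurable_fst.
  apply: (measurableT_comp (@measurable_consrV n)); apply: measurable_fun_pair.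
    by apply: measurableT_comp => //; exact: measurable_fst.
  exact: measurable_snd.
rewrite (_ : (fun x => _) = fun x => (\int[leb]_t
    ((fun z : (X * measurableTypeR R)%type => intN (fun v : 'rV[R]_n => f (z.1, consrV (z.2, v))))^\+ (x, t))
  - \int[leb]_t
    ((fun z : (X * measurableTypeR R)%type => intN (fun v : 'rV[R]_n => f (z.1, consrV (z.2, v))))^\- (x, t)))%E).
  apply: emeasurable_funB.
    by apply: measurable_fun_fubini_tonelli_F => //; exact: measurable_funepos.
  by apply: measurable_fun_fubini_tonelli_F => //; exact: measurable_funeneg.
by apply/funext => x; rewrite integralE; congr (_ - _)%E; apply: eq_integral => t _; rewrite ?funeposE ?funenegE.
Qed.

(** By Fubini only almost every section is integrable, so the induction hypothesis identifies the
    inner integrals almost everywhere. Measurability of the iterated integral then comes from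
    [measurable_intN]. *)
Lemma integrable_intN n (f : 'rV[R]_n -> \bar R) :
  (muN n).-integrable setT (f : rVB n -> \bar R) -> intN f = (\int[muN n]_x f x)%E.
Proof.
elim: n f => [|n IH] f fi /=.
  by rewrite integral_dirac ?diracT ?mul1e //; exact: measurable_int fi.
have [-> fi'] := integral_muS fi.
have mf : measurable_fun setT (f : rVB n.+1 -> \bar R) by exact: measurable_int fi.
have mg : measurable_fun setT ((fun z => f (consrV z)) : (measurableTypeR R * rVB n)%type -> \bar R).
  exact: (measurableT_comp mf (@measurable_consrV n)).
apply: ae_eq_integral => //.
- exact: (@measurable_intN _ _ n (fun z => f (consrV z))).
- exact: (measurable_fubini_F fi').
have := ae_integrable1 fi'; apply: filterS => t h _.
by rewrite -IH.
Qed.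

(** Both sides are measures in [A]; by uniqueness of Lebesgue measure a comparison on half-open
    intervals suffices. *)
Lemma leb_affine (c a : R) (A : set (measurableTypeR R)) : 0 < c -> measurable A ->
  leb A = (c%:E * leb [set t | A (c * t + a)%R])%E.
Proof.
move=> c0 mA.
pose phi : measurableTypeR R -> measurableTypeR R := fun t => c * t + a.
have mphi : measurable_fun setT phi by apply: measurable_funD => //; apply: measurable_funM.
pose m1 := (mscale (NngNum (ltW c0)) (pushforward leb phi) :
  {measure set (measurableTypeR R) -> \bar R}).
pose m' := m1 mphi.
rewrite [LHS](_ : _ = m' A) //.
apply: lebesgue_measure_unique => // _ [[u v] _ <-] /=.
rewrite /mscale /= /pushforward /=.
have -> : phi @^-1` `]u, v] = `](u - a) / c, (v - a) / c]%classic.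
  apply/seteqP; split => t /=; rewrite !in_itv /= /phi ltr_pdivrMr // ler_pdivlMr // ![_ * c]mulrC;
  by move=> /andP[? ?]; apply/andP; split; lra.
rewrite /leb !lebesgue_measure_itv /= !lte_fin ltr_pM2r ?invr_gt0 // ltrD2r.
case: ifP => uv; last by rewrite mule0.
by rewrite -!EFinD -EFinM; congr EFin; field; rewrite gt_eqF.
Qed.

Lemma ge0_integral_leb_affine (c a : R) (f : R -> \bar R) : 0 < c ->
  measurable_fun setT (f : measurableTypeR R -> \bar R) -> (forall t, 0 <= f t)%E ->
  (\int[leb]_t f t = c%:E * \int[leb]_t f (c * t + a)%R)%E.
Proof.
move=> c0 mf f0.
pose phi : measurableTypeR R -> measurableTypeR R := fun t => c * t + a.
have mphi : measurable_fun setT phi by apply: measurable_funD => //; apply: measurable_funM.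
pose m1 := (mscale (NngNum (ltW c0)) (pushforward leb phi) :
  {measure set (measurableTypeR R) -> \bar R}).
pose m' := m1 mphi.
rewrite (@eq_measure_integral _ _ _ _ m'); last by move=> A mA _; exact: leb_affine.
rewrite ge0_integral_mscale // ge0_integral_pushforward // preimage_setT.
Qed.

Lemma ge0_integral_muN_affine n (c : R) (a : 'rV[R]_n) (f : 'rV[R]_n -> \bar R) : 0 < c ->
  measurable_fun setT (f : rVB n -> \bar R) -> (forall t, 0 <= f t)%E ->
  (\int[muN n]_x f x = (c ^+ n)%:E * \int[muN n]_x f (c *: x + a)%R)%E.
Proof.
move=> c0; elim: n a f => [|n IH] a f mf f0 /=.
  by rewrite expr0 mul1e; apply: eq_integral => x _; congr f; apply/rowP; case.
have aff m (b : 'rV[R]_m) : measurable_fun setT ((fun x => c *: x + b) : rVB m -> rVB m).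
  apply: measurable_rVP => i; under eq_fun do rewrite !mxE.
  by apply: measurable_funD => //; apply: measurable_funM => //; exact: measurable_coord.
rewrite !ge0_integral_muS //; last exact: (measurableT_comp mf).
have mf2 : measurable_fun setT (fun z : (measurableTypeR R * rVB n)%type => f (@consrV n z)).
  exact: (measurableT_comp mf (@measurable_consrV n)).
have h0 t : (0 <= \int[muN n]_v f (consrV (t, v)))%E by exact: integral_ge0.
have := @ge0_integral_leb_affine c (a ord0 ord0) (fun t => \int[muN n]_v f (consrV (t, v)))%E c0
  (@measurable_fun_fubini_tonelli_F _ _ _ _ _ (muN n) _ mf2 (fun z => f0 _)) h0.
move=> ->.
rewrite exprS EFinM -muleA; congr (_ * _)%E.
rewrite -ge0_integralZl //; last 3 first.
- apply: (@measurable_fun_fubini_tonelli_F _ _ _ _ _ (muN n)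
    (fun z : (measurableTypeR R * rVB n)%type => f (c *: consrV z + a))) => //.
  apply: (measurableT_comp mf); apply: (measurableT_comp (aff _ _)).
  exact: measurable_consrV.
- by move=> t _; exact: integral_ge0.
- by rewrite lee_fin exprn_ge0 // ltW.
apply: eq_integral => t _.
have mf3 := measurableT_comp mf (measurable_fun_pair2 (c * t + a ord0 ord0) (@measurable_consrV n)).
rewrite (IH (tailrV a) _ mf3 (fun _ => f0 _)).
congr (_ * _)%E; apply: eq_integral => v _; congr f.
exact: consrV_affine.
Qed.
End BorelRow.

(** * Euclidean norm and real powers *)

Section Euclid.
Variables (R : realType) (n : nat).
Implicit Types x y z : 'rV[R]_n.

Lemma eucl_sum_ge0 x : 0 <= \sum_(i < n) x ord0 i ^+ 2.
Proof. by apply: sumr_ge0 => i _; exact: sqr_ge0. Qed.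

Lemma eucl_ge0 x : 0 <= eucl x.
Proof. exact: sqrtr_ge0. Qed.

Lemma sqr_eucl x : eucl x ^+ 2 = \sum_(i < n) x ord0 i ^+ 2.
Proof. by rewrite sqr_sqrtr // eucl_sum_ge0. Qed.

Lemma eucl0 : eucl (0 : 'rV[R]_n) = 0.
Proof. by rewrite /eucl big1 ?sqrtr0 // => i _; rewrite mxE expr0n. Qed.

Lemma coord_le_eucl x i : `|x ord0 i| <= eucl x.
Proof.
rewrite -(@ler_pXn2r _ 2) // ?nnegrE ?eucl_ge0 // sqr_eucl real_normK ?num_real //.
by rewrite (bigD1 i) //= lerDl; apply: sumr_ge0 => j _; exact: sqr_ge0.
Qed.

Lemma eucl_eq0 x : (eucl x == 0) = (x == 0).
Proof.
apply/eqP/eqP => [e|->]; last exact: eucl0.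
apply/rowP => i; rewrite mxE; apply/eqP; rewrite -normr_le0.
by rewrite -e; exact: coord_le_eucl.
Qed.

Lemma eucl_gt0 x : (0 < eucl x) = (x != 0).
Proof. by rewrite lt_neqAle eucl_ge0 andbT eq_sym eucl_eq0. Qed.

Lemma eucl_subr_gt0 x y : (0 < eucl (x - y)) = (x != y).
Proof. by rewrite eucl_gt0 subr_eq0. Qed.

Lemma euclZ (c : R) x : eucl (c *: x) = `|c| * eucl x.
Proof.
rewrite /eucl -sqrtr_sqr -sqrtrM ?sqr_ge0 //; congr Num.sqrt.
by rewrite mulr_sumr; apply: eq_bigr => i _; rewrite mxE exprMn.
Qed.

Lemma euclN x : eucl (- x) = eucl x.
Proof. by rewrite -scaleN1r euclZ normrN1 mul1r. Qed.

Lemma euclB_sym x y : eucl (x - y) = eucl (y - x).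
Proof. by rewrite -opprB euclN. Qed.

Lemma cauchy_schwarz_sum (a b : 'I_n -> R) (A B : R) :
  0 <= A -> 0 <= B -> \sum_(i < n) a i ^+ 2 <= A ^+ 2 -> \sum_(i < n) b i ^+ 2 <= B ^+ 2 ->
  \sum_(i < n) a i * b i <= A * B.
Proof.
move=> A0 B0 aA bB.
have sq0 (c : 'I_n -> R) : \sum_(i < n) c i ^+ 2 <= 0 -> forall i, c i = 0.
  move=> c0 i; have : \sum_(i < n) c i ^+ 2 == 0.
    by rewrite eq_le c0 /=; apply: sumr_ge0 => j _; exact: sqr_ge0.
  rewrite psumr_eq0; last by move=> j _; exact: sqr_ge0.
  by move=> /allP /(_ i (mem_index_enum _)); rewrite sqrf_eq0 => /eqP.
move: A0; rewrite le_eqVlt => /orP[/eqP A0|A0].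
  by rewrite -A0 mul0r big1 // => i _; rewrite sq0 ?mul0r // (le_trans aA) // -A0 expr0n.
move: B0; rewrite le_eqVlt => /orP[/eqP B0|B0].
  by rewrite -B0 mulr0 big1 // => i _; rewrite [b i]sq0 ?mulr0 // (le_trans bB) // -B0 expr0n.
(* Young's inequality [a b <= (t a^2 + b^2 / t) / 2] at [t = B / A] *)
apply: (@le_trans _ _ (\sum_(i < n) (B / A * a i ^+ 2 + A / B * b i ^+ 2) / 2)).
  apply: ler_sum => i _; rewrite ler_pdivlMr //.
  have -> : B / A * a i ^+ 2 + A / B * b i ^+ 2 =
      (B * a i - A * b i) ^+ 2 / (A * B) + a i * b i * 2.
    by field; rewrite !gt_eqF.
  by rewrite lerDr divr_ge0 ?sqr_ge0 // mulr_ge0 // ltW.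
rewrite -mulr_suml big_split /= -!mulr_sumr ler_pdivrMr //.
have -> : A * B * 2 = B / A * A ^+ 2 + A / B * B ^+ 2 by field; rewrite !gt_eqF.
by apply: lerD; rewrite ler_pM2l // divr_gt0.
Qed.

Lemma ler_euclD x y : eucl (x + y) <= eucl x + eucl y.
Proof.
rewrite -(@ler_pXn2r _ 2) // ?nnegrE ?eucl_ge0 ?addr_ge0 ?eucl_ge0 //.
rewrite sqrrD !sqr_eucl.
under eq_bigr do rewrite mxE sqrrD.
rewrite !big_split /= lerD2r lerD2l.
rewrite -mulr2n lerMn2r /=; apply: cauchy_schwarz_sum; rewrite ?eucl_ge0 ?sqr_eucl //.
Qed.

Lemma ler_euclB x y z : eucl (x - z) <= eucl (x - y) + eucl (y - z).
Proof. by rewrite (le_trans _ (ler_euclD _ _)) // addrA subrK. Qed.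

Lemma parallelogram_eucl x y :
  eucl (x + y) ^+ 2 + eucl (x - y) ^+ 2 = 2 * (eucl x ^+ 2 + eucl y ^+ 2).
Proof.
rewrite !sqr_eucl -!big_split /= mulr_sumr; apply: eq_bigr => i _.
by rewrite !mxE; ring.
Qed.

Lemma eucl_le_sum x : eucl x <= \sum_(i < n) `|x ord0 i|.
Proof.
rewrite -(@ler_pXn2r _ 2) // ?nnegrE ?eucl_ge0 ?sumr_ge0 //.
rewrite sqr_eucl expr2 mulr_suml; apply: ler_sum => i _.
rewrite -real_normK ?num_real // expr2 ler_wpM2l // (bigD1 i) //= lerDl.
exact: sumr_ge0.
Qed.

Lemma coord_le_norm x i : `|x ord0 i| <= `|x|.
Proof.
rewrite [leRHS]mx_normrE.
exact: (le_bigmax _ (fun ij : 'I_1 * 'I_n => `|x ij.1 ij.2|) (ord0, i)).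
Qed.

Lemma eucl_le_norm x : eucl x <= n%:R * `|x|.
Proof.
apply: (le_trans (eucl_le_sum x)); rewrite -[n in n%:R]card_ord -sum1_card natr_sum mulr_suml.
by apply: ler_sum => i _; rewrite mul1r; exact: coord_le_norm.
Qed.

Lemma norm_le_eucl x : `|x| <= eucl x.
Proof.
rewrite [leLHS]mx_normrE; apply: bigmax_le => /=; first exact: eucl_ge0.
by move=> [i j] _; rewrite ord1; exact: coord_le_eucl.
Qed.
End Euclid.

Section Powers.
Variable R : realType.
Implicit Types (x y a b p e : R).

Lemma powR_mono p a b : 0 <= p -> 0 <= a -> a <= b -> a `^ p <= b `^ p.
Proof. by move=> p0 a0 ab; apply: ge0_ler_powR; rewrite ?nnegrE // (le_trans a0). Qed.

Lemma powRK p a : 0 < p -> 0 <= a -> (a `^ p^-1) `^ p = a.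
Proof. by move=> p0 a0; rewrite -powRrM mulVf ?gt_eqF // powRr1. Qed.

Lemma powRVK p a : 0 < p -> 0 <= a -> (a `^ p) `^ p^-1 = a.
Proof. by move=> p0 a0; rewrite -powRrM mulfV ?gt_eqF // powRr1. Qed.

Lemma powR_div p a b : 0 <= a -> 0 <= b -> (a / b) `^ p = a `^ p / b `^ p.
Proof.
by move=> a0 b0; rewrite powRM ?invr_ge0 // -powR_inv1 // -powRrM mulN1r powRN.
Qed.

Lemma continuous_norm_powR p : 0 < p -> continuous (fun x => `|x| `^ p).
Proof.
move=> p0 x; have [->|x0] := eqVneq x 0.
  rewrite /continuous_at normr0 powR0 ?gt_eqF //; apply/cvgrPdist_lt => /= e e0.
  near=> y; rewrite sub0r normrN ger0_norm ?powR_ge0 //.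
  rewrite -[ltRHS](powRK p0 (ltW e0)) gt0_ltr_powR ?nnegrE ?powR_ge0 //.
  near: y; apply/nbhs_ballP; exists (e `^ p^-1) => /=; first exact: powR_gt0.
  by move=> y; rewrite /ball /= sub0r normrN.
have : {near x, (fun y => expR (p * ln `|y|)) =1 (fun y => `|y| `^ p)}.
  near=> y; rewrite /powR normr_eq0 ifF //; apply/negbTE; near: y.
  exact: (open_neq x0).
move=> /near_eq_cvg h; rewrite /continuous_at {2}/powR normr_eq0 (negbTE x0).
apply: cvg_trans h _.
apply: (@cvg_comp _ _ _ (fun y => p * ln `|y|) expR _ (nbhs (p * ln `|x|))); last exact: continuous_expR.
apply: cvgMl_tmp; apply: (@cvg_comp _ _ _ (fun y => `|y|) (@ln R) _ (nbhs `|x|)).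
  exact: norm_continuous.
by apply: continuous_ln; rewrite normr_gt0.
Unshelve. all: by end_near. Qed.

Lemma cvg_powR p (u : nat -> R) (l : R) : 0 < p -> (forall k, 0 <= u k) -> u @ \oo --> l ->
  (fun k => u k `^ p) @ \oo --> l `^ p.
Proof.
move=> p0 u0 ul; have l0 : 0 <= l.
  rewrite -(cvg_lim _ ul) //; apply: limr_ge; first by apply/cvg_ex; exists l.
  exact: nearW.
rewrite -[X in _ --> X `^ p](ger0_norm l0).
have -> : (fun k => u k `^ p) = (fun k => `|u k| `^ p) by apply/funext => k; rewrite ger0_norm.
apply: (@cvg_comp _ _ _ u (fun x => `|x| `^ p) _ (nbhs l)) => //.
exact: (continuous_norm_powR p0).
Qed.

(** Dichotomy on [b <= d * a], where [(1 + d)^p = 1 + e]: either [b] is absorbed by the first term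
    or [a] by the second. The factor close to 1 in front of [a^p] is what lets a cutoff cost
    arbitrarily little energy. *)
Lemma powRD_le p e : 0 < p -> 0 < e -> exists2 C, 0 <= C &
  forall a b, 0 <= a -> 0 <= b -> (a + b) `^ p <= (1 + e) * a `^ p + C * b `^ p.
Proof.
move=> p0 e0; pose d := (1 + e) `^ p^-1 - 1.
have d0 : 0 < d.
  have : 1 `^ p^-1 < (1 + e) `^ p^-1.
    by apply: gt0_ltr_powR; rewrite ?invr_gt0 ?nnegrE //; lra.
  by rewrite powR1 subr_gt0.
exists ((d^-1 + 1) `^ p) => [|a b a0 b0]; first exact: powR_ge0.
have [ba|ab] := lerP b (d * a).
  apply: (@le_trans _ _ ((1 + e) * a `^ p)); last by rewrite lerDl mulr_ge0 ?powR_ge0.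
  rewrite -[1 + e](@powRK p) //; last by lra.
  rewrite -powRM ?powR_ge0 //; apply: powR_mono; [exact: ltW|exact: addr_ge0|].
  rewrite (_ : _ `^ _ = 1 + d); last by rewrite /d; ring.
  by rewrite mulrDl mul1r lerD2l.
apply: (@le_trans _ _ ((d^-1 + 1) `^ p * b `^ p)).
  rewrite -powRM //; last by rewrite addr_ge0 // invr_ge0 ltW.
  apply: powR_mono; [exact: ltW|exact: addr_ge0|].
  by rewrite mulrDl mul1r lerD2r mulrC ler_pdivlMr // mulrC ltW.
by rewrite lerDr mulr_ge0 ?powR_ge0 //; lra.
Qed.

(** Young's inequality for [t] and [c^(p - 1)] with exponents [p] and [p / (p - 1)]. This form of
    convexity covers [t = 0] and [c = 0] as well. *)
Lemma powR_tangent p t c : 1 < p -> 0 <= t -> 0 <= c ->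
  c `^ p + p * c `^ (p - 1) * (t - c) <= t `^ p.
Proof.
move=> p1 t0 c0; have p0 : 0 < p by lra.
have q0 : 0 < p / (p - 1) by rewrite divr_gt0 // subr_gt0.
have := @conjugate_powR _ t (c `^ (p - 1)) p (p / (p - 1)) t0 (powR_ge0 _ _) p0 q0.
have -> : p^-1 + (p / (p - 1))^-1 = 1 by field; apply/andP; split; rewrite gt_eqF //; lra.
move=> /(_ erefl); rewrite -powRrM.
have -> : (p - 1) * (p / (p - 1)) = p by field; rewrite gt_eqF //; lra.
have -> : p * c `^ (p - 1) * (t - c) = p * (t * c `^ (p - 1)) - p * (c * c `^ (p - 1)) by ring.
rewrite mulr_powRB1 // => H.
have -> : t `^ p = p * (t `^ p / p + c `^ p / (p / (p - 1))) - (p - 1) * c `^ p.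
  by field; apply/andP; split; rewrite gt_eqF //; lra.
have : p * (t * c `^ (p - 1)) <= p * (t `^ p / p + c `^ p / (p / (p - 1))) by rewrite ler_pM2l.
lra.
Qed.
End Powers.

(** * Integrals of p-th powers *)

Section PowerIntegrals.
Variables (d : measure_display) (Z : measurableType d) (R : realType).
Variable nu : {measure set Z -> \bar R}.
Implicit Types (F G : Z -> R) (p : R).

Definition Epow p F : \bar R := (\int[nu]_z (F z `^ p)%:E)%E.

Lemma measurable_Epow p F : measurable_fun setT F ->
  measurable_fun setT (fun z => (F z `^ p)%:E).
Proof.
move=> mF; apply/measurable_EFinP.
exact: (measurableT_comp (measurable_powR p) mF).
Qed.

Lemma powR_EFin_ge0 p F (D : set Z) z : D z -> (0 <= (F z `^ p)%:E)%E.
Proof. by rewrite lee_fin powR_ge0. Qed.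

Lemma Epow_ge0 p F : (0 <= Epow p F)%E.
Proof. by apply: integral_ge0 => z _; rewrite lee_fin powR_ge0. Qed.

Lemma le_Epow p F G : 0 <= p -> measurable_fun setT F -> measurable_fun setT G ->
  (forall z, 0 <= F z) -> (forall z, F z <= G z) -> (Epow p F <= Epow p G)%E.
Proof.
move=> p0 mF mG F0 FG; apply: ge0_le_integral => //.
- by move=> z _; rewrite lee_fin powR_ge0.
- exact: measurable_Epow.
- exact: measurable_Epow.
- by move=> z _; rewrite lee_fin; exact: powR_mono.
Qed.

Lemma EpowZ p c F : 0 <= c -> measurable_fun setT F -> (forall z, 0 <= F z) ->
  Epow p (fun z => c * F z) = ((c `^ p)%:E * Epow p F)%E.
Proof.
move=> c0 mF F0; rewrite /Epow -ge0_integralZl //.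
- by apply: eq_integral => z _; rewrite powRM.
- exact: measurable_Epow.
- by move=> z _; rewrite lee_fin powR_ge0.
- by rewrite lee_fin powR_ge0.
Qed.

Lemma le_EpowD p e : 0 < p -> 0 < e -> exists2 C, 0 <= C & forall F G,
  measurable_fun setT F -> measurable_fun setT G ->
  (forall z, 0 <= F z) -> (forall z, 0 <= G z) ->
  (Epow p (fun z => F z + G z)%R <= (1 + e)%:E * Epow p F + C%:E * Epow p G)%E.
Proof.
move=> p0 e0; have [C C0 HC] := powRD_le p0 e0; exists C => // F G mF mG F0 G0.
have e1 : 0 <= 1 + e by lra.
rewrite /Epow -!ge0_integralZl ?lee_fin //;
  try exact: measurable_Epow; try exact: powR_EFin_ge0.
rewrite -ge0_integralD //; last 4 first.
- by move=> z _; rewrite lee_fin mulr_ge0 // powR_ge0.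
- by apply: emeasurable_funM => //; exact: measurable_Epow.
- by move=> z _; rewrite lee_fin mulr_ge0 // powR_ge0.
- by apply: emeasurable_funM => //; exact: measurable_Epow.
apply: ge0_le_integral => //.
- by move=> z _; rewrite lee_fin powR_ge0.
- by apply: measurable_Epow; exact: measurable_funD.
- by apply: emeasurable_funD; apply: emeasurable_funM => //; exact: measurable_Epow.
- by move=> z _; rewrite lee_fin; exact: HC.
Qed.

(* Brezis-Lieb splitting: [(B + A_k)^p - 2 A_k^p] is dominated by a multiple of [B^p]. *)
Lemma Epow_add_vanishing p (A : nat -> Z -> R) (B : Z -> R) (C M : R) (k0 : nat) : 0 < p ->
  (forall k, measurable_fun setT (A k)) -> (forall k z, 0 <= A k z) ->
  (forall k, (Epow p (A k) <= C%:E)%E) -> (forall z, A ^~ z @ \oo --> 0) ->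
  measurable_fun setT B -> (forall z, 0 <= B z) -> (Epow p B <= M%:E)%E ->
  exists2 k, (k0 <= k)%N & (Epow p (fun z => B z + A k z)%R <= (M + 2 * C + 1)%:E)%E.
Proof.
move=> p0 mA A0 AC Acvg mB B0 BM.
have [C0 C00 HC] := powRD_le p0 ltr01.
(* The 2 is the factor [1 + e] of [powRD_le] at [e = 1], which gives [h k z <= C0 * B z ^ p].
   Truncation at 0 supplies the lower bound for dominated convergence, and the limit is
   [B z ^ p]. *)
pose h k z := Num.max 0 ((B z + A k z) `^ p - 2 * A k z `^ p).
have mpow F : measurable_fun setT F -> measurable_fun setT (fun z => F z `^ p).
  by move=> mF; exact: (measurableT_comp (measurable_powR p) mF).
have mh k : measurable_fun setT (h k).
  apply: measurable_maxr => //; apply: measurable_funB.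
    by apply: mpow; exact: measurable_funD.
  by apply: measurable_funM => //; exact: mpow.
have iB : nu.-integrable setT (fun z => (C0 * B z `^ p)%:E).
  apply/integrableP; split; first by apply/measurable_EFinP; apply: measurable_funM => //; exact: mpow.
  under eq_integral do rewrite /= ger0_norm ?mulr_ge0 ?powR_ge0 // EFinM.
  rewrite ge0_integralZl ?lee_fin //; last 2 first.
  - exact: measurable_Epow.
  - by move=> z _; rewrite lee_fin powR_ge0.
  apply: (@le_lt_trans _ _ (C0%:E * M%:E)%E); last by rewrite -EFinM ltry.
  by apply: lee_wpmul2l => //; rewrite lee_fin.
have hle k z : (`|(h k z)%:E| <= (C0 * B z `^ p)%R%:E)%E.
  rewrite /= lee_fin ger0_norm ?le_max ?lexx // ge_max mulr_ge0 ?powR_ge0 //=.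
  by have := HC _ _ (A0 k z) (B0 z); rewrite [A k z + _]addrC; lra.
have hcvg z : (fun k => (h k z)%:E) @ \oo --> (B z `^ p)%:E.
  apply: cvg_EFin; first by near=> k.
  rewrite (_ : _ \o _ = h ^~ z) //.
  have : (fun k => (B z + A k z) `^ p - 2 * A k z `^ p) @ \oo --> B z `^ p.
    rewrite -[X in _ --> X]subr0; apply: cvgB.
      apply: cvg_powR => // [k|]; first exact: addr_ge0.
      by rewrite -[X in _ --> X]addr0; apply: cvgD; [exact: cvg_cst|exact: Acvg].
    rewrite -[X in _ --> X](mulr0 2); apply: cvgMl_tmp.
    by rewrite -[X in _ --> X](@powR0 R p) ?gt_eqF //; exact: cvg_powR.
  move=> /cvgrPdist_lt hc; apply/cvgrPdist_lt => e e0; near=> k.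
  have : `|B z `^ p - ((B z + A k z) `^ p - 2 * A k z `^ p)| < e by near: k; exact: hc.
  apply: le_lt_trans; rewrite /h; case: (lerP 0 ((B z + A k z) `^ p - 2 * A k z `^ p)) => // D0.
  rewrite subr0 ger0_norm ?powR_ge0 // (le_trans _ (ler_norm _)) // lerBrDl -lerBrDr subrr.
  exact: ltW.
have mhE k : measurable_fun setT (fun z => (h k z)%:E) by exact/measurable_EFinP.
have [_ _] := @dominated_convergence _ _ _ nu setT measurableT (fun k z => (h k z)%:E)
  (fun z => (B z `^ p)%:E) (fun z => (C0 * B z `^ p)%:E)
  mhE (measurable_Epow p mB)
  (aeW _ (fun z _ => hcvg z)) iB (aeW _ (fun z k _ => hle k z)).
move=> /= hint.
have EBfin : Epow p B \is a fin_num.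
  by rewrite ge0_fin_numE ?Epow_ge0 // (le_lt_trans BM) // ltry.
have [k kk0 hk] : exists2 k, (k0 <= k)%N & (\int[nu]_z (h k z)%:E <= (M + 1)%:E)%E.
  move: hint; rewrite -/(Epow p B) -(fineK EBfin) => /fine_cvgP[hfin] /cvgrPdist_lt /(_ 1 ltr01) hnear.
  have [n _ Hn] : \forall n \near \oo, (\int[nu]_z (h n z)%:E <= (M + 1)%:E)%E.
    near=> n.
    have hf : (\int[nu]_z (h n z)%:E)%E \is a fin_num by near: n.
    rewrite -(fineK hf) lee_fin.
    have : `|fine (Epow p B) - fine (\int[nu]_z (h n z)%:E)%E| < 1 by near: n.
    have : fine (Epow p B) <= M by rewrite -lee_fin fineK.
    rewrite ltr_norml => ? /andP[? ?]; lra.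
  by exists (maxn n k0); [exact: leq_maxr|apply: Hn => /=; exact: leq_maxl].
exists k => //.
apply: (@le_trans _ _ (2%:E * Epow p (A k) + \int[nu]_z (h k z)%:E)%E).
  rewrite /Epow -ge0_integralZl ?lee_fin //; last 2 first.
  - exact: measurable_Epow.
  - by move=> z _; rewrite lee_fin powR_ge0.
  rewrite -ge0_integralD //; last 3 first.
  - by move=> z _; rewrite lee_fin mulr_ge0 // powR_ge0.
  - by apply: emeasurable_funM => //; exact: measurable_Epow.
  - by move=> z _; rewrite lee_fin le_max lexx.
  apply: ge0_le_integral => //.
  - by move=> z _; rewrite lee_fin powR_ge0.
  - by apply: measurable_Epow; exact: measurable_funD.
  - apply: emeasurable_funD; last exact/measurable_EFinP.
    by apply: emeasurable_funM => //; exact: measurable_Epow.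
  - move=> z _; rewrite -EFinM -EFinD lee_fin -lerBlDl /h le_max lexx.
    by rewrite orbT.
rewrite (_ : M + 2 * C + 1 = 2 * C + (M + 1)); last by ring.
rewrite (EFinD (2 * C)); apply: leeD; last exact: hk.
by rewrite EFinM; apply: lee_wpmul2l => //; rewrite lee_fin.
Unshelve. all: by end_near. Qed.

(** By [Epow_add_vanishing] each further index raises the energy of the sum by at most
    [L = 2 C + 1], as if the terms had disjoint supports. A sum of [K] terms then has energy at most
    [K L], and its average at most [K^(1 - p) L], which tends to 0 because [p > 1]. *)
Lemma cesaro_Epow_small p (A : nat -> Z -> R) (C e : R) (k0 : nat) : 1 < p ->
  (forall k, measurable_fun setT (A k)) -> (forall k z, 0 <= A k z) ->
  (forall k, (Epow p (A k) <= C%:E)%E) -> (forall z, A ^~ z @ \oo --> 0) -> 0 < e ->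
  exists s : seq nat, [/\ (0 < size s)%N, all (leq k0) s &
    (Epow p (fun z => (size s)%:R^-1 * \sum_(k <- s) A k z)%R <= e%:E)%E].
Proof.
move=> p1 mA A0 AC Acvg e0; have p0 : 0 < p by lra.
have mS (s : seq nat) : measurable_fun setT (fun z => \sum_(k <- s) A k z).
  by apply: measurable_sum => k; exact: mA.
have C0 : 0 <= C by rewrite -lee_fin (le_trans _ (AC 0%N)) // Epow_ge0.
pose L := 2 * C + 1.
have [s0 Hs0] : exists s : nat -> seq nat, forall K, [/\ size (s K) = K, all (leq k0) (s K) &
    (Epow p (fun z => \sum_(k <- s K) A k z)%R <= (K%:R * L)%:E)%E].
  suff : forall K, exists s, [/\ size s = K, all (leq k0) s &
      (Epow p (fun z => \sum_(k <- s) A k z)%R <= (K%:R * L)%:E)%E].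
    by move=> H; have [f Hf] := choice H; exists f.
  elim=> [|K [s [sK sk sE]]].
    exists [::]; split => //; rewrite mul0r /Epow integral0_eq // => z _.
    by rewrite big_nil powR0 ?gt_eqF.
  have S0 z : 0 <= \sum_(k <- s) A k z by apply: sumr_ge0.
  have [k kk0 kE] := Epow_add_vanishing k0 p0 mA A0 AC Acvg (mS s) S0 sE.
  exists (k :: s); split; [by rewrite /= sK|by rewrite /= kk0|].
  rewrite (_ : _.+1%:R * L = K%:R * L + 2 * C + 1); last by rewrite -natr1 /L; ring.
  apply: le_trans kE; rewrite le_eqVlt; apply/orP; left; apply/eqP.
  by apply: eq_integral => z _; rewrite big_cons addrC.
have L0 : 0 < L by rewrite /L; lra.
(* Large enough that [K^(p - 1) >= L / e]. *)
pose K := (Num.truncn ((L / e) `^ (p - 1)^-1)).+1.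
have [sK sk sE] := Hs0 K; exists (s0 K); split => //; first by rewrite sK.
rewrite sK EpowZ ?invr_ge0 //; last by move=> z; exact: sumr_ge0.
have K0 : 0 < K%:R :> R by rewrite ltr0n.
apply: (@le_trans _ _ ((K%:R^-1 `^ p)%:E * (K%:R * L)%:E)%E).
  by apply: lee_wpmul2l => //; rewrite lee_fin powR_ge0.
rewrite -EFinM lee_fin -[K%:R^-1]powR_inv1 ?(ltW K0) // -powRrM mulN1r powRN.
rewrite ler_pdivrMl ?powR_gt0 // -(mulr_powRB1 (ltW K0) p0) -mulrA ler_pM2l //.
rewrite mulrC -ler_pdivrMl // mulrC.
apply: (@le_trans _ _ (((L / e) `^ (p - 1)^-1) `^ (p - 1))).
  by rewrite powRK ?subr_gt0 // divr_ge0 // ltW.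
apply: powR_mono; rewrite ?powR_ge0 ?subr_ge0 //; first exact: ltW.
by apply/ltW; rewrite /K; apply: truncnS_gt.
Qed.
End PowerIntegrals.

(** * Smooth functions *)

Section Smooth.
Variables (R : realType) (n : nat).
Local Notation V := 'rV[R]_n.
Implicit Types (f g : V -> R) (x y v h : V).

Lemma is_derive_line f x v (t : R) : differentiable f (x + t *: v) ->
  is_derive t 1 (fun s : R => f (x + s *: v)) (derive f (x + t *: v) v).
Proof.
move=> df.
have dl : is_diff (t : R) (fun s : R => x + s *: v) (fun s : R => s *: v).
  by apply: is_diff_eq; rewrite add0r.
have dfd : is_diff (x + t *: v) f ('d f (x + t *: v)) by exact/differentiableP.
have dc := @is_diff_comp _ _ _ _ _ _ _ _ _ dl dfd.
have dd : differentiable (fun s : R => f (x + s *: v)) t by exact: (@ex_diff _ _ _ _ _ _ _ dc).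
apply: DeriveDef; first exact/derivable1_diffP.
rewrite !deriveE //; have /= -> := @diff_val _ _ _ _ _ _ _ dc.
by rewrite /= scale1r.
Qed.

Lemma derive_sum_coord f x v : differentiable f x ->
  derive f x v = \sum_(i < n) v ord0 i * derive f x (delta_mx ord0 i).
Proof.
move=> df; rewrite deriveE // {1}(matrix_sum_delta v) big_ord1 linear_sum /=.
by apply: eq_bigr => i _; rewrite linearZ /= deriveE.
Qed.

Lemma mean_value_line f x v : (forall y, differentiable f y) ->
  exists2 t : R, 0 <= t <= 1 & f (x + v) - f x = derive f (x + t *: v) v.
Proof.
move=> df; pose F (s : R) := f (x + s *: v).
have dF (t : R) : is_derive t 1 F (derive f (x + t *: v) v) by exact: is_derive_line.
have cF : {within `[0, 1], continuous F}.
  apply: continuous_subspaceT => t; apply: differentiable_continuous.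
  by apply/derivable1_diffP; exact: (@ex_derive _ _ _ _ _ _ _ (dF t)).
have [c c01] := @MVT _ F _ 0 1 ltr01 (fun t _ => dF t) cF.
rewrite /F scale1r scale0r addr0 subr0 mulr1 => ->.
by exists c => //; move: c01; rewrite in_itv /= => /andP[/ltW -> /ltW ->].
Qed.

(** A coinduction principle: smoothness is shown by exhibiting a class of differentiable functions
    that contains its derivatives, so that formulas for higher derivatives never have to be
    written. *)
Lemma smooth_closed (S : (V -> R) -> Prop) f :
  (forall g x, S g -> differentiable g x) ->
  (forall g v, S g -> S (fun x => derive g x v)) -> S f -> smooth f.
Proof.
move=> dS cS Sf vs x; apply: dS; elim: vs => //= v vs IH.
exact: cS.
Qed.

Lemma smooth_differentiable f x : smooth f -> differentiable f x.
Proof. by move=> /(_ [::] x). Qed.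

Lemma smooth_continuous f : smooth f -> continuous f.
Proof. by move=> sf x; apply: differentiable_continuous; exact: smooth_differentiable. Qed.

Lemma smooth_derive f v : smooth f -> smooth (fun x => derive f x v).
Proof.
(* The head of the list is the outermost derivative, so the direction that is applied first goes to
   the end. *)
move=> sf vs x; have := sf (vs ++ [:: v]) x.
suff -> : Diter (vs ++ [:: v]) f = Diter vs (fun x => derive f x v) by [].
by elim: vs => //= w vs ->.
Qed.

Lemma smoothD f g : smooth f -> smooth g -> smooth (fun x => f x + g x).
Proof.
move=> sf sg; apply: (@smooth_closed (fun k => exists f g,
  [/\ smooth f, smooth g & k = fun x => f x + g x])); last by exists f, g.
  move=> _ x [a [b [sa sb ->]]].
  by apply: differentiableD; exact: smooth_differentiable.
move=> _ v [a [b [sa sb ->]]].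
exists (fun x => derive a x v), (fun x => derive b x v).
split; [exact: smooth_derive|exact: smooth_derive|].
apply/funext => x; rewrite -deriveD //; apply: diff_derivable; exact: smooth_differentiable.
Qed.

Lemma smooth_cst (c : R) : smooth (fun _ : V => c).
Proof.
apply: (@smooth_closed (fun k => exists c, k = fun=> c)); last by exists c.
  by move=> _ x [a ->]; exact: differentiable_cst.
by move=> _ v [a ->]; exists 0; apply/funext => x; rewrite derive_cst.
Qed.

(** Sums of products of iterated derivatives: by the Leibniz rule this class contains its
    directional derivatives. *)
Inductive prod_span f g : (V -> R) -> Prop :=
| prod_span_prod vs ws : prod_span f g (fun x => Diter vs f x * Diter ws g x)
| prod_span_add a b : prod_span f g a -> prod_span f g b -> prod_span f g (fun x => a x + b x).

Lemma smoothM f g : smooth f -> smooth g -> smooth (fun x => f x * g x).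
Proof.
move=> sf sg; have dS k x : prod_span f g k -> differentiable k x.
  elim=> [vs ws|a b _ da _ db]; last exact: differentiableD.
  by apply: differentiableM; [exact: sf|exact: sg].
apply: (@smooth_closed (prod_span f g)) => //; last exact: (@prod_span_prod _ _ [::] [::]).
move=> k v; elim=> [vs ws|a b Sa Da Sb Db]; last first.
  suff -> : (fun x => derive (fun x => a x + b x) x v) =
      fun x => derive a x v + derive b x v by exact: prod_span_add.
  by apply/funext => x; rewrite -deriveD //; apply: diff_derivable; exact: dS.
suff -> : (fun x => derive (fun x => Diter vs f x * Diter ws g x) x v) =
    fun x => Diter vs f x * Diter (v :: ws) g x + Diter (v :: vs) f x * Diter ws g x.
  by apply: prod_span_add; exact: prod_span_prod.
apply/funext => x; rewrite [LHS]deriveM; last 2 first.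
- by apply: diff_derivable; exact: sf.
- by apply: diff_derivable; exact: sg.
by rewrite /= [X in _ + X]mulrC.
Qed.

Lemma smoothZ (c : R) f : smooth f -> smooth (fun x => c * f x).
Proof. by move=> sf; apply: smoothM => //; exact: smooth_cst. Qed.

Lemma smooth_sum (I : Type) (r : seq I) (F : I -> V -> R) :
  (forall i, smooth (F i)) -> smooth (fun x => \sum_(i <- r) F i x).
Proof.
move=> sF; elim: r => [|i r IH].
  by under eq_fun do rewrite big_nil; exact: smooth_cst.
by under eq_fun do rewrite big_cons; exact: smoothD.
Qed.

Lemma is_diff_affine (c : R) (a x : V) : is_diff x (fun y => c *: y + a) (fun y => c *: y).
Proof. by apply: is_diff_eq; rewrite addr0. Qed.

Lemma differentiable_affine f (c : R) (a x : V) : differentiable f (c *: x + a) ->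
  differentiable (fun y => f (c *: y + a)) x.
Proof.
move=> df; apply: (@differentiable_comp _ _ _ _ (fun y => c *: y + a)) => //.
Qed.

Lemma deriveZdir f (c : R) (x v : V) : differentiable f x ->
  derive f x (c *: v) = c * derive f x v.
Proof. by move=> df; rewrite !deriveE // linearZ. Qed.

Lemma derive_affine f (c : R) (a x v : V) : differentiable f (c *: x + a) ->
  derive (fun y => f (c *: y + a)) x v = c * derive f (c *: x + a) v.
Proof.
move=> df; have := differentiable_affine df; set G := fun y => _ => dG.
have := @is_derive_line G x v 0; rewrite scale0r addr0 => /(_ dG) d1.
have := @is_derive_line f (c *: x + a) (c *: v) 0.
rewrite scale0r addr0 => /(_ df) d2.
rewrite -(deriveZdir c v df) -(@derive_val _ _ _ _ _ _ _ d1) -(@derive_val _ _ _ _ _ _ _ d2).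
congr (derive _ (0 : R) (1 : R)); apply/funext => s.
by rewrite /G scalerDr addrAC !scalerA [c * s]mulrC.
Qed.

Lemma smooth_affine f (c : R) (a : V) : smooth f -> smooth (fun x => f (c *: x + a)).
Proof.
move=> sf; apply: (@smooth_closed (fun k => exists2 g, smooth g & k = fun x => g (c *: x + a)));
  last by exists f.
  by move=> _ x [g sg ->]; apply: differentiable_affine; exact: smooth_differentiable.
move=> _ v [g sg ->]; exists (fun x => c * derive g x v).
  by apply: smoothZ; exact: smooth_derive.
by apply/funext => x; rewrite derive_affine //; exact: smooth_differentiable.
Qed.
End Smooth.

(** * Flat functions on the real line *)

Section Theta.
Variable R : realType.
Implicit Types t : R.

Definition theta (j : nat) (t : R) : R := if t <= 0 then 0 else t^-1 ^+ j * expR (- t^-1).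

Lemma theta_le0 j t : t <= 0 -> theta j t = 0.
Proof. by rewrite /theta => ->. Qed.

Lemma theta_gt0E j t : 0 < t -> theta j t = t^-1 ^+ j * expR (- t^-1).
Proof. by move=> t0; rewrite /theta leNgt t0. Qed.

Lemma theta_ge0 j t : 0 <= theta j t.
Proof.
rewrite /theta; case: ifPn => //; rewrite -ltNge => t0.
by rewrite mulr_ge0 ?expR_ge0 // exprn_ge0 // invr_ge0 ltW.
Qed.

(** One term of the exponential series at [1 / t]: [(1 / t)^j / j! <= exp (1 / t)]. *)
Lemma theta_bound j t : theta j t <= j`!%:R.
Proof.
have [t0|t0] := lerP t 0; first by rewrite theta_le0.
rewrite theta_gt0E // expRN ler_pdivrMr ?expR_gt0 //.
have s0 : 0 <= t^-1 by rewrite invr_ge0 ltW.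
case: j => [|j]; first by rewrite expr0 fact0 mul1r -[1]expR0 ler_expR.
have := expR_ge1Dxn j s0; have f0 : 0 < (j.+1)`!%:R :> R by rewrite ltr0n fact_gt0.
move=> h; rewrite mulrC -ler_pdivrMr //; lra.
Qed.

Lemma thetaS j t : theta j t = theta j.+1 t * t.
Proof.
have [t0|t0] := lerP t 0; first by rewrite !theta_le0 // mul0r.
by rewrite !theta_gt0E // exprS; field; rewrite gt_eqF.
Qed.

(** Away from 0 this is calculus. At 0, [thetaS] used twice turns the difference quotient into
    [theta j.+2 h * h], and [theta_bound] makes it tend to 0. *)
Lemma is_derive_theta j t : is_derive t 1 (theta j) (theta j.+2 t - j%:R * theta j.+1 t).
Proof.
have [t0|t0|->] := ltgtP t 0.
- rewrite !theta_le0 ?(ltW t0) // mulr0 subr0.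
  apply: (@near_eq_is_derive _ _ _ (cst 0)).
  near=> s; rewrite theta_le0 //; apply: ltW; near: s; exact: lt_nbhsl.
- have tn : t != 0 by rewrite gt_eqF.
  have di : is_derive t 1 (fun s : R => s^-1) (- t ^- 2).
    have did : derivable (@id R) t 1 by exact: derivable_id.
    have := @deriveV R _ id t 1 tn did.
    rewrite derive_id /= => e; apply: DeriveDef.
      exact: (@derivableV R _ id t 1 tn did).
    by rewrite [LHS]e -mulr_algl scaler1 mulr1.
  have dX := @is_deriveX _ _ _ j t 1 _ di.
  have dN := @is_deriveN _ _ _ _ _ _ _ di.
  have dE := @is_derive1_comp _ expR _ t _ _ (is_derive_expR _) dN.
  have dM := is_deriveM dX dE.
  have dT : is_derive t 1 (fun s : R => s^-1 ^+ j * expR (- s^-1)) (theta j.+2 t - j%:R * theta j.+1 t).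
    move: dM; have -> : ((fun s : R => s^-1) ^+ j * (expR \o - (fun s : R => s^-1)) : R -> R) =
        fun s => s^-1 ^+ j * expR (- s^-1) by rewrite exprfctE.
    set w := (X in is_derive _ _ _ X -> _) => dM; suff <- : w = theta j.+2 t - j%:R * theta j.+1 t by [].
    have -> : w = t^-1 ^+ j * (expR (- t^-1) * - - t ^- 2) +
        expR (- t^-1) * ((j%:R * t^-1 ^+ j.-1) * - t ^- 2) by rewrite /w exprfctE.
    rewrite !theta_gt0E // {dM w}.
    case: j {dX} => [|k]; first by rewrite !mul0r expr0; field.
    by rewrite /= !exprS; field.
  apply: near_eq_is_derive dT.
  near=> s; rewrite theta_gt0E //; near: s; exact: lt_nbhsr.
- rewrite !theta_le0 // mulr0 subr0.
  have lim0 : (fun h : R => h^-1 *: (theta j (h *: 1 + 0) - theta j 0)) @ 0^' --> (0 : R).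
    apply/cvgrPdist_le => e e0.
    have f0 : 0 < (j.+2)`!%:R :> R by rewrite ltr0n fact_gt0.
    near=> h; rewrite sub0r normrN (theta_le0 _ (lexx 0)) subr0 addr0.
    rewrite scaler1 [h^-1 *: _]/(h^-1 * _) normrM normfV ler_pdivrMl; last first.
      by rewrite normr_gt0; near: h; exact: nbhs_dnbhs_neq.
    rewrite thetaS thetaS !normrM mulrC ler_pM2l; last first.
      by rewrite normr_gt0; near: h; exact: nbhs_dnbhs_neq.
    rewrite ger0_norm ?theta_ge0 //.
    apply: (@le_trans _ _ ((j.+2)`!%:R * `|h|)); first by rewrite ler_wpM2r // theta_bound.
    rewrite -ler_pdivlMl // mulrC.
    near: h; apply: nbhs_dnbhs; apply/nbhs_ballP; exists (e / (j.+2)`!%:R) => /=; first exact: divr_gt0.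
    by move=> y; rewrite /ball /= sub0r normrN => /ltW.
  by apply: DeriveDef; [apply/cvg_ex; exists 0|exact: cvg_lim lim0].
Unshelve. all: by end_near. Qed.
End Theta.

Lemma lipschitz_continuous (R : realType) (W : normedModType R) (f : W -> R) (C : R) :
  (forall x y, `|f x - f y| <= C * `|x - y|) -> continuous f.
Proof.
move=> fC x; apply/cvgrPdist_le => e e0; near=> y.
apply: (le_trans (fC x y)); apply: (@le_trans _ _ ((`|C| + 1) * `|x - y|)).
  by rewrite ler_wpM2r // (le_trans (ler_norm _)) // lerDl.
rewrite -ler_pdivlMl ?ltr_wpDl // mulrC; near: y; apply: cvgr_dist_le; first exact: cvg_id.
by rewrite divr_gt0 // ltr_wpDl.
Unshelve. all: by end_near. Qed.

(** * Compact supports, Lipschitz and Taylor bounds *)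

Section CompactSupport.
Variables (R : realType) (n : nat).
Local Notation V := 'rV[R]_n.
Implicit Types (f g : V -> R) (x y v : V).

Lemma ler_dist_eucl x y : `|eucl x - eucl y| <= eucl (x - y).
Proof.
rewrite ler_norml; apply/andP; split.
  by rewrite lerNl opprB lerBlDr euclB_sym (le_trans _ (ler_euclD _ _)) // subrK.
by rewrite lerBlDr (le_trans _ (ler_euclD _ _)) // subrK.
Qed.

Lemma continuous_eucl : continuous (@eucl R n).
Proof.
apply: (@lipschitz_continuous _ V _ n%:R) => x y.
by rewrite (le_trans (ler_dist_eucl _ _)) // eucl_le_norm.
Qed.

Lemma compact_euclid_ball (r : R) : compact [set x : V | eucl x <= r].
Proof.
apply: bounded_closed_compact.
  exists r; split; first exact: num_real.
  by move=> M rM x /= xr; rewrite (le_trans (norm_le_eucl _)) // (le_trans xr) // ltW.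
apply: (@preimage_closed _ _ (@eucl R n) [set t | t <= r]); last exact: closed_le.
by move=> x _; exact: continuous_eucl.
Qed.

Lemma open_euclid_compl (r : R) : open [set x : V | r < eucl x].
Proof.
apply: (@open_comp _ _ (@eucl R n) [set t | r < t]); last exact: open_gt.
by move=> x _; exact: continuous_eucl.
Qed.

Lemma continuous_bounded_on_ball f (r : R) : continuous f ->
  exists2 M, 0 <= M & forall x, eucl x <= r -> `|f x| <= M.
Proof.
move=> cf; have [r0|r0] := ltP r 0.
  by exists 0 => // x; rewrite leNgt (lt_le_trans r0 (eucl_ge0 x)).
have [||c _ cM] := @EVT_max_rV R n (fun x => `|f x|) [set x : V | eucl x <= r] _ (@compact_euclid_ball r).
- by exists 0; rewrite /= eucl0.
- apply: continuous_subspaceT => x.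
  by apply: (@continuous_comp _ _ _ f (fun t => `|t|)); [exact: cf|exact: norm_continuous].
by exists `|f c| => // x xr; apply: cM; rewrite inE.
Qed.

Lemma compact_support_bounded f : continuous f -> compact_support f ->
  exists2 M, 0 <= M & forall x, `|f x| <= M.
Proof.
move=> cf [r fr]; have [M M0 HM] := continuous_bounded_on_ball r cf.
exists M => // x; have [/HM //|/fr ->] := lerP (eucl x) r.
by rewrite normr0.
Qed.

Lemma derive_support f (r : R) v : (forall x, r < eucl x -> f x = 0) ->
  forall x, r < eucl x -> derive f x v = 0.
Proof.
move=> fr x rx; rewrite (@near_eq_derive _ _ _ f (cst 0)) ?derive_cst //.
near=> y; apply: fr; near: y; apply: open_nbhs_nbhs; split => //.
exact: open_euclid_compl.
Unshelve. all: by end_near. Qed.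

Lemma Cc_inf_derive f v : Cc_inf f -> Cc_inf (fun x => derive f x v).
Proof.
move=> [sf [r fr]]; split; first exact: smooth_derive.
by exists r; exact: derive_support.
Qed.

Lemma Cc_inf_continuous f : Cc_inf f -> continuous f.
Proof. by move=> [sf _]; exact: smooth_continuous. Qed.

Lemma Cc_inf_bounded f : Cc_inf f -> exists2 M, 0 <= M & forall x, `|f x| <= M.
Proof. by move=> cf; apply: compact_support_bounded; [exact: Cc_inf_continuous|case: cf]. Qed.

Lemma Cc_infM f g : smooth f -> Cc_inf g -> Cc_inf (fun x => f x * g x).
Proof.
move=> sf [sg [r gr]]; split; first exact: smoothM.
by exists r => x /gr ->; rewrite mulr0.
Qed.

Lemma Cc_infZ (c : R) f : Cc_inf f -> Cc_inf (fun x => c * f x).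
Proof. by apply: Cc_infM; exact: smooth_cst. Qed.

Lemma Cc_inf_affine f (c : R) (a : V) : c != 0 -> Cc_inf f -> Cc_inf (fun x => f (c *: x + a)).
Proof.
move=> c0 [sf [r fr]]; split; first exact: smooth_affine.
exists ((r + eucl a) / `|c|) => x; rewrite ltr_pdivrMr ?normr_gt0 // => h; apply: fr.
have := ler_euclD (c *: x + a) (- a); rewrite addrK euclZ euclN => h2.
by rewrite mulrC in h; lra.
Qed.

Lemma sumr_le_natmul (F : 'I_n -> R) (b : R) : (forall i, F i <= b) ->
  \sum_(i < n) F i <= n%:R * b.
Proof.
move=> Fb; apply: (@le_trans _ _ (\sum_(i < n) b)); first exact: ler_sum.
by rewrite sumr_const card_ord mulr_natl.
Qed.

Lemma lipschitz_of_bounded_derive f (C : R) : (forall x, differentiable f x) ->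
  (forall i x, `|derive f x (delta_mx ord0 i)| <= C) ->
  forall x h, `|f (x + h) - f x| <= n%:R * C * `|h|.
Proof.
move=> df dC x h; have [t _ ->] := mean_value_line x h df.
rewrite derive_sum_coord // (le_trans (ler_norm_sum _ _ _)) //.
rewrite -mulrA; apply: sumr_le_natmul => i.
rewrite mulrC normrM; apply: ler_pM => //; exact: coord_le_norm.
Qed.

(** The mean value theorem along the segment reduces the remainder to increments of the partial
    derivatives, to which the Lipschitz bound applies. Each of the two sums over coordinates costs a
    factor [n]. *)
Lemma taylor_of_bounded_derive2 f (C : R) : (forall x, differentiable f x) ->
  (forall i x, differentiable (fun y => derive f y (delta_mx ord0 i)) x) ->
  (forall i j x, `|derive (fun y => derive f y (delta_mx ord0 i)) x (delta_mx ord0 j)| <= C) ->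
  forall x h, `|f (x + h) - f x - derive f x h| <= n%:R ^+ 2 * C * `|h| ^+ 2.
Proof.
move=> df d2f dC x h; have [t /andP[t0 t1] ->] := mean_value_line x h df.
rewrite !derive_sum_coord // -sumrB (le_trans (ler_norm_sum _ _ _)) //.
rewrite [X in _ <= X](_ : _ = n%:R * (`|h| * (n%:R * C * `|h|))); last by ring.
apply: sumr_le_natmul => i; rewrite -mulrBr normrM.
apply: ler_pM => //; first exact: coord_le_norm.
apply: (le_trans (lipschitz_of_bounded_derive (d2f i) (dC i) x (t *: h))).
have nC0 : 0 <= n%:R * C by rewrite mulr_ge0 // (le_trans _ (dC i i x)).
by rewrite ler_wpM2l // normrZ ger0_norm // ler_piMl.
Qed.
End CompactSupport.

(** * Bump functions *)

Section Bump.
Variables (R : realType) (n : nat).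
Local Notation V := 'rV[R]_n.
Implicit Types (f g k : V -> R) (x y v : V) (r : R).

(** This is [r^2 - |x|^2], written with the sum of squares because [eucl] is not differentiable at
    0. *)
Definition sq_gap r x : R := r ^+ 2 - \sum_(i < n) x ord0 i ^+ 2.

(* The [theta j] arise by differentiating [exp (- 1 / t)], so this class is closed under
   directional derivatives. *)
Inductive radial_bump r : (V -> R) -> Prop :=
| bump_base j : radial_bump r (fun x => theta j (sq_gap r x))
| bump_coord i f : radial_bump r f -> radial_bump r (fun x => x ord0 i * f x)
| bump_add f g : radial_bump r f -> radial_bump r g -> radial_bump r (fun x => f x + g x)
| bump_scale c f : radial_bump r f -> radial_bump r (fun x => c * f x).

Lemma bump_sum r (I : Type) (s : seq I) (F : I -> V -> R) :
  (forall i, radial_bump r (F i)) -> radial_bump r (fun x => \sum_(i <- s) F i x).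
Proof.
move=> bF; elim: s => [|i s IH].
  have := bump_scale 0 (bump_base r 0).
  by under eq_fun do rewrite mul0r; under [X in _ -> radial_bump r X]eq_fun do rewrite big_nil.
by under eq_fun do rewrite big_cons; exact: bump_add.
Qed.

Lemma bump_support r f x : 0 <= r -> radial_bump r f -> r <= eucl x -> f x = 0.
Proof.
move=> r0 bf rx; elim: bf => [j|i g _ IH|g h _ IHg _ IHh|c g _ IH].
- rewrite theta_le0 // /sq_gap -sqr_eucl subr_le0.
  by rewrite ler_pXn2r ?nnegrE ?eucl_ge0.
- by rewrite IH mulr0.
- by rewrite IHg IHh addr0.
- by rewrite IH mulr0.
Qed.

Lemma differentiable_sq_gap r x : differentiable (sq_gap r) x.
Proof.
apply: differentiableB => //.
have -> : (fun y : V => \sum_(i < n) y ord0 i ^+ 2) = \sum_(i < n) (fun y : V => y ord0 i ^+ 2).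
  by apply/funext => y; rewrite fct_sumE.
apply: differentiable_sum => i; under eq_fun do rewrite expr2.
by apply: differentiableM; exact: differentiable_coord.
Qed.

Lemma derive_sq_gap r x v : derive (sq_gap r) x v = - 2 * \sum_(i < n) x ord0 i * v ord0 i.
Proof.
have d1 := @is_derive_line R n (sq_gap r) x v 0.
rewrite scale0r addr0 in d1; have {}d1 := d1 (differentiable_sq_gap r x).
rewrite -(@derive_val _ _ _ _ _ _ _ d1).
pose b := \sum_(i < n) x ord0 i * v ord0 i; pose c := \sum_(i < n) v ord0 i ^+ 2.
(* Along a line the function is a quadratic polynomial in the parameter, which is differentiated
   formally. *)
have -> : (fun s : R => sq_gap r (x + s *: v)) =
    horner ((sq_gap r x)%:P - (2 * b) *: 'X - c *: ('X * 'X)).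
  apply/funext => s; rewrite !(hornerD, hornerN, hornerZ, hornerM, hornerX, hornerC) /sq_gap.
  have -> : \sum_(i < n) (x + s *: v) ord0 i ^+ 2 =
      \sum_(i < n) x ord0 i ^+ 2 + 2 * b * s + c * s ^+ 2.
    rewrite /b /c mulr_sumr !mulr_suml -!big_split /=; apply: eq_bigr => i _.
    by rewrite !mxE; ring.
ring.
rewrite derive_val !(derivB, derivC, derivZ, derivX, derivM) -polyC1 !(hornerD, hornerN, hornerZ, hornerM, hornerX, hornerC) /b.
by ring.
Qed.

Lemma differentiable_bump_base r j x : differentiable (fun y => theta j (sq_gap r y)) x.
Proof.
apply: (@differentiable_comp _ _ _ _ (sq_gap r) (theta j)); first exact: differentiable_sq_gap.
by apply/derivable1_diffP; exact: (@ex_derive _ _ _ _ _ _ _ (is_derive_theta j _)).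
Qed.

Lemma derive_bump_base r j x v : derive (fun y => theta j (sq_gap r y)) x v =
  \sum_(i < n) ((- 2 * v ord0 i) * (x ord0 i *
    (theta j.+2 (sq_gap r x) + (- j%:R) * theta j.+1 (sq_gap r x)))).
Proof.
have d1 := @is_derive_line R n _ x v 0.
have := d1 (fun y => theta j (sq_gap r y)); rewrite scale0r addr0.
move=> /(_ (differentiable_bump_base r j x)) d2.
have := d1 (sq_gap r); rewrite scale0r addr0 => /(_ (differentiable_sq_gap r x)) {}d1.
have dt := is_derive_theta j (sq_gap r (x + 0 *: v)).
have := @is_derive1_comp _ (theta j) (fun s : R => sq_gap r (x + s *: v)) 0 _ _ dt d1.
move=> dc; rewrite -(@derive_val _ _ _ _ _ _ _ d2) -[LHS]/(derive (theta j \o fun s : R => sq_gap r (x + s *: v)) 0 1).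
rewrite (@derive_val _ _ _ _ _ _ _ dc) scale0r addr0 derive_sq_gap !mulr_sumr.
by apply: eq_bigr => i _; ring.
Qed.

Lemma differentiable_bump r f x : radial_bump r f -> differentiable f x.
Proof.
elim=> [j|i g _ IH|g h _ IHg _ IHh|c g _ IH].
- exact: differentiable_bump_base.
- by apply: differentiableM => //; exact: differentiable_coord.
- exact: differentiableD.
- exact: differentiableM.
Qed.

Lemma derive_coordinate i x v : derive (fun y : V => y ord0 i) x v = v ord0 i.
Proof.
have := @is_derive_line R n (fun y => y ord0 i) x v 0.
rewrite scale0r addr0 => /(_ (differentiable_coord _ _ _)) d1.
rewrite -(@derive_val _ _ _ _ _ _ _ d1).
have -> : (fun s : R => (x + s *: v) ord0 i) = horner ((x ord0 i)%:P + v ord0 i *: 'X).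
  by apply/funext => s; rewrite !hornerE !mxE mulrC.
by rewrite derive_val !(derivD, derivC, derivZ, derivX) !hornerE.
Qed.

Lemma bump_derive r f v : radial_bump r f -> radial_bump r (fun x => derive f x v).
Proof.
elim=> [j|i g bg IH|g h bg IHg bh IHh|c g bg IH].
- under eq_fun do rewrite derive_bump_base.
  apply: bump_sum => i; apply: bump_scale; apply: bump_coord; apply: bump_add.
    exact: bump_base.
  by apply: bump_scale; exact: bump_base.
- suff -> : (fun x => derive (fun x => x ord0 i * g x) x v) =
      fun x => x ord0 i * derive g x v + v ord0 i * g x.
    by apply: bump_add; [exact: bump_coord|exact: bump_scale].
  apply/funext => x; rewrite [LHS]deriveM; last 2 first.
  + by apply: diff_derivable; exact: differentiable_coord.
  + by apply: diff_derivable; exact: differentiable_bump bg.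
  by rewrite derive_coordinate [g x *: _]mulrC.
- suff -> : (fun x => derive (fun x => g x + h x) x v) =
      fun x => derive g x v + derive h x v by exact: bump_add.
  by apply/funext => x; rewrite [LHS]deriveD //; apply: diff_derivable; [exact: differentiable_bump bg|exact: differentiable_bump bh].
- suff -> : (fun x => derive (fun x => c * g x) x v) = fun x => c * derive g x v.
    exact: bump_scale.
  by apply/funext => x; rewrite [LHS]deriveZ //; apply: diff_derivable; exact: differentiable_bump bg.
Qed.

Lemma bump_Cc_inf r f : 0 <= r -> radial_bump r f -> Cc_inf f.
Proof.
move=> r0 bf; split.
  apply: (@smooth_closed _ _ (radial_bump r)) => //; first by move=> g x; exact: differentiable_bump.
  by move=> g v; exact: bump_derive.
by exists r => x /ltW; exact: bump_support.
Qed.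

Lemma Cc_inf_lipschitz f : Cc_inf f -> exists2 C, 0 <= C & forall x h, `|f (x + h) - f x| <= C * `|h|.
Proof.
move=> cf; have /choice[M HM] : forall i : 'I_n, exists M,
    0 <= M /\ forall x, `|derive f x (delta_mx ord0 i)| <= M.
  by move=> i; have [M M0 HM] := Cc_inf_bounded (Cc_inf_derive (delta_mx ord0 i) cf); exists M.
exists (n%:R * \sum_i M i) => [|x h].
  by rewrite mulr_ge0 // sumr_ge0 // => i _; case: (HM i).
apply: lipschitz_of_bounded_derive; first by move=> y; apply: smooth_differentiable; case: cf.
move=> i y; apply: (le_trans ((HM i).2 y)); rewrite (bigD1 i) //= lerDl.
by apply: sumr_ge0 => j _; case: (HM j).
Qed.

Lemma Cc_inf_taylor f : Cc_inf f ->
  exists2 C, 0 <= C & forall x h, `|f (x + h) - f x - derive f x h| <= C * `|h| ^+ 2.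
Proof.
move=> cf; have /choice[M HM] : forall ij : 'I_n * 'I_n, exists M, 0 <= M /\
    forall x, `|derive (fun y => derive f y (delta_mx ord0 ij.1)) x (delta_mx ord0 ij.2)| <= M.
  move=> ij; have [M M0 HM] := Cc_inf_bounded (Cc_inf_derive (delta_mx ord0 ij.2)
    (Cc_inf_derive (delta_mx ord0 ij.1) cf)).
  by exists M.
exists (n%:R ^+ 2 * \sum_ij M ij) => [|x h].
  by rewrite mulr_ge0 ?sqr_ge0 // sumr_ge0 // => i _; case: (HM i).
apply: taylor_of_bounded_derive2; first by move=> y; apply: smooth_differentiable; case: cf.
  by move=> i y; apply: smooth_differentiable; apply: smooth_derive; case: cf.
move=> i j y; apply: (le_trans ((HM (i, j)).2 y)); rewrite (bigD1 (i, j)) //= lerDl.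
by apply: sumr_ge0 => k _; case: (HM k).
Qed.

End Bump.
Arguments radial_bump {R n}.

Section FlatDiff.
Variables (R : realType) (V : normedModType R).
Implicit Types (g : V -> R).

(** An increment of order [|h|^2] is [o(h)], so the differential is 0. Subtracting the expected
    linear part reduces the differentiability of a convolution to this case. *)
Lemma differentiable_flat g x (C : R) : (forall h, `|g (x + h) - g x| <= C * `|h| ^+ 2) ->
  differentiable g x /\ forall v, derive g x v = 0.
Proof.
move=> gC.
have H : g \o shift x = cst (g x) + \0 +o_ 0 id.
  apply/eqaddoP => e e0; near=> h.
  rewrite (_ : (_ - _) h = g (x + h) - g x); last first.
    by rewrite -[LHS]/(g (h + x) - (g x + 0)) addr0 [h + x]addrC.
  apply: (le_trans (gC h)); apply: (@le_trans _ _ ((`|C| + 1) * `|h| ^+ 2)).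
    by rewrite ler_wpM2r // ?sqr_ge0 // (le_trans (ler_norm _)) // lerDl.
  rewrite expr2 mulrA ler_wpM2r // -ler_pdivlMl ?ltr_wpDl // mulrC.
  near: h; apply/nbhs_normP; exists (e / (`|C| + 1)) => /=; first by rewrite divr_gt0 // ltr_wpDl.
  by move=> h; rewrite /= sub0r normrN => /ltW.
have d0 : 'd g x = \0 :> (V -> R) by apply: diff_unique H; exact: cst_continuous.
have dg : differentiable g x by apply/diff_locallyP; rewrite d0; split => //; exact: cst_continuous.
by split => // v; rewrite deriveE // d0.
Unshelve. all: by end_near. Qed.
End FlatDiff.

(** * Local integrability *)

Section LocInt.
Variables (R : realType) (n : nat).
Local Notation V := 'rV[R]_n.
Local Notation mu := (muN R n).
Implicit Types (f g k u : V -> R) (x y v : V) (r : R).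

Definition mfun_rV f := measurable_fun setT (f : rVB R n -> R).

(** The local integrability of [weak_grad], with balls cut out by [if] and the integral taken
    against [muN]. *)
Definition locint g := forall r, (\int[mu]_x (if eucl x <= r then `|g x| else 0)%:E < +oo)%E.

Lemma measurable_eucl : mfun_rV (@eucl R n).
Proof. by apply: continuous_measurable_rV; exact: continuous_eucl. Qed.

Lemma measurable_restr_ball g r : mfun_rV g ->
  measurable_fun setT ((fun x => if eucl x <= r then `|g x| else 0) : rVB R n -> R).
Proof.
move=> mg; apply: measurable_fun_ifT => //; last exact: measurableT_comp.
by apply: measurable_fun_ler => //; exact: measurable_eucl.
Qed.
End LocInt.

Section CubeVolume.
Variable R : realType.

(** The indicator of the cube of half-side [r]. As a product over coordinates it integrates by
    induction on the dimension, and it serves to bound integrals over balls from both sides. *)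
Definition cube_fun (r : R) n (x : 'rV[R]_n) : R := \prod_(i < n) \1_`[- r, r] (x ord0 i).

Lemma cube_fun_ge0 r n (x : 'rV[R]_n) : 0 <= cube_fun r x.
Proof. by apply: prodr_ge0 => i _; rewrite indicE. Qed.

Lemma measurable_cube_fun r n : measurable_fun setT (@cube_fun r n : rVB R n -> R).
Proof.
rewrite /cube_fun; elim: (index_enum _) => [|i s IH].
  by under eq_fun do rewrite big_nil; exact: measurable_cst.
under eq_fun do rewrite big_cons; apply: measurable_funM => //.
apply: (measurableT_comp (measurable_indic _)) => //; exact: measurable_coord.
Qed.

Lemma integral_cube_fun_lty r n : (\int[muN R n]_x (cube_fun r x)%:E < +oo)%E.
Proof.
elim: n => [|n IH] /=.
  rewrite integral_dirac //=; last by apply/measurable_EFinP; exact: measurable_cube_fun.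
  by rewrite diracT mul1e ltry.
rewrite ge0_integral_muS //; last 2 first.
- by apply/measurable_EFinP; exact: measurable_cube_fun.
- by move=> x; rewrite lee_fin cube_fun_ge0.
rewrite (eq_integral (fun t : measurableTypeR R => (\1_`[- r, r] t)%:E * \int[muN R n]_v (cube_fun r v)%:E)%E); last first.
  move=> t _; rewrite -ge0_integralZl ?lee_fin //; last 2 first.
  - by apply/measurable_EFinP; exact: measurable_cube_fun.
  - by move=> v _; rewrite lee_fin cube_fun_ge0.
  apply: eq_integral => v _; rewrite -EFinM; congr EFin.
  rewrite /cube_fun big_ord_recl consrV0; congr (_ * _).
  by apply: eq_bigr => i _; rewrite consrVS.
have I0 : (0 <= \int[muN R n]_v (cube_fun r v)%:E)%E.
  by apply: integral_ge0 => v _; rewrite lee_fin cube_fun_ge0.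
rewrite ge0_integralZr //; last first.
  by apply/measurable_EFinP; exact: measurable_indic.
rewrite integral_indic // setIT lte_mul_pinfty //.
by rewrite ge0_fin_numE //= lebesgue_measure_itv /=; case: ifP; rewrite ?ltry // -EFinB ltry.
Qed.
End CubeVolume.

Section LocInt2.
Variables (R : realType) (n : nat).
Local Notation V := 'rV[R]_n.
Local Notation mu := (muN R n).
Implicit Types (f g k u : V -> R) (x y v : V) (r : R).

Lemma locint_cst (c : R) : locint (fun _ : V => c).
Proof.
move=> r; apply: (@le_lt_trans _ _ (\int[mu]_x (`|c|%:E * (cube_fun r x)%:E))%E); last first.
  rewrite ge0_integralZl ?lee_fin //; last 2 first.
  - by apply/measurable_EFinP; exact: measurable_cube_fun.
  - by move=> x _; rewrite lee_fin cube_fun_ge0.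
  by apply: lte_mul_pinfty; rewrite ?lee_fin //; exact: integral_cube_fun_lty.
apply: ge0_le_integral => //.
- by move=> x _; rewrite lee_fin; case: ifP.
- by apply/measurable_EFinP; apply: (@measurable_restr_ball _ _ (fun=> c)); exact: measurable_cst.
- by apply: emeasurable_funM => //; apply/measurable_EFinP; exact: measurable_cube_fun.
move=> x _; rewrite -EFinM lee_fin; case: ifP => [xr|_]; last by rewrite mulr_ge0 ?cube_fun_ge0.
rewrite /cube_fun big1 ?mulr1 // => i _.
rewrite indicE mem_set //= in_itv /= -ler_norml.
exact: le_trans (coord_le_eucl _ _) xr.
Qed.

Lemma locint_le f g : mfun_rV f -> mfun_rV g -> (forall x, `|f x| <= `|g x|) -> locint g -> locint f.
Proof.
move=> mf mg fg lg r; apply: le_lt_trans (lg r); apply: ge0_le_integral => //.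
- by move=> x _; rewrite lee_fin; case: ifP.
- by apply/measurable_EFinP; exact: measurable_restr_ball.
- by apply/measurable_EFinP; exact: measurable_restr_ball.
by move=> x _; rewrite lee_fin; case: ifP.
Qed.

Lemma locint_bounded_on_balls f : mfun_rV f ->
  (forall r, exists M, forall x, eucl x <= r -> `|f x| <= M) -> locint f.
Proof.
move=> mf fM r; have [M HM] := fM r.
apply: le_lt_trans (locint_cst M r); apply: ge0_le_integral => //.
- by move=> x _; rewrite lee_fin; case: ifP.
- by apply/measurable_EFinP; exact: measurable_restr_ball.
- by apply/measurable_EFinP; apply: (@measurable_restr_ball _ _ (fun=> M)); exact: measurable_cst.
move=> x _; rewrite lee_fin; case: ifP => // /HM h.
by rewrite (le_trans h) // ler_norm.
Qed.

Lemma locint_continuous f : continuous f -> locint f.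
Proof.
move=> cf; apply: locint_bounded_on_balls; first exact: continuous_measurable_rV.
by move=> r; have [M _ HM] := continuous_bounded_on_ball r cf; exists M.
Qed.

Lemma integrable_locintM g u (M r : R) : mfun_rV g -> locint g -> mfun_rV u ->
  (forall x, `|u x| <= M) -> (forall x, r < eucl x -> u x = 0) ->
  mu.-integrable setT (fun x => (g x * u x)%:E).
Proof.
move=> mg lg mu_ uM ur.
have mgu : mfun_rV (fun x => g x * u x) by exact: measurable_funM.
apply/integrableP; split; first exact/measurable_EFinP.
have M0 : 0 <= M by apply: (le_trans _ (uM 0)).
apply: (@le_lt_trans _ _ (\int[mu]_x (M%:E * (if eucl x <= r then `|g x| else 0)%:E))%E).
  apply: ge0_le_integral => //.
  - by apply: measurableT_comp => //; exact/measurable_EFinP.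
  - by apply: emeasurable_funM => //; apply/measurable_EFinP; exact: measurable_restr_ball.
  move=> x _; rewrite -EFinM /= lee_fin; case: ifP => [xr|/negbT].
    by rewrite normrM mulrC ler_wpM2r.
  by rewrite -ltNge => /ur ->; rewrite mulr0 normr0 mulr0.
rewrite ge0_integralZl ?lee_fin //; last 2 first.
- by apply/measurable_EFinP; exact: measurable_restr_ball.
- by move=> x _; rewrite lee_fin; case: ifP.
by rewrite lte_mul_pinfty ?lee_fin.
Qed.

Lemma integrable_locint_Cc g u : mfun_rV g -> locint g -> continuous u -> compact_support u ->
  mu.-integrable setT (fun x => (g x * u x)%:E).
Proof.
move=> mg lg cu su; have [M _ uM] := compact_support_bounded cu su; case: su => r ur.
by apply: (@integrable_locintM _ _ M r) => //; exact: continuous_measurable_rV.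
Qed.

Lemma integrable_Cc u : continuous u -> compact_support u ->
  mu.-integrable setT (fun x => (u x)%:E).
Proof.
move=> cu su; have := @integrable_locint_Cc (fun=> 1) u (measurable_cst _) (locint_cst 1) cu su.
by under eq_fun do rewrite mul1r.
Qed.
End LocInt2.

(** * Affine changes of variables *)

Section AffineIntegral.
Variables (R : realType) (n : nat).
Local Notation V := 'rV[R]_n.
Local Notation mu := (muN R n).
Implicit Types (f g k u : V -> R) (x y v a : V) (c r : R).

Definition integ f := mu.-integrable setT (fun x => (f x)%:E).

Lemma integ_mfun f : integ f -> mfun_rV f.
Proof. by move=> /measurable_int /measurable_EFinP. Qed.

Lemma mfun_affine f c a : mfun_rV f -> mfun_rV (fun x => f (c *: x + a)).
Proof.
move=> mf; apply: (measurableT_comp mf); apply: measurable_rVP => i.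
under eq_fun do rewrite !mxE.
by apply: measurable_funD => //; apply: measurable_funM => //; exact: measurable_coord.
Qed.

Lemma integ_affine f c a : 0 < c -> integ f -> integ (fun x => f (c *: x + a)).
Proof.
move=> c0 intf; have mf := integ_mfun intf.
apply/integrableP; split; first by apply/measurable_EFinP; exact: mfun_affine.
move/integrableP : intf => [_].
rewrite (ge0_integral_muN_affine a c0) //; last by apply: measurableT_comp => //; exact/measurable_EFinP.
have cn0 : 0 < c ^+ n by exact: exprn_gt0.
move=> h; rewrite ltNge; apply/negP; rewrite leye_eq => /eqP e.
by move: h; rewrite e mulry gtr0_sg // mul1e ltxx.
Qed.

Lemma Rintegral_affine f c a : 0 < c -> integ f ->
  \int[mu]_x f x = c ^+ n * \int[mu]_x f (c *: x + a).
Proof.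
move=> c0 intf; have mf := integ_mfun intf; have intfa := integ_affine a c0 intf.
rewrite /Rintegral integralE [in RHS]integralE.
have mEf : measurable_fun setT ((fun x => (f x)%:E) : rVB R n -> \bar R) by exact/measurable_EFinP.
rewrite (ge0_integral_muN_affine a c0 (measurable_funepos mEf)) //.
rewrite (ge0_integral_muN_affine a c0 (measurable_funeneg mEf)) //.
have fp := integrable_pos_fin_num measurableT intfa.
have fn := integrable_neg_fin_num measurableT intfa.
have e : forall P N : \bar R, P \is a fin_num -> N \is a fin_num ->
    fine ((c ^+ n)%:E * P - (c ^+ n)%:E * N) = c ^+ n * fine (P - N).
  by move=> P N Pf Nf; rewrite -(fineK Pf) -(fineK Nf) -!EFinM -!EFinB /= mulrBr.
rewrite -(e _ _ fp fn); congr (fine (_ * _ - _ * _))%E.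
  by apply: eq_integral => x _; rewrite !funeposE.
by apply: eq_integral => x _; rewrite !funenegE.
Qed.

Lemma integD f g : integ f -> integ g -> integ (fun x => f x + g x).
Proof. exact: integrableD. Qed.

Lemma integB f g : integ f -> integ g -> integ (fun x => f x - g x).
Proof. exact: integrableB. Qed.

Lemma integZ c f : integ f -> integ (fun x => c * f x).
Proof. exact: integrableZl. Qed.

Lemma integ_norm f : integ f -> integ (fun x => `|f x|).
Proof. exact: integrable_norm. Qed.

Lemma RintD f g : integ f -> integ g ->
  \int[mu]_x (f x + g x) = \int[mu]_x f x + \int[mu]_x g x.
Proof. exact: RintegralD. Qed.

Lemma RintB f g : integ f -> integ g ->
  \int[mu]_x (f x - g x) = \int[mu]_x f x - \int[mu]_x g x.
Proof. exact: RintegralB. Qed.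

Lemma RintZ c f : integ f -> \int[mu]_x (c * f x) = c * \int[mu]_x f x.
Proof. exact: RintegralZl. Qed.

Lemma le_Rint f g : integ f -> integ g -> (forall x, f x <= g x) ->
  \int[mu]_x f x <= \int[mu]_x g x.
Proof. by move=> intf intg fg; exact: le_Rintegral. Qed.

Lemma Rintegral_shift f a : integ f -> \int[mu]_x f x = \int[mu]_x f (x + a).
Proof.
move=> intf; rewrite (Rintegral_affine a ltr01 intf) expr1n mul1r.
by under eq_Rintegral do rewrite scale1r.
Qed.

Lemma integ_shift f a : integ f -> integ (fun x => f (x + a)).
Proof. by move=> /(integ_affine a ltr01); under eq_fun do rewrite scale1r. Qed.

Lemma mfun_shift f a : mfun_rV f -> mfun_rV (fun x => f (x + a)).
Proof. by move=> /(mfun_affine 1 a); under eq_fun do rewrite scale1r. Qed.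

Lemma Cc_inf_shift f a : Cc_inf f -> Cc_inf (fun x => f (x + a)).
Proof.
by move=> /(Cc_inf_affine a (oner_neq0 R)); under [X in Cc_inf X -> _]eq_fun do rewrite scale1r.
Qed.

Lemma ge0_integral_shift (f : V -> \bar R) a : measurable_fun setT (f : rVB R n -> \bar R) ->
  (forall x, 0 <= f x)%E -> (\int[mu]_x f x = \int[mu]_x f (x + a)%R)%E.
Proof.
move=> mf f0; rewrite (ge0_integral_muN_affine a ltr01 mf f0) expr1n mul1e.
by under eq_integral do rewrite scale1r.
Qed.

Lemma integ_bounded f g M : integ f -> mfun_rV g -> (forall x, `|g x| <= M) ->
  integ (fun x => f x * g x).
Proof.
move=> intf mg gM; have mf := integ_mfun intf.
have M0 : 0 <= M by apply: (le_trans _ (gM 0)).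
apply: (@le_integrable _ _ _ mu _ measurableT _ (fun x => (M%:E * (f x)%:E)%E)).
- by apply/measurable_EFinP; exact: measurable_funM.
- by move=> x _; rewrite -EFinM /= lee_fin !normrM mulrC (ger0_norm M0) ler_wpM2r.
- exact: integrableZl.
Qed.
End AffineIntegral.

(** * Mollification *)

Section Convolution.
Variables (R : realType) (n : nat).
Local Notation V := 'rV[R]_n.
Local Notation mu := (muN R n).
Implicit Types (f g k u : V -> R) (x y v a h : V) (c r : R).

(** A convolution with the reflected kernel: the substitution [z = y - x] gives the average of
    [u (z + x)] with weight [k z], as in [convE], and differentiation in [x] brings a minus sign. *)
Definition mconv k u x : R := \int[mu]_y (u y * k (y - x)).

Lemma Cc_inf_mfun k : Cc_inf k -> mfun_rV k.
Proof. by move=> /Cc_inf_continuous; exact: continuous_measurable_rV. Qed.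

Lemma integ_conv k u x : Cc_inf k -> integ u -> integ (fun y => u y * k (y - x)).
Proof.
move=> ck iu; have [M _ kM] := Cc_inf_bounded ck.
by apply: (integ_bounded (M := M)) => //; apply: mfun_shift; exact: Cc_inf_mfun.
Qed.

Lemma integ_sum (I : Type) (s : seq I) (F : I -> V -> R) : (forall i, integ (F i)) ->
  integ (fun x => \sum_(i <- s) F i x).
Proof.
move=> iF; elim: s => [|i s IH].
  by rewrite /integ; under eq_fun do rewrite big_nil; exact: integrable0.
rewrite /integ; under eq_fun do rewrite big_cons EFinD.
exact: (integrableD measurableT (iF i) IH).
Qed.

Lemma Rintegral_sum (I : Type) (s : seq I) (F : I -> V -> R) : (forall i, integ (F i)) ->
  \int[mu]_x (\sum_(i <- s) F i x) = \sum_(i <- s) \int[mu]_x F i x.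
Proof.
move=> iF; elim: s => [|i s IH].
  by rewrite big_nil /Rintegral integral0_eq // => x _; rewrite big_nil.
rewrite big_cons -IH -RintegralD //; [|exact: iF|exact: integ_sum].
by apply: eq_Rintegral => x _; rewrite big_cons.
Qed.

Lemma conv_derive_sum k u x v : Cc_inf k -> integ u ->
  mconv (fun y => derive k y v) u x =
  \sum_(i < n) v ord0 i * mconv (fun y => derive k y (delta_mx ord0 i)) u x.
Proof.
move=> ck iu; have ci i : integ (fun y => u y * derive k (y - x) (delta_mx ord0 i)).
  exact: (integ_conv x (Cc_inf_derive _ ck) iu).
under eq_bigr => i _ do rewrite /mconv -(RintZ _ (ci i)).
rewrite -Rintegral_sum; last by move=> i; exact: integZ.
apply: eq_Rintegral => y _; rewrite derive_sum_coord; last by apply: smooth_differentiable; case: ck.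
by rewrite mulr_sumr; apply: eq_bigr => i _; rewrite mulrCA.
Qed.

(** Taylor's formula for [k] at [y - x] in the direction [- h], integrated against [|u|]. The
    direction [- h] explains the plus sign of the derivative term. The estimate replaces
    differentiation under the integral sign. *)
Lemma conv_taylor k u : Cc_inf k -> integ u -> exists C, forall x h,
  `|mconv k u (x + h) - mconv k u x + mconv (fun y => derive k y h) u x| <= C * `|h| ^+ 2.
Proof.
move=> ck iu; have [C C0 HC] := Cc_inf_taylor ck.
exists (C * \int[mu]_y `|u y|) => x h.
have ck1 := integ_conv (x + h) ck iu; have ck2 := integ_conv x ck iu.
have ck3 := integ_conv x (Cc_inf_derive h ck) iu.
have i12 := integB ck1 ck2; have i123 := integD i12 ck3.
rewrite /mconv -(RintB ck1 ck2) -(RintD i12 ck3).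
apply: le_trans (le_normr_Rintegral _ i123) _ => //.
rewrite -mulrA [X in C * X]mulrC mulrA -(RintZ _ (integ_norm iu)).
apply: le_Rint; [exact: integ_norm|by apply: integZ; exact: integ_norm|].
move=> y; rewrite -mulrBr -mulrDr normrM mulrC ler_wpM2r //.
have := HC (y - x) (- h); rewrite normrN [y - x - h](_ : _ = y - (x + h)); last by rewrite opprD addrA.
have -> : derive k (y - x) (- h) = - derive k (y - x) h.
  rewrite -[- h]scaleN1r deriveZdir ?mulN1r //.
  by apply: smooth_differentiable; case: ck.
by rewrite opprK.
Qed.

Lemma derive_linear_form (c : 'I_n -> R) x v :
  differentiable (fun y : V => \sum_(i < n) y ord0 i * c i) x /\
  derive (fun y : V => \sum_(i < n) y ord0 i * c i) x v = \sum_(i < n) v ord0 i * c i.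
Proof.
have -> : (fun y : V => \sum_(i < n) y ord0 i * c i) = \sum_(i < n) (fun y : V => y ord0 i * c i).
  by apply/funext => y; rewrite fct_sumE.
have d i : differentiable (fun y : V => y ord0 i * c i) x.
  by apply: differentiableM => //; exact: differentiable_coord.
split; first exact: differentiable_sum.
rewrite derive_sum; last by move=> i; exact: diff_derivable.
apply: eq_bigr => i _; rewrite deriveMr; last by apply: diff_derivable; exact: differentiable_coord.
by rewrite derive_coordinate mulrC.
Qed.

(** By [conv_taylor] the increment of [mconv k u] agrees with the linear form [Q] up to [O(|h|^2)],
    so [mconv k u - Q] falls under [differentiable_flat]. *)
Lemma derive_conv k u x v : Cc_inf k -> integ u ->
  differentiable (mconv k u) x /\
  derive (mconv k u) x v = - mconv (fun y => derive k y v) u x.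
Proof.
move=> ck iu; have [C HC] := conv_taylor ck iu.
pose c i := - mconv (fun y => derive k y (delta_mx ord0 i)) u x.
pose Q (y : V) := \sum_(i < n) y ord0 i * c i.
have QE h : Q h = - mconv (fun y => derive k y h) u x.
  rewrite conv_derive_sum // /Q -sumrN; apply: eq_bigr => i _; by rewrite mulrN.
have [dQ DQ] := derive_linear_form c x v.
pose g y := mconv k u y - Q y.
have [dg Dg] : differentiable g x /\ forall w, derive g x w = 0.
  apply: (@differentiable_flat _ _ g x C) => h; rewrite /g.
  have -> : Q (x + h) = Q x + Q h.
    by rewrite /Q -big_split /=; apply: eq_bigr => i _; rewrite mxE mulrDl.
  rewrite [X in `|X|](_ : _ = mconv k u (x + h) - mconv k u x - Q h); last by ring.
  by rewrite QE opprK.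
have -> : mconv k u = fun y => g y + Q y by apply/funext => y; rewrite /g subrK.
split; first exact: differentiableD.
by rewrite [LHS]deriveD ?Dg ?DQ ?add0r -/(Q v) ?QE //; exact: diff_derivable.
Qed.

Lemma smooth_conv k u : Cc_inf k -> integ u -> smooth (mconv k u).
Proof.
move=> ck iu; apply: (@smooth_closed _ _ (fun f => exists2 k, Cc_inf k & f = mconv k u)); last by exists k.
  by move=> _ x [l cl ->]; have [] := derive_conv x 0 cl iu.
move=> _ v [l cl ->]; exists (fun y => (-1) * derive l y v).
  by apply: Cc_infZ; exact: Cc_inf_derive.
apply/funext => x; have [_ ->] := derive_conv x v cl iu.
rewrite /mconv; under [in RHS]eq_Rintegral do rewrite mulrCA.
by rewrite (RintZ _ (integ_conv x (Cc_inf_derive v cl) iu)) mulN1r.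
Qed.

Lemma Cc_inf_conv k u : Cc_inf k -> integ u -> compact_support u -> Cc_inf (mconv k u).
Proof.
move=> ck iu [r ur]; split; first exact: smooth_conv.
have [_ [r' kr]] := ck; exists (r + r') => x rx.
rewrite /mconv /Rintegral integral0_eq // => y _; congr EFin.
have [yr|/ur -> //] := lerP (eucl y) r; last by rewrite mul0r.
rewrite kr ?mulr0 //; have := ler_euclD (y - x) (- y).
by rewrite addrAC subrr add0r !euclN; lra.
Qed.

Lemma convE k u x : Cc_inf k -> integ u -> mconv k u x = \int[mu]_z (u (z + x) * k z).
Proof.
move=> ck iu; rewrite /mconv (Rintegral_shift x (integ_conv x ck iu)).
by apply: eq_Rintegral => z _; rewrite addrK.
Qed.
End Convolution.

(** * Mollifiers, cutoffs and Jensen's inequality *)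

Section Mollifier.
Variables (R : realType) (n : nat).
Local Notation V := 'rV[R]_n.
Local Notation mu := (muN R n).
Implicit Types (f g k u : V -> R) (x y v a h : V) (c r : R).

Lemma integral_cube_fun_gt0 (r : R) m : 0 < r -> (0 < \int[muN R m]_x (cube_fun r x)%:E)%E.
Proof.
move=> r0; elim: m => [|m IH] /=.
  rewrite integral_dirac //=; last by apply/measurable_EFinP; exact: measurable_cube_fun.
  by rewrite diracT mul1e /cube_fun big_ord0.
rewrite ge0_integral_muS //; last 2 first.
- by apply/measurable_EFinP; exact: measurable_cube_fun.
- by move=> x; rewrite lee_fin cube_fun_ge0.
rewrite (eq_integral (fun t : measurableTypeR R =>
  (\1_`[- r, r] t)%:E * \int[muN R m]_v (cube_fun r v)%:E)%E); last first.
  move=> t _; rewrite -ge0_integralZl ?lee_fin //; last 2 first.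
  - by apply/measurable_EFinP; exact: measurable_cube_fun.
  - by move=> v _; rewrite lee_fin cube_fun_ge0.
  apply: eq_integral => v _; rewrite -EFinM; congr EFin.
  rewrite /cube_fun big_ord_recl consrV0; congr (_ * _).
  by apply: eq_bigr => i _; rewrite consrVS.
rewrite ge0_integralZr //; last 2 first.
- by apply/measurable_EFinP; exact: measurable_indic.
- exact: ltW.
rewrite integral_indic // setIT; apply: mule_gt0 => //.
rewrite /leb /= lebesgue_measure_itv /= lte_fin ifT; last by lra.
by rewrite -EFinB lte_fin; lra.
Qed.

Lemma mollifier_exists r : 0 < r -> exists k : V -> R,
  [/\ Cc_inf k, forall x, 0 <= k x, forall x, r <= eucl x -> k x = 0 &
      \int[mu]_x k x = 1].
Proof.
move=> r0; pose B x := theta 0 (sq_gap r x).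
have bB : radial_bump r B by exact: bump_base.
have cB : Cc_inf B := bump_Cc_inf (ltW r0) bB.
have B0 x : 0 <= B x by exact: theta_ge0.
have iB : integ B by apply: integrable_Cc; [exact: Cc_inf_continuous|case: cB].
(* The cube of half-side [q] lies in the ball of radius [r / 2], where [sq_gap r] is at least
   [r^2 / 2] and the bump at least [e]. This bounds its integral away from 0. The [+ 1] keeps the
   denominator nonzero. *)
pose q := r / (2 * (n%:R + 1)); pose e := expR (- (r ^+ 2 / 2)^-1).
have n1 : 0 < n%:R + 1 :> R by rewrite ltr_wpDl.
have q0 : 0 < q by rewrite divr_gt0 // mulr_gt0.
have I0 : 0 < \int[mu]_x B x.
  have e0 : 0 < e by exact: expR_gt0.
  have : (e%:E * \int[mu]_x (cube_fun q x)%:E <= \int[mu]_x (B x)%:E)%E.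
    rewrite -ge0_integralZl ?lee_fin ?(ltW e0) //; last 2 first.
    - by apply/measurable_EFinP; exact: measurable_cube_fun.
    - by move=> x _; rewrite lee_fin cube_fun_ge0.
    apply: ge0_le_integral => //.
    - by move=> x _; rewrite -EFinM lee_fin mulr_ge0 ?cube_fun_ge0 // ltW.
    - by apply: emeasurable_funM => //; apply/measurable_EFinP; exact: measurable_cube_fun.
    - exact: measurable_int iB.
    move=> x _; rewrite -EFinM lee_fin.
    have [xq|] := boolP [forall i, `|x ord0 i| <= q]; last first.
      move=> /forallPn[i xi]; rewrite /cube_fun (bigD1 i) //= indicE memNset ?mul0r ?mulr0 //=.
      by rewrite in_itv /= -ler_norml; exact/negP.
    rewrite /cube_fun big1 ?mulr1; last first.
      by move=> i _; rewrite indicE mem_set //= in_itv /= -ler_norml; exact: (forallP xq).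
    have xr : eucl x <= r / 2.
      apply: (le_trans (eucl_le_sum x)); apply: (@le_trans _ _ (n%:R * q)).
        by apply: sumr_le_natmul => i; exact: (forallP xq).
      rewrite (_ : _ * q = r / 2 * (n%:R / (n%:R + 1))); last by rewrite /q; field; rewrite gt_eqF.
      rewrite ler_piMr ?divr_ge0 ?(ltW r0) //.
      by rewrite ler_pdivrMr // mul1r lerDl.
    have gap : r ^+ 2 / 2 <= sq_gap r x.
      rewrite /sq_gap -sqr_eucl.
      have : eucl x ^+ 2 <= (r / 2) ^+ 2 by rewrite ler_pXn2r // nnegrE ?eucl_ge0 // divr_ge0 // ltW.
      have : 0 <= r ^+ 2 by exact: sqr_ge0.
      rewrite expr_div_n (_ : 2 ^+ 2 = 4 :> R); last by ring.
      lra.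
    have r20 : 0 < r ^+ 2 / 2 by rewrite divr_gt0 // exprn_gt0.
    rewrite /B theta_gt0E ?(lt_le_trans r20) // expr0 mul1r ler_expR lerN2.
    by rewrite lef_pV2 // posrE // (lt_le_trans r20).
  have Bfin : (\int[mu]_x (B x)%:E)%E \is a fin_num by exact: integrable_fin_num.
  rewrite -(fineK Bfin); move=> h; rewrite -lte_fin; apply: lt_le_trans h.
  by apply: mule_gt0; rewrite ?lte_fin //; exact: integral_cube_fun_gt0.
exists (fun x => (\int[mu]_x B x)^-1 * B x); split.
- exact: Cc_infZ.
- by move=> x; rewrite mulr_ge0 // invr_ge0 ltW.
- by move=> x rx; rewrite (bump_support (ltW r0) bB rx) mulr0.
- by rewrite (RintZ _ iB) mulVf // gt_eqF.
Qed.

Lemma cutoff_exists : exists chi : V -> R,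
  [/\ Cc_inf chi, forall x, 0 <= chi x <= 1, chi 0 = 1 & forall x, 1 <= eucl x -> chi x = 0].
Proof.
pose B x := theta 0 (sq_gap 1 x).
have bB : radial_bump 1 B by exact: bump_base.
have E1 : expR (1 : R) * expR (- 1^-1) = 1 by rewrite -expRD invr1 subrr expR0.
(* At the origin the bump is [theta 0 1 = exp (- 1)], which the factor [expR 1] normalises to 1. *)
exists (fun x => expR 1 * B x); split.
- by apply: Cc_infZ; exact: bump_Cc_inf bB.
- move=> x; rewrite mulr_ge0 ?expR_ge0 ?theta_ge0 //=.
  rewrite -[X in _ <= X]E1 ler_pM2l ?expR_gt0 // /B.
  have [g0|g0] := lerP (sq_gap 1 x) 0; first by rewrite theta_le0 // expR_ge0.
  rewrite theta_gt0E // expr0 mul1r ler_expR lerN2 lef_pV2 ?posrE //.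
  by rewrite /sq_gap expr1n gerBl eucl_sum_ge0.
- rewrite /B /sq_gap big1 ?subr0 ?expr1n; last by move=> i _; rewrite mxE expr0n.
  by rewrite theta_gt0E // expr0 mul1r.
- by move=> x x1; rewrite (bump_support ler01 bB x1) mulr0.
Qed.

(** The tangent to [t^p] at the mean [c], integrated against the probability density [k]: the linear
    term vanishes by the choice of [c]. If [F^p k] is not integrable, the right-hand side is
    infinite. *)
Lemma jensen_powR k (F : V -> R) (p : R) : 1 < p ->
  integ k -> (forall x, 0 <= k x) -> \int[mu]_x k x = 1 ->
  mfun_rV F -> (forall x, 0 <= F x) -> integ (fun x => F x * k x) ->
  (((\int[mu]_x (F x * k x)) `^ p)%:E <= \int[mu]_x (F x `^ p * k x)%:E)%E.
Proof.
move=> p1 ik k0 k1 mF F0 iFk; set c := \int[mu]_x _.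
have c0 : 0 <= c by apply: Rintegral_ge0 => x _; exact: mulr_ge0.
have mk := integ_mfun ik.
have mFp : mfun_rV (fun x => F x `^ p * k x).
  by apply: measurable_funM => //; exact: (measurableT_comp (measurable_powR p)).
have [iFp|nFp] := pselect (integ (fun x => F x `^ p * k x)); last first.
  suff -> : (\int[mu]_x (F x `^ p * k x)%:E = +oo)%E by rewrite leey.
  apply/eqP; rewrite -leye_eq leNgt; apply/negP => h; apply: nFp.
  apply/integrableP; split; first exact/measurable_EFinP.
  by under eq_integral do rewrite /= ger0_norm ?mulr_ge0 ?powR_ge0 //.
have iA := integD (integZ (c `^ p) ik)
  (integZ (p * c `^ (p - 1)) (integB iFk (integZ c ik))).
have -> : c `^ p = \int[mu]_x (c `^ p * k x + p * c `^ (p - 1) * (F x * k x - c * k x)).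
  rewrite (RintD (integZ _ ik) (integZ _ (integB iFk (integZ _ ik)))).
  rewrite (RintZ _ ik) (RintZ _ (integB iFk (integZ _ ik))) (RintB iFk (integZ _ ik)).
  by rewrite (RintZ _ ik) k1 -/c !mulr1 subrr mulr0 addr0.
rewrite /Rintegral fineK; last exact: integrable_fin_num iA.
apply: le_integral => // x _; rewrite lee_fin.
rewrite -mulrBl mulrA -mulrDl ler_wpM2r //.
exact: powR_tangent.
Qed.
End Mollifier.

Section MollifyEnergy.
Variables (R : realType) (n : nat).
Local Notation V := 'rV[R]_n.
Local Notation mu := (muN R n).
Variables (d : measure_display) (X : measurableType d).
Variable nu : {sigma_finite_measure set X -> \bar R}.

(** Jensen's inequality at each [x], Tonelli, and invariance of the energy under [tau]. Keeping [X]
    and [tau] abstract serves both pairs of points, moved diagonally, and single points carrying a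
    gradient. *)
Lemma mollify_Epow (p : R) (k : V -> R) (tau : X -> V -> X) (G Gw : X -> R) : 1 < p ->
  integ k -> (forall x, 0 <= k x) -> \int[mu]_x k x = 1 ->
  measurable_fun setT G -> (forall x, 0 <= G x) -> measurable_fun setT Gw -> (forall x, 0 <= Gw x) ->
  measurable_fun setT ((fun w => G (tau w.1 w.2)) : (X * rVB R n)%type -> R) ->
  (forall z, Epow nu p (fun x => G (tau x z)) = Epow nu p G) ->
  (forall x, integ (fun z => G (tau x z) * k z)) ->
  (forall x, Gw x <= \int[mu]_z (G (tau x z) * k z)) ->
  (Epow nu p Gw <= Epow nu p G)%E.
Proof.
move=> p1 ik k0 k1 mG G0 mGw Gw0 mGt Etau iGk GwG; have mk := integ_mfun ik.
have mH : measurable_fun setT ((fun w => (G (tau w.1 w.2) `^ p * k w.2)%:E) : (X * rVB R n)%type -> \bar R).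
  apply/measurable_EFinP; apply: measurable_funM.
    exact: (measurableT_comp (measurable_powR p)).
  exact: (measurableT_comp mk measurable_snd).
have H0 (w : (X * rVB R n)%type) : (0 <= (G (tau w.1 w.2) `^ p * k w.2)%:E)%E.
  by rewrite lee_fin mulr_ge0 // powR_ge0.
apply: (@le_trans _ _ (\int[nu]_x \int[mu]_z (G (tau x z) `^ p * k z)%:E)%E).
  apply: ge0_le_integral => //.
  - by move=> x _; rewrite lee_fin powR_ge0.
  - exact: measurable_Epow.
  - exact: (@measurable_fun_fubini_tonelli_F _ _ _ _ _ mu _ mH H0).
  move=> x _; apply: le_trans (jensen_powR p1 ik k0 k1 _ _ (iGk x)) => //.
    rewrite lee_fin; apply: powR_mono => //; lra.
  exact: (measurable_fun_pair2 x mGt).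
have -> := @fubini_tonelli _ _ _ _ R nu mu _ mH H0.
rewrite (eq_integral (fun z : rVB R n => (k z)%:E * Epow nu p G)%E); last first.
  move=> z _; rewrite -(Etau z) /Epow -ge0_integralZl //.
  - by apply: eq_integral => x _; rewrite -EFinM mulrC.
  - by apply: measurable_Epow; exact: (measurable_fun_pair1 z mGt).
  - by move=> x _; rewrite lee_fin powR_ge0.
  - by rewrite lee_fin.
rewrite ge0_integralZr //; [|exact/measurable_EFinP|by move=> z _; rewrite lee_fin|exact: Epow_ge0].
have kfin := integrable_fin_num measurableT ik.
by rewrite -(fineK kfin) -/(Rintegral mu setT k) k1 mul1e.
Qed.
End MollifyEnergy.

(** * Fatou's lemma as an upper bound *)

Section FatouBound.
Variables (d : measure_display) (Z : measurableType d) (R : realType).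
Variable nu : {measure set Z -> \bar R}.

(** A lower limit is at most [C] as soon as the integrals are at most [C] for arbitrarily large
    indices, so the bound is asked for only along such indices. *)
Lemma fatou_le (u : nat -> Z -> \bar R) (F : Z -> \bar R) (C : \bar R) :
  (forall m, measurable_fun setT (u m)) -> (forall m z, 0 <= u m z)%E ->
  (forall z, u ^~ z @ \oo --> F z) ->
  (forall m0, exists2 m, (m0 <= m)%N & (\int[nu]_z u m z <= C)%E) ->
  (\int[nu]_z F z <= C)%E.
Proof.
move=> mu u0 uF uC.
have := @fatou _ _ _ nu setT measurableT u mu (fun m z _ => u0 m z).
rewrite (_ : (\int[nu]_x limn_einf (u^~ x))%E = (\int[nu]_z F z)%E); last first.
  by apply: eq_integral => z _; have [-> _] := cvg_limn_einf_sup (uF z).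
move=> /le_trans; apply; rewrite limn_einf_lim; apply: lime_le; first exact: is_cvg_einfs.
apply: nearW => m0; have [m m0m Cm] := uC m0.
apply: le_trans Cm; apply: ereal_inf_lbound; exists m => //.
Qed.

Lemma Epow_fatou (p : R) (u : nat -> Z -> R) (F : Z -> R) (C : \bar R) : 0 < p ->
  (forall m, measurable_fun setT (u m)) -> (forall m z, 0 <= u m z) ->
  (forall z, u ^~ z @ \oo --> F z) ->
  (forall m0, exists2 m, (m0 <= m)%N & (Epow nu p (u m) <= C)%E) ->
  (Epow nu p F <= C)%E.
Proof.
move=> p0 mu u0 uF uC; apply: (fatou_le (u := fun m z => (u m z `^ p)%:E)) => //.
- by move=> m; exact: measurable_Epow.
- by move=> m z; rewrite lee_fin powR_ge0.
move=> z; apply: cvg_EFin; first by near=> m.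
exact: cvg_powR (uF z).
Unshelve. all: by end_near. Qed.
End FatouBound.

(** * Integrability of powers of the norm *)

Section Radial.
Variables (R : realType) (n : nat).
Local Notation V := 'rV[R]_n.
Local Notation mu := (muN R n).
Implicit Types (f g h : V -> R) (x y z : V).

(* Replaces polar coordinates: truncated powers of [eucl] satisfy such a self-similar recursion. *)
Lemma geometric_scaling_integral (f : nat -> V -> R) h (F : V -> R) (I0 kappa lambda : R) :
  0 < lambda -> 0 <= kappa -> kappa / lambda ^+ n < 1 ->
  (forall m, mfun_rV (f m)) -> (forall m z, 0 <= f m z) -> mfun_rV h -> (forall z, 0 <= h z) ->
  (\int[mu]_z (h z)%:E <= I0%:E)%E ->
  (forall z, f 0%N z = 0) -> (forall m z, f m.+1 z <= h z + kappa * f m (lambda *: z)) ->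
  (forall z, \forall m \near \oo, f m z = F z) ->
  (\int[mu]_z (F z)%:E < +oo)%E.
Proof.
move=> l0 k0 q1 mf f0 mh h0 hI fz fS fF; set q := kappa / lambda ^+ n in q1.
have ln0 : 0 < lambda ^+ n by exact: exprn_gt0.
have q0 : 0 <= q by rewrite divr_ge0 // ltW.
have I00 : 0 <= I0.
  by rewrite -lee_fin (le_trans _ hI) // integral_ge0 // => z _; rewrite lee_fin.
(* [I0 / (1 - q)] is the fixed point of [t -> I0 + q t]; the factor [q] combines [kappa] with the
   Jacobian of [z -> lambda z]. *)
have bound m : (\int[mu]_z (f m z)%:E <= (I0 / (1 - q))%:E)%E.
  elim: m => [|m IH].
    by rewrite integral0_eq ?lee_fin ?divr_ge0 ?subr_ge0 ?(ltW q1) // => z _; rewrite fz.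
  have mfl : mfun_rV (fun z => f m (lambda *: z)).
    by have := mfun_affine lambda 0 (mf m); under eq_fun do rewrite addr0.
  apply: (@le_trans _ _ (\int[mu]_z ((h z)%:E + kappa%:E * (f m (lambda *: z))%:E))%E).
    apply: ge0_le_integral => //.
    - by move=> z _; rewrite lee_fin.
    - by apply/measurable_EFinP; exact: mf.
    - apply: emeasurable_funD; first exact/measurable_EFinP.
      by apply: emeasurable_funM => //; exact/measurable_EFinP.
    - by move=> z _; rewrite -EFinM -EFinD lee_fin.
  rewrite ge0_integralD //; last 4 first.
  - by move=> z _; rewrite lee_fin.
  - exact/measurable_EFinP.
  - by move=> z _; rewrite -EFinM lee_fin mulr_ge0.
  - by apply: emeasurable_funM => //; exact/measurable_EFinP.
  rewrite ge0_integralZl ?lee_fin //; last 2 first.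
  - exact/measurable_EFinP.
  - by move=> z _; rewrite lee_fin.
  have mEf : measurable_fun setT ((fun z => (f m z)%:E) : rVB R n -> \bar R) by apply/measurable_EFinP; exact: mf.
  have e : (\int[mu]_z (f m z)%:E = (lambda ^+ n)%:E * \int[mu]_z (f m (lambda *: z))%:E)%E.
    have f0E z : (0 <= (f m z)%:E)%E by rewrite lee_fin.
    rewrite (ge0_integral_muN_affine 0 l0 mEf f0E); congr (_ * _)%E.
    by apply: eq_integral => z _; rewrite addr0.
  have Ifin : (\int[mu]_z (f m z)%:E)%E \is a fin_num.
    by rewrite ge0_fin_numE ?(le_lt_trans IH) ?ltry // integral_ge0 // => z _; rewrite lee_fin.
  have e2 : (\int[mu]_z (f m (lambda *: z))%:E = (lambda ^+ n)^-1%:E * \int[mu]_z (f m z)%:E)%E.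
    by rewrite e muleA -EFinM mulVf ?mul1e // gt_eqF.
  rewrite e2 muleA -EFinM -/q -(fineK Ifin) -EFinM.
  apply: (@le_trans _ _ (I0%:E + (q * (I0 / (1 - q)))%:E)%E).
    apply: leeD => //; rewrite lee_fin ler_wpM2l // -lee_fin fineK //.
  rewrite -EFinD lee_fin (_ : I0 + _ = I0 / (1 - q)) //.
  by field; rewrite gt_eqF // subr_gt0.
apply: (@le_lt_trans _ _ (I0 / (1 - q))%:E); last exact: ltry.
apply: (@fatou_le _ (rVB R n) R mu (fun m z => (f m z)%:E) (fun z => (F z)%:E)).
- by move=> m; apply/measurable_EFinP; exact: mf.
- by move=> m z; rewrite lee_fin.
- move=> z; apply: cvg_EFin; first by near=> m.
  apply: cvg_near_cst; near=> m; near: m; exact: fF.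
- by move=> m0; exists m0.
Unshelve. all: by end_near. Qed.

Lemma integral_bounded_ball h (M r : R) : mfun_rV h -> (forall z, 0 <= h z <= M) ->
  (forall z, r < eucl z -> h z = 0) ->
  exists I0, (\int[mu]_z (h z)%:E <= I0%:E)%E.
Proof.
move=> mh hM hr.
have : integ (fun z => 1 * h z).
  apply: (@integrable_locintM R n (fun=> 1) h M r) => //.
  - exact: measurable_cst.
  - exact: locint_cst.
  - by move=> z; have /andP[a b] := hM z; rewrite ger0_norm.
under [X in integ X]eq_fun do rewrite mul1r.
move=> ih; exists (fine (\int[mu]_z (h z)%:E)%E).
by rewrite fineK // integrable_fin_num.
Qed.
End Radial.

Section RadialPowers.
Variables (R : realType) (n : nat).
Local Notation V := 'rV[R]_n.
Local Notation mu := (muN R n).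
Implicit Types (x y z : V) (a b c t : R).

Lemma powR_between t c : 1 / 2 <= c -> c <= 2 -> c `^ t <= 2 `^ `|t|.
Proof.
move=> c1 c2; have c0 : 0 < c by lra.
have [t0|t0] := leP 0 t; first by rewrite ger0_norm //; apply: powR_mono => //; exact: ltW.
rewrite ltr0_norm // (_ : c `^ t = (c^-1) `^ (- t)); last first.
  by rewrite -powR_inv1 ?(ltW c0) // -powRrM mulN1r opprK.
apply: powR_mono; rewrite ?oppr_ge0 ?invr_ge0 ?(ltW t0) ?(ltW c0) //.
by rewrite invf_ple ?posrE //; lra.
Qed.

Lemma powR2_lt1 t : t < 0 -> 2 `^ t < 1.
Proof.
move=> t0; rewrite /powR ifF; last by apply/negbTE; rewrite pnatr_eq0.
by rewrite expR_lt1 pmulr_llt0 // ln_gt0 // ltr1n.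
Qed.

Definition annulus_pow (a lo hi : R) z : R :=
  if (lo < eucl z) && (eucl z <= hi) then eucl z `^ (- a) else 0.

Lemma measurable_annulus_pow a lo hi : mfun_rV (annulus_pow a lo hi).
Proof.
apply: measurable_fun_ifT.
- apply: measurable_and; first by apply: measurable_fun_ltr => //; exact: measurable_eucl.
  by apply: measurable_fun_ler => //; exact: measurable_eucl.
- exact: (measurableT_comp (measurable_powR _) (@measurable_eucl R n)).
- exact: measurable_cst.
Qed.

Lemma annulus_pow_ge0 a lo hi z : 0 <= annulus_pow a lo hi z.
Proof. by rewrite /annulus_pow; case: ifP => // _; exact: powR_ge0. Qed.

Lemma annulus_pow_bounded a lo hi : 1 / 2 <= lo -> hi <= 2 ->
  exists I0, (\int[mu]_z (annulus_pow a lo hi z)%:E <= I0%:E)%E.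
Proof.
move=> lo2 hi2; apply: (@integral_bounded_ball R n _ (2 `^ `|- a|) hi).
- exact: measurable_annulus_pow.
- move=> z; rewrite annulus_pow_ge0 /annulus_pow; case: ifP => [/andP[l h]|_]; last exact: powR_ge0.
  by apply: powR_between; lra.
- by move=> z hz; rewrite /annulus_pow [X in _ && X]leNgt hz andbF.
Qed.

Lemma eucl_half z : eucl (2^-1 *: z) = eucl z / 2.
Proof. by rewrite euclZ ger0_norm ?invr_ge0 // mulrC. Qed.

(** Beyond radius 2 the function is [2^(- a)] times its value at [z / 2]. Hence
    [geometric_scaling_integral] applies with ratio [2^(n - a) < 1], the truncations being to
    [|z| <= 2^m]. *)
Lemma integral_tail_lty a : n%:R < a ->
  (\int[mu]_z (if (1 < eucl z)%R then eucl z `^ (- a) else 0)%:E < +oo)%E.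
Proof.
move=> na; have [I0 hI0] := @annulus_pow_bounded a 1 2 ltac:(lra) (lexx _).
apply: (@geometric_scaling_integral R n (fun m => annulus_pow a 1 (2 ^+ m)) (annulus_pow a 1 2) _
  I0 (2 `^ (- a)) 2^-1) => //.
- rewrite exprVn invrK -powR_mulrn // -powRD; last by apply/implyP.
  by apply: powR2_lt1; lra.
- by move=> m; exact: measurable_annulus_pow.
- by move=> m z; exact: annulus_pow_ge0.
- exact: measurable_annulus_pow.
- exact: annulus_pow_ge0.
- by move=> z; rewrite /annulus_pow expr0; case: ifP => // /andP[h1 h2]; move: (lt_le_trans h1 h2); rewrite ltxx.
- move=> m z; rewrite {1}/annulus_pow; case: ifP => [/andP[h1 h2]|_]; last first.
    by rewrite addr_ge0 ?annulus_pow_ge0 // mulr_ge0 ?powR_ge0 ?annulus_pow_ge0.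
  have [z2|z2] := lerP (eucl z) 2.
    rewrite {1}/annulus_pow h1 z2 lerDl mulr_ge0 ?powR_ge0 ?annulus_pow_ge0 //.
  rewrite -[leLHS]add0r lerD ?annulus_pow_ge0 // /annulus_pow eucl_half.
  rewrite ltr_pdivlMr // mul1r z2 ler_pdivrMr // -exprSr h2 /=.
  by rewrite -powRM // ?divr_ge0 ?eucl_ge0 // mulrCA mulfV // mulr1.
- move=> z; exists (Num.truncn (eucl z)).+1 => // m /= zm; rewrite /annulus_pow.
  suff -> : eucl z <= 2 ^+ m by rewrite andbT.
  apply: (le_trans (ltW (truncnS_gt (eucl z)))); rewrite -natrX ler_nat.
  by rewrite (leq_trans zm) // ltnW // ltn_expl.
Qed.

(** The mirror image of the tail: inside radius [1 / 2] the function is [2^b] times its value at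
    [2 z], and the ratio is [2^(b - n) < 1]. *)
Lemma integral_origin_lty b : b < n%:R ->
  (\int[mu]_z (if (0 < eucl z <= 1)%R then eucl z `^ (- b) else 0)%:E < +oo)%E.
Proof.
move=> bn; have [I0 hI0] := @annulus_pow_bounded b (1 / 2) 1 (lexx _) ltac:(lra).
apply: (@geometric_scaling_integral R n (fun m => annulus_pow b (2 ^- m) 1) (annulus_pow b (1 / 2) 1) _
  I0 (2 `^ b) 2) => //.
- rewrite -powR_mulrn // -powRN -powRD; last by apply/implyP.
  by apply: powR2_lt1; lra.
- by move=> m; exact: measurable_annulus_pow.
- by move=> m z; exact: annulus_pow_ge0.
- exact: measurable_annulus_pow.
- exact: annulus_pow_ge0.
- by move=> z; rewrite /annulus_pow expr0 invr1; case: ifP => // /andP[h1 h2]; move: (lt_le_trans h1 h2); rewrite ltxx.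
- move=> m z; rewrite {1}/annulus_pow; case: ifP => [/andP[h1 h2]|_]; last first.
    by rewrite addr_ge0 ?annulus_pow_ge0 // mulr_ge0 ?powR_ge0 ?annulus_pow_ge0.
  have [z2|z2] := ltrP (1 / 2) (eucl z).
    by rewrite {1}/annulus_pow h2 z2 lerDl mulr_ge0 ?powR_ge0 ?annulus_pow_ge0.
  rewrite -[leLHS]add0r lerD ?annulus_pow_ge0 // /annulus_pow euclZ ger0_norm //.
  have z0 : 0 < eucl z by apply: lt_trans h1; rewrite invr_gt0 exprn_gt0.
  have -> : 2 ^- m < 2 * eucl z.
    by move: h1; rewrite exprS invfM mulrC ltr_pdivrMr // mulrC.
  have -> /= : 2 * eucl z <= 1 by lra.
  rewrite powRM ?eucl_ge0 // mulrA -powRD; last by apply/implyP.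
  by rewrite subrr powRr0 mul1r.
- move=> z; have [z0|z0] := ltrP 0 (eucl z); last first.
    apply: nearW => m; rewrite /annulus_pow andFb ifF //; apply/negbTE; rewrite negb_and -leNgt.
    by rewrite (le_trans z0) // invr_ge0 exprn_ge0.
  exists (Num.truncn (eucl z)^-1).+1 => // m /= zm; rewrite /annulus_pow /=.
  suff -> : 2 ^- m < eucl z by [].
  rewrite invf_plt ?posrE ?exprn_gt0 //.
  apply: (lt_le_trans (truncnS_gt (eucl z)^-1)); rewrite -natrX ler_nat.
  by rewrite (leq_trans zm) // ltnW // ltn_expl.
Qed.
End RadialPowers.

(** * The fractional seminorm *)

Section PairMeasure.
Variables (R : realType) (n : nat).
Local Notation V := 'rV[R]_n.
Local Notation mu := (muN R n).
Local Notation VB := (rVB R n).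
Implicit Types (f g A B : V -> R) (x y z a : V) (c : R) (H : V * V -> R).

Definition mfun_pair (H : V * V -> R) := measurable_fun setT (H : (VB * VB)%type -> R).

Lemma mfun_pair_fst f : mfun_rV f -> mfun_pair (fun w => f w.1).
Proof. by move=> mf; exact: (measurableT_comp mf measurable_fst). Qed.

Lemma mfun_pair_snd f : mfun_rV f -> mfun_pair (fun w => f w.2).
Proof. by move=> mf; exact: (measurableT_comp mf measurable_snd). Qed.

Lemma measurable_rVB_sub d (T : measurableType d) (u v : T -> V) :
  measurable_fun setT (u : T -> VB) -> measurable_fun setT (v : T -> VB) ->
  measurable_fun setT ((fun t => u t - v t) : T -> VB).
Proof.
move=> mu_ mv; apply: measurable_rVP => i; under eq_fun do rewrite !mxE.
by apply: measurable_funB; exact: measurable_rV_coord.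
Qed.

Lemma measurable_rVB_add d (T : measurableType d) (u v : T -> V) :
  measurable_fun setT (u : T -> VB) -> measurable_fun setT (v : T -> VB) ->
  measurable_fun setT ((fun t => u t + v t) : T -> VB).
Proof.
move=> mu_ mv; apply: measurable_rVP => i; under eq_fun do rewrite !mxE.
by apply: measurable_funD; exact: measurable_rV_coord.
Qed.

Lemma mfun_pair_sub f : mfun_rV f -> mfun_pair (fun w => f (w.1 - w.2)).
Proof.
move=> mf; apply: (measurableT_comp mf).
by apply: measurable_rVB_sub; [exact: measurable_fst|exact: measurable_snd].
Qed.

Lemma mfun_pair_affine c a H : mfun_pair H -> mfun_pair (fun w => H (c *: w.1 + a, c *: w.2 + a)).
Proof.
move=> mH; apply: (measurableT_comp mH); apply: measurable_fun_pair;
  apply: measurable_rVP => i; under eq_fun do rewrite !mxE;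
  apply: measurable_funD => //; apply: measurable_funM => //; apply: measurable_rV_coord.
- exact: measurable_fst.
- exact: measurable_snd.
Qed.

(** A named copy of the product measure, to carry the sigma-finite structure that [mollify_Epow]
    asks for. *)
Definition pair_measure : set (VB * VB) -> \bar R := (mu \x mu)%E.

HB.instance Definition _ := Measure.on pair_measure.

Lemma sigma_finite_pair_measure : sigma_finite setT pair_measure.
Proof. exact: sigma_finite_product. Qed.

HB.instance Definition _ := @Measure_isSigmaFinite.Build _ _ _ pair_measure sigma_finite_pair_measure.

Definition muP : {sigma_finite_measure set (VB * VB)%type -> \bar R} := pair_measure.

Lemma ge0_integral_muP (F : V * V -> \bar R) :
  measurable_fun setT (F : (VB * VB)%type -> \bar R) -> (forall w, 0 <= F w)%E ->
  (\int[muP]_w F w = \int[mu]_x \int[mu]_y F (x, y))%E.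
Proof. by move=> mF F0; exact: (@fubini_tonelli1 _ _ _ _ R mu mu F mF F0). Qed.

Lemma ge0_integral_muP_swap (F : V * V -> \bar R) :
  measurable_fun setT (F : (VB * VB)%type -> \bar R) -> (forall w, 0 <= F w)%E ->
  (\int[muP]_w F w = \int[mu]_y \int[mu]_x F (x, y))%E.
Proof.
move=> mF F0; rewrite (ge0_integral_muP mF F0).
exact: (@fubini_tonelli _ _ _ _ R mu mu F mF F0).
Qed.

Lemma ge0_integral_muP_affine c a H : 0 < c -> mfun_pair H -> (forall w, 0 <= H w) ->
  (\int[muP]_w (H w)%:E =
   (c ^+ n * c ^+ n)%:E * \int[muP]_w (H (c *: w.1 + a, c *: w.2 + a))%:E)%E.
Proof.
move=> c0 mH H0.
have mHE : measurable_fun setT ((fun w => (H w)%:E) : (VB * VB)%type -> \bar R) by exact/measurable_EFinP.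
have H0E w : (0 <= (H w)%:E)%E by rewrite lee_fin.
have mHa : measurable_fun setT ((fun w => (H (c *: w.1 + a, c *: w.2 + a))%:E) : (VB * VB)%type -> \bar R).
  by apply/measurable_EFinP; exact: mfun_pair_affine.
rewrite !ge0_integral_muP //.
have cn0 : 0 <= c ^+ n by rewrite exprn_ge0 // ltW.
have mI := @measurable_fun_fubini_tonelli_F _ _ _ _ _ mu _ mHE H0E.
have I0 x : (0 <= \int[mu]_y (H (x, y))%:E)%E by exact: integral_ge0.
have -> := ge0_integral_muN_affine a c0 mI I0.
rewrite EFinM -muleA; congr (_ * _)%E; rewrite -ge0_integralZl //; last 2 first.
- exact: (@measurable_fun_fubini_tonelli_F _ _ _ _ _ mu _ mHa (fun w => H0E _)).
- by move=> x _; exact: integral_ge0.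
apply: eq_integral => x _.
exact: (ge0_integral_muN_affine a c0 (measurable_fun_pair2 (c *: x + a : VB) mHE) (fun y => H0E _)).
Qed.

Lemma Epow_muP_affine p c a H : 0 < c -> mfun_pair H ->
  Epow muP p H = ((c ^+ n * c ^+ n)%:E * Epow muP p (fun w => H ((c *: w.1 + a)%R, (c *: w.2 + a)%R)))%E.
Proof.
move=> c0 mH; rewrite /Epow.
have mHp : mfun_pair (fun w => H w `^ p) by exact: (measurableT_comp (measurable_powR p) mH).
exact: (ge0_integral_muP_affine a c0 mHp (fun w => powR_ge0 (H w) p)).
Qed.

Lemma integral_muP_product A B : mfun_rV A -> mfun_rV B -> (forall x, 0 <= A x) -> (forall x, 0 <= B x) ->
  (\int[muP]_w (A w.1 * B w.2)%:E = \int[mu]_x (A x)%:E * \int[mu]_y (B y)%:E)%E.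
Proof.
move=> mA mB A0 B0; rewrite ge0_integral_muP //; last 2 first.
- by apply/measurable_EFinP; apply: measurable_funM; [exact: mfun_pair_fst|exact: mfun_pair_snd].
- by move=> w; rewrite lee_fin mulr_ge0.
rewrite -ge0_integralZr //; last 3 first.
- exact/measurable_EFinP.
- by move=> x _; rewrite lee_fin.
- by apply: integral_ge0 => x _; rewrite lee_fin.
apply: eq_integral => x _; rewrite -ge0_integralZl //.
- exact/measurable_EFinP.
- by move=> y _; rewrite lee_fin.
- by rewrite lee_fin.
Qed.

Lemma integral_muP_convolution A B : mfun_rV A -> mfun_rV B -> (forall x, 0 <= A x) -> (forall x, 0 <= B x) ->
  (\int[muP]_w (A w.2 * B (w.1 - w.2))%:E = \int[mu]_x (A x)%:E * \int[mu]_y (B y)%:E)%E.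
Proof.
move=> mA mB A0 B0; rewrite ge0_integral_muP_swap //; last 2 first.
- by apply/measurable_EFinP; apply: measurable_funM; [exact: mfun_pair_snd|exact: mfun_pair_sub].
- by move=> w; rewrite lee_fin mulr_ge0.
have mBE : measurable_fun setT ((fun y => (B y)%:E) : VB -> \bar R) by exact/measurable_EFinP.
have B0E y : (0 <= (B y)%:E)%E by rewrite lee_fin.
rewrite -ge0_integralZr //; last 3 first.
- exact/measurable_EFinP.
- by move=> x _; rewrite lee_fin.
- exact: integral_ge0.
apply: eq_integral => y _; rewrite (ge0_integral_shift (- y) mBE B0E) -ge0_integralZl //.
- by apply/measurable_EFinP; exact: mfun_shift.
- by rewrite lee_fin.
Qed.

End PairMeasure.

Section Gagliardo.
Variables (R : realType) (n : nat) (s p : R).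
Local Notation V := 'rV[R]_n.
Local Notation mu := (muN R n).
Local Notation VB := (rVB R n).
Implicit Types (f g u k : V -> R) (x y z a : V) (c : R) (w : V * V).

(** The p-th root of the Gagliardo integrand, so that the seminorm becomes an [L^p] norm over pairs.
    On the diagonal the numerator vanishes. *)
Definition gquot f w : R := `|f w.1 - f w.2| / eucl (w.1 - w.2) `^ (n%:R / p + s).

Lemma gquot_ge0 f w : 0 <= gquot f w.
Proof. by rewrite divr_ge0 // powR_ge0. Qed.

Lemma mfun_gquot f : mfun_rV f -> mfun_pair (gquot f).
Proof.
move=> mf; apply: measurable_funM.
  apply: measurableT_comp => //; apply: measurable_funB;
  by [exact: mfun_pair_fst|exact: mfun_pair_snd].
have -> : (fun w => (eucl (w.1 - w.2) `^ (n%:R / p + s))^-1) =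
    fun w : V * V => eucl (w.1 - w.2) `^ (- (n%:R / p + s)).
  by apply/funext => w; rewrite powRN.
apply: (measurableT_comp (measurable_powR _)).
exact: (mfun_pair_sub (@measurable_eucl R n)).
Qed.

Lemma gquotZ c f w : gquot (fun x => c * f x) w = `|c| * gquot f w.
Proof. by rewrite /gquot -mulrBr normrM mulrA. Qed.

Lemma gquot_affine f c a w : 0 < c ->
  gquot (fun x => f (c *: x + a)) w = c `^ (n%:R / p + s) * gquot f (c *: w.1 + a, c *: w.2 + a).
Proof.
move=> c0; rewrite /gquot /= opprD addrACA subrr addr0 -scalerBr euclZ (gtr0_norm c0).
rewrite powRM ?(ltW c0) ?eucl_ge0 // invfM mulrCA mulVKf //.
by rewrite gt_eqF // powR_gt0.
Qed.

Hypothesis p0 : 0 < p.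

Lemma gquot_powR f w : gquot f w `^ p =
  `|f w.1 - f w.2| `^ p / eucl (w.1 - w.2) `^ (n%:R + s * p).
Proof.
rewrite powR_div ?powR_ge0 // -powRrM (_ : (n%:R / p + s) * p = n%:R + s * p) //.
by field; rewrite gt_eqF.
Qed.

Lemma gagliardoE f : mfun_rV f -> gagliardo_p s p f = Epow (muP R n) p (gquot f).
Proof.
move=> mf; have mg : measurable_fun setT ((fun w => (gquot f w `^ p)%:E) : (VB * VB)%type -> \bar R).
  by apply: measurable_Epow; exact: mfun_gquot.
have g0 w : (0 <= (gquot f w `^ p)%:E)%E by rewrite lee_fin powR_ge0.
rewrite /Epow (ge0_integral_muP mg g0) /gagliardo_p.
have e x : intN (fun y => ((`|f x - f y| `^ p) / (eucl (x - y) `^ (n%:R + s * p)))%:E) =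
    (\int[mu]_y (gquot f (x, y) `^ p)%:E)%E.
  rewrite -ge0_intN //; last exact: (measurable_fun_pair2 (x : VB) mg).
  by congr intN; apply/funext => y; rewrite gquot_powR.
under eq_fun do rewrite e.
apply: ge0_intN; first exact: (@measurable_fun_fubini_tonelli_F _ _ _ _ _ mu _ mg g0).
by move=> x; exact: integral_ge0.
Qed.

Lemma Epow_gquot_affine f c a : mfun_rV f -> 0 < c ->
  Epow (muP R n) p (gquot (fun x => f (c *: x + a))) =
  ((c `^ (s * p - n%:R))%:E * Epow (muP R n) p (gquot f))%E.
Proof.
move=> mf c0; have mg := mfun_gquot mf.
have ga0 w : 0 <= gquot f (c *: w.1 + a, c *: w.2 + a) by exact: gquot_ge0.
have -> : gquot (fun x => f (c *: x + a)) =
    fun w => c `^ (n%:R / p + s) * gquot f (c *: w.1 + a, c *: w.2 + a).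
  by apply/funext => w; rewrite gquot_affine.
have -> := @EpowZ _ _ R (muP R n) p _ _ (powR_ge0 c (n%:R / p + s)) (mfun_pair_affine c a mg) ga0.
rewrite [X in _ = (_ * X)%E](Epow_muP_affine p a c0 mg).
rewrite muleA -EFinM; congr (_%:E * _)%E.
rewrite -powRrM -!powR_mulrn ?(ltW c0) // -!powRD; try by apply/implyP; rewrite (gt_eqF c0).
by congr (_ `^ _); field; rewrite gt_eqF.
Qed.

Lemma Epow_gquot_conv k u : 1 < p -> Cc_inf k -> (forall x, 0 <= k x) -> \int[mu]_x k x = 1 ->
  continuous u -> compact_support u ->
  (Epow (muP R n) p (gquot (mconv k u)) <= Epow (muP R n) p (gquot u))%E.
Proof.
move=> p1 ck k0 k1 cu su.
have iu : integ u by exact: integrable_Cc.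
have ik : integ k by apply: integrable_Cc; [exact: Cc_inf_continuous|case: ck].
have mu_ : mfun_rV u by exact: continuous_measurable_rV.
have mg := mfun_gquot mu_.
have ish x : integ (fun z => u (z + x) * k z).
  have [M _ kM] := Cc_inf_bounded ck; have mk := Cc_inf_mfun ck.
  by apply: (integ_bounded (M := M)) => //; exact: integ_shift.
(* Diagonal translations preserve [muP] and the distance of the two points, and an increment of
   [mconv k u] is the average of the translated increments of [u]. *)
pose tau (w : V * V) (z : V) := (w.1 + z, w.2 + z).
have mtau : measurable_fun setT ((fun v => gquot u (tau v.1 v.2)) : ((VB * VB) * VB)%type -> R).
  apply: (measurableT_comp mg); apply: measurable_fun_pair; apply: measurable_rVB_add.
  - by apply: measurableT_comp; [exact: measurable_fst|exact: measurable_fst].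
  - exact: measurable_snd.
  - by apply: measurableT_comp; [exact: measurable_snd|exact: measurable_fst].
  - exact: measurable_snd.
have Etau z : Epow (muP R n) p (fun w => gquot u (tau w z)) = Epow (muP R n) p (gquot u).
  have -> : (fun w => gquot u (tau w z)) = gquot (fun x => u (1 *: x + z)).
    by apply/funext => w; rewrite gquot_affine // powR1 mul1r !scale1r.
  by have := Epow_gquot_affine z mu_ ltr01; rewrite powR1 mul1e.
have e w z : gquot u (tau w z) * k z =
    (eucl (w.1 - w.2) `^ (n%:R / p + s))^-1 * `|u (z + w.1) * k z - u (z + w.2) * k z|.
  rewrite /gquot /= opprD addrACA subrr addr0 -mulrBl normrM (ger0_norm (k0 _)).
  by rewrite [_ + w.1]addrC [_ + w.2]addrC; ring.
have itau w : integ (fun z => gquot u (tau w z) * k z).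
  by under [X in integ X]eq_fun do rewrite e; apply: integZ; apply: integ_norm; exact: integB.
have mw : mfun_pair (gquot (mconv k u)).
  apply: mfun_gquot; apply: continuous_measurable_rV; apply: smooth_continuous; exact: smooth_conv.
have le w : gquot (mconv k u) w <= \int[mu]_z (gquot u (tau w z) * k z).
  have -> : \int[mu]_z (gquot u (tau w z) * k z) = \int[mu]_z
    ((eucl (w.1 - w.2) `^ (n%:R / p + s))^-1 * `|u (z + w.1) * k z - u (z + w.2) * k z|).
    by apply: eq_Rintegral => z _; exact: e.
  have i12 := integB (ish w.1) (ish w.2).
  rewrite (RintZ _ (integ_norm i12)) mulrC {1}/gquot (convE _ ck iu) (convE _ ck iu).
  rewrite -(RintB (ish _) (ish _)) ler_wpM2r ?invr_ge0 ?powR_ge0 //.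
  exact: (le_normr_Rintegral measurableT i12).
exact: (mollify_Epow p1 ik k0 k1 mg (gquot_ge0 u) mw (gquot_ge0 _) mtau Etau itau le).
Qed.
End Gagliardo.

(** * Cutoffs *)

Section AveragedCutoff.
Variables (R : realType) (n : nat).
Local Notation V := 'rV[R]_n.
Implicit Types (f g u chi : V -> R) (x y z a : V) (c e : R) (r : seq nat).

Definition is_cutoff chi := [/\ Cc_inf chi, forall x, 0 <= chi x <= 1, chi 0 = 1 &
  forall x, 1 <= eucl x -> chi x = 0].

Definition dilate chi (k : nat) x : R := chi ((k.+1)%:R^-1 *: x).

Definition avg_cutoff chi r x : R := (size r)%:R^-1 * \sum_(k <- r) dilate chi k x.

Lemma Cc_inf_dilate chi k : Cc_inf chi -> Cc_inf (dilate chi k).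
Proof.
move=> cc; have k0 : (k.+1)%:R^-1 != 0 :> R by rewrite invr_eq0 pnatr_eq0.
by have := Cc_inf_affine 0 k0 cc; under [X in Cc_inf X -> _]eq_fun do rewrite addr0.
Qed.

Lemma dilate_cvg chi x : is_cutoff chi -> (fun k => dilate chi k x) @ \oo --> (1 : R).
Proof.
move=> [cc _ c1 _]; have [C C0 HC] := Cc_inf_lipschitz cc.
apply/cvgrPdist_le => e e0; near=> k; rewrite -c1 distrC.
have := HC 0 ((k.+1)%:R^-1 *: x); rewrite add0r -/(dilate chi k x) => /le_trans; apply.
rewrite normrZ ger0_norm ?invr_ge0 // mulrCA ler_pdivrMl ?ltr0n //.
near: k; exists (Num.truncn (C * `|x| / e)) => // k /= hk.
rewrite -ler_pdivrMr //; apply: (le_trans (ltW (truncnS_gt (C * `|x| / e)))).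
by rewrite ler_nat ltnS.
Unshelve. all: by end_near. Qed.

Lemma Cc_inf_sum (I : Type) (r : seq I) (F : I -> V -> R) :
  (forall i, Cc_inf (F i)) -> Cc_inf (fun x => \sum_(i <- r) F i x).
Proof.
move=> cF; split; first by apply: smooth_sum => i; case: (cF i).
elim: r => [|i r [b Hb]]; first by exists 0 => x _; rewrite big_nil.
have [_ [b' Hb']] := cF i; exists (Num.max b b') => x.
by rewrite gt_max => /andP[h1 h2]; rewrite big_cons Hb' // add0r Hb.
Qed.

Lemma Cc_inf_avg_cutoff chi r : is_cutoff chi -> Cc_inf (avg_cutoff chi r).
Proof.
move=> [cc _ _ _]; apply: Cc_infZ; apply: Cc_inf_sum => k; exact: Cc_inf_dilate.
Qed.

Lemma avg_le_of_all (F : nat -> R) (b : R) r : (0 < size r)%N -> (forall k, k \in r -> F k <= b) ->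
  (size r)%:R^-1 * \sum_(k <- r) F k <= b.
Proof.
move=> r0 Fb; rewrite ler_pdivrMl ?ltr0n // -sum1_size natr_sum mulr_suml.
by rewrite big_seq [leRHS]big_seq; apply: ler_sum => k /Fb; rewrite mul1r.
Qed.

Lemma avg_cutoff_bound chi r x : is_cutoff chi -> (0 < size r)%N -> 0 <= avg_cutoff chi r x <= 1.
Proof.
move=> [_ c01 _ _] r0; apply/andP; split.
  by rewrite mulr_ge0 ?invr_ge0 // sumr_ge0 // => k _; have /andP[] := c01 ((k.+1)%:R^-1 *: x).
by apply: avg_le_of_all => // k _; have /andP[] := c01 ((k.+1)%:R^-1 *: x).
Qed.

(** The error functions [A] are abstract, so the averaging serves increments as well as gradients.
    Starting the indices late enough makes every dilated cutoff, hence the average, close to 1 at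
    the two prescribed points. *)
Lemma cutoff_average d (Z : measurableType d) (nu : {measure set Z -> \bar R}) (p C e : R)
    chi (A : nat -> Z -> R) x y : 1 < p -> is_cutoff chi ->
  (forall k, measurable_fun setT (A k)) -> (forall k t, 0 <= A k t) ->
  (forall k, (Epow nu p (A k) <= C%:E)%E) -> (forall t, A ^~ t @ \oo --> 0) -> 0 < e ->
  exists r, [/\ (0 < size r)%N,
    (Epow nu p (fun t => ((size r)%:R^-1 * \sum_(k <- r) A k t)%R) <= e%:E)%E,
    1 - avg_cutoff chi r x <= e & 1 - avg_cutoff chi r y <= e].
Proof.
move=> p1 cc mA A0 AC Acvg e0.
have near1 z : exists k0, forall k, (k0 <= k)%N -> 1 - dilate chi k z <= e.
  have /cvgrPdist_le /(_ e e0) [k0 _ H] := @dilate_cvg chi z cc.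
  by exists k0 => k /H h; rewrite (le_trans (ler_norm _)).
have [kx Hx] := near1 x; have [ky Hy] := near1 y.
have [r [r0 rk rE]] := cesaro_Epow_small (maxn kx ky) p1 mA A0 AC Acvg e0.
exists r; split => //.
  have -> : 1 - avg_cutoff chi r x = (size r)%:R^-1 * \sum_(k <- r) (1 - dilate chi k x).
    rewrite sumrB mulrBr; congr (_ - _).
    rewrite big_const_seq count_predT iter_addr addr0 -[1 *+ _]/((size r)%:R) mulVf //.
    by rewrite pnatr_eq0 -lt0n.
  apply: avg_le_of_all => // k kr; apply: Hx.
  by apply: leq_trans (leq_maxl _ ky) _; exact: (allP rk).
have -> : 1 - avg_cutoff chi r y = (size r)%:R^-1 * \sum_(k <- r) (1 - dilate chi k y).
  rewrite sumrB mulrBr; congr (_ - _).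
  rewrite big_const_seq count_predT iter_addr addr0 -[1 *+ _]/((size r)%:R) mulVf //.
  by rewrite pnatr_eq0 -lt0n.
apply: avg_le_of_all => // k kr; apply: Hy.
by apply: leq_trans (leq_maxr kx _) _; exact: (allP rk).
Qed.
End AveragedCutoff.

(** * Finite energy of the weighted cutoff kernel *)

Section CutoffEnergy.
Variables (R : realType) (n : nat) (s p : R).
Local Notation V := 'rV[R]_n.
Local Notation mu := (muN R n).
Local Notation VB := (rVB R n).
Implicit Types (f g u chi : V -> R) (x y z : V) (a c : R) (w : V * V).
Hypotheses (n1 : (1 <= n)%N) (s0 : 0 < s) (s1 : s < 1) (p1 : 1 < p) (nsp : n%:R < s * p).
Let p0 : 0 < p. Proof. exact: lt_trans ltr01 p1. Qed.
Let alpha := alpha_sp n s p.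

Lemma alpha_gt0 : 0 < alpha.
Proof. by rewrite /alpha /alpha_sp subr_gt0 ltr_pdivrMr. Qed.

Lemma alphaM : alpha * p = s * p - n%:R.
Proof. by rewrite /alpha /alpha_sp mulrBl mulfVK // gt_eqF. Qed.

Definition far_pow (a : R) z : R := if 1 < eucl z then eucl z `^ (- a) else 0.
Definition near_pow (a : R) z : R := if 0 < eucl z <= 1 then eucl z `^ (- a) else 0.
Definition ball_ind (r : R) z : R := if eucl z <= r then 1 else 0.

Lemma mfun_far_pow a : mfun_rV (far_pow a).
Proof.
apply: measurable_fun_ifT.
- by apply: measurable_fun_ltr; [exact: measurable_cst|exact: measurable_eucl].
- exact: (measurableT_comp (measurable_powR _) (@measurable_eucl R n)).
- exact: measurable_cst.
Qed.

Lemma mfun_near_pow a : mfun_rV (near_pow a).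
Proof. exact: measurable_annulus_pow. Qed.

Lemma mfun_ball_ind r : mfun_rV (ball_ind r).
Proof.
apply: measurable_fun_ifT; [|exact: measurable_cst|exact: measurable_cst].
by apply: measurable_fun_ler; [exact: measurable_eucl|exact: measurable_cst].
Qed.

Lemma far_pow_ge0 a z : 0 <= far_pow a z.
Proof. by rewrite /far_pow; case: ifP => // _; exact: powR_ge0. Qed.

Lemma near_pow_ge0 a z : 0 <= near_pow a z.
Proof. by rewrite /near_pow; case: ifP => // _; exact: powR_ge0. Qed.

Lemma ball_ind_ge0 r z : 0 <= ball_ind r z.
Proof. by rewrite /ball_ind; case: ifP. Qed.

Lemma integral_ball_ind_lty r : (\int[mu]_z (ball_ind r z)%:E < +oo)%E.
Proof.
have [|||I0 h] := @integral_bounded_ball R n (ball_ind r) 1 r.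
- exact: mfun_ball_ind.
- by move=> z; rewrite ball_ind_ge0 /ball_ind; case: ifP; rewrite ?lexx ?ler01.
- by move=> z rz; rewrite /ball_ind leNgt rz.
by apply: le_lt_trans h _; rewrite ltry.
Qed.

(* The weight [max 1 |y|^alpha] dominates both the constant 1 and [|y|^alpha]. *)
Definition cutoff_kernel chi w : R := Num.max 1 (eucl w.2) `^ alpha * gquot s p chi w.

Lemma cutoff_kernel_ge0 chi w : 0 <= cutoff_kernel chi w.
Proof. by rewrite mulr_ge0 ?powR_ge0 // gquot_ge0. Qed.

Lemma mfun_cutoff_kernel chi : mfun_rV chi -> mfun_pair (cutoff_kernel chi).
Proof.
move=> mc; apply: measurable_funM; last exact: mfun_gquot.
apply: (measurableT_comp (measurable_powR _)); apply: measurable_maxr => //.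
exact: (mfun_pair_snd (@measurable_eucl R n)).
Qed.

Let gamma := n%:R + s * p.

(** Close to the diagonal the Lipschitz bound on the cutoff gains [|z|^p]; at distance above 1 it is
    enough that increments of the cutoff are at most 1. *)
Let near_kernel (L : R) z : R := L `^ p * near_pow (gamma - p) z + far_pow gamma z.

(** For [|y| <= 2] the weight is bounded, and the kernel depends on [x - y] only. For [|y| > 2] only
    [|x| < 1] contributes, there [|x - y| >= |y| / 2], and the powers combine to
    [alpha p - gamma = - 2 n]. *)
Lemma cutoff_kernel_le chi (L : R) w : is_cutoff chi -> 0 <= L ->
  (forall x y, `|chi x - chi y| <= L * eucl (x - y)) ->
  cutoff_kernel chi w `^ p <=
    (2 `^ (alpha * p) * ball_ind 2 w.2) * near_kernel L (w.1 - w.2) +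
    ball_ind 1 w.1 * (2 `^ gamma * far_pow (2 * n%:R) w.2).
Proof.
move=> [_ c01 _ cs] L0 HL; case: w => x y /=.
have nk0 z : 0 <= near_kernel L z.
  by rewrite addr_ge0 ?far_pow_ge0 // mulr_ge0 ?powR_ge0 ?near_pow_ge0.
rewrite /cutoff_kernel powRM ?powR_ge0 ?gquot_ge0 // -powRrM gquot_powR //= -/gamma.
have c1 : `|chi x - chi y| <= 1.
  by have /andP[? ?] := c01 x; have /andP[? ?] := c01 y; rewrite ler_norml; apply/andP; split; lra.
have g0 : 0 < gamma by rewrite /gamma ltr_wpDl // mulr_gt0.
have pow1 : 1 `^ p = 1 :> R by rewrite powR1.
have zpow (t : R) : t = 0 -> `|t| `^ p = 0 by move=> ->; rewrite normr0 powR0 ?gt_eqF.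
have [y2|y2] := lerP (eucl y) 2.
  apply: (@le_trans _ _ (2 `^ (alpha * p) * ball_ind 2 y * near_kernel L (x - y))); last first.
    by rewrite lerDl !mulr_ge0 ?ball_ind_ge0 ?powR_ge0 ?far_pow_ge0.
  rewrite /ball_ind y2 mulr1; apply: ler_pM; rewrite ?powR_ge0 ?divr_ge0 ?powR_ge0 //.
    apply: powR_mono; rewrite ?mulr_ge0 ?(ltW alpha_gt0) ?(ltW p0) // ?le_max ?ler01 //.
    by rewrite ge_max y2 andbT ler1n.
  have [z0|z0] := lerP (eucl (x - y)) 0.
    have /eqP : eucl (x - y) == 0 by rewrite eq_le z0 eucl_ge0.
    move=> /eqP; rewrite eucl_eq0 subr_eq0 => /eqP ->.
    by rewrite zpow ?subrr // mul0r.
  rewrite /near_kernel; have [z1|z1] := lerP (eucl (x - y)) 1.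
    rewrite /near_pow /far_pow z0 z1 ltNge z1 /= addr0 opprB.
    rewrite ler_pdivrMr ?powR_gt0 // -mulrA -powRD; last by rewrite (gt_eqF z0) implybT.
    rewrite subrK -powRM ?eucl_ge0 //; apply: powR_mono => //; exact: ltW.
  rewrite /near_pow /far_pow [eucl _ <= 1]leNgt z1 z0 /= mulr0 add0r powRN ler_piMl ?invr_ge0 ?powR_ge0 //.
  by rewrite -[leRHS]pow1; apply: powR_mono => //; exact: ltW.
rewrite {1}/ball_ind [eucl y <= 2]leNgt y2 /= mulr0 mul0r add0r.
have [x1|x1] := ltP (eucl x) 1; last first.
  rewrite zpow; last by rewrite !cs ?subrr //; lra.
  by rewrite mul0r mulr0 !mulr_ge0 ?ball_ind_ge0 ?powR_ge0 ?far_pow_ge0.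
have y0 : 0 < eucl y by lra.
rewrite /ball_ind (ltW x1) mul1r /far_pow ifT; last by lra.
have -> : Num.max 1 (eucl y) = eucl y by apply/max_r; lra.
have zy : eucl y / 2 <= eucl (x - y).
  by have := ler_euclB y x 0; rewrite !subr0 euclB_sym; lra.
apply: (@le_trans _ _ (eucl y `^ (alpha * p) * ((eucl y / 2) `^ gamma)^-1)).
  rewrite ler_wpM2l ?powR_ge0 // -[leRHS]mul1r; apply: ler_pM; rewrite ?powR_ge0 ?invr_ge0 ?powR_ge0 //.
    by rewrite -[leRHS]pow1; apply: powR_mono => //; exact: ltW.
  rewrite lef_pV2 ?posrE ?powR_gt0 ?divr_gt0 //; last by lra.
  by apply: powR_mono; rewrite ?(ltW g0) // divr_ge0 // ltW.
rewrite powR_div ?(ltW y0) // invf_div mulrCA ler_wpM2l ?powR_ge0 // -powRN -powRD; last first.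
  by rewrite (gt_eqF y0) implybT.
rewrite (_ : alpha * p - gamma = - (2 * n%:R)) //.
by rewrite alphaM /gamma; ring.
Qed.

(** Three exponents decide: [gamma - p < n] at the origin, which is where [s < 1] enters, and
    [gamma > n] and [2 n > n] at infinity. The two terms of the bound integrate as a convolution and
    as a product. *)
Lemma Epow_cutoff_kernel_lty chi : is_cutoff chi ->
  (Epow (muP R n) p (cutoff_kernel chi) < +oo)%E.
Proof.
move=> cc; have [cinf c01 _ _] := cc; have [L L0 HL] := Cc_inf_lipschitz cinf.
have HL' x y : `|chi x - chi y| <= L * eucl (x - y).
  have := HL y (x - y); rewrite [y + _]addrC subrK => /le_trans; apply.
  by rewrite ler_wpM2l // norm_le_eucl.
pose A y := 2 `^ (alpha * p) * ball_ind 2 y; pose B y := 2 `^ gamma * far_pow (2 * n%:R) y.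
have A0 y : 0 <= A y by rewrite mulr_ge0 ?powR_ge0 ?ball_ind_ge0.
have B0 y : 0 <= B y by rewrite mulr_ge0 ?powR_ge0 ?far_pow_ge0.
have K0 z : 0 <= near_kernel L z.
  by rewrite addr_ge0 ?far_pow_ge0 // mulr_ge0 ?powR_ge0 ?near_pow_ge0.
have mA : mfun_rV A by apply: measurable_funM => //; exact: mfun_ball_ind.
have mB : mfun_rV B by apply: measurable_funM => //; exact: mfun_far_pow.
have mK : mfun_rV (near_kernel L).
  by apply: measurable_funD; [apply: measurable_funM => //; exact: mfun_near_pow|exact: mfun_far_pow].
have scal (c : R) (h : V -> R) : 0 <= c -> mfun_rV h -> (forall z, 0 <= h z) ->
    (\int[mu]_z (h z)%:E < +oo)%E -> (\int[mu]_z (c * h z)%:E < +oo)%E.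
  move=> c0 mh h0 hI; under eq_integral do rewrite EFinM.
  rewrite ge0_integralZl ?lee_fin //; last 2 first.
  - exact/measurable_EFinP.
  - by move=> z _; rewrite lee_fin.
  by apply: lte_mul_pinfty; rewrite ?lee_fin.
have IA : (\int[mu]_z (A z)%:E < +oo)%E.
  by apply: scal; rewrite ?powR_ge0 //; [exact: mfun_ball_ind|exact: ball_ind_ge0|exact: integral_ball_ind_lty].
have IB : (\int[mu]_z (B z)%:E < +oo)%E.
  apply: scal; rewrite ?powR_ge0 //; [exact: mfun_far_pow|exact: far_pow_ge0|].
  by apply: integral_tail_lty; rewrite mulr_natl mulr2n ltrDl ltr0n.
have I1 : (\int[mu]_z (ball_ind 1 z)%:E < +oo)%E by exact: integral_ball_ind_lty.
have IK : (\int[mu]_z (near_kernel L z)%:E < +oo)%E.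
  under eq_integral do rewrite EFinD.
  rewrite ge0_integralD //; last 4 first.
  - by move=> z _; rewrite lee_fin mulr_ge0 ?powR_ge0 ?near_pow_ge0.
  - by apply/measurable_EFinP; apply: measurable_funM => //; exact: mfun_near_pow.
  - by move=> z _; rewrite lee_fin far_pow_ge0.
  - by apply/measurable_EFinP; exact: mfun_far_pow.
  apply: lte_add_pinfty.
    apply: scal; rewrite ?powR_ge0 //; [exact: mfun_near_pow|exact: near_pow_ge0|].
    apply: integral_origin_lty; rewrite /gamma -addrA gtrDl subr_lt0.
    by rewrite -[ltRHS]mul1r ltr_pM2r.
  by apply: integral_tail_lty; rewrite /gamma ltrDl mulr_gt0.
have prod_lty (x y : \bar R) : (0 <= x -> 0 <= y -> x < +oo -> y < +oo -> x * y < +oo)%E.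
  by move=> x0 y0 xo yo; apply: lte_mul_pinfty => //; rewrite ge0_fin_numE.
have Ige0 (h : V -> R) : (forall z, 0 <= h z) -> (0 <= \int[mu]_z (h z)%:E)%E.
  by move=> h0; apply: integral_ge0 => z _; rewrite lee_fin.
have mT1 : mfun_pair (fun w => A w.2 * near_kernel L (w.1 - w.2)).
  by apply: measurable_funM; [exact: mfun_pair_snd|exact: mfun_pair_sub].
have mT2 : mfun_pair (fun w => ball_ind 1 w.1 * B w.2).
  by apply: measurable_funM; [apply: mfun_pair_fst; exact: mfun_ball_ind|exact: mfun_pair_snd].
apply: (@le_lt_trans _ _ (\int[muP R n]_w ((A w.2 * near_kernel L (w.1 - w.2))%:E +
    (ball_ind 1 w.1 * B w.2)%:E))%E).
  apply: ge0_le_integral => //.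
  - by move=> w _; rewrite lee_fin powR_ge0.
  - by apply: measurable_Epow; apply: mfun_cutoff_kernel; exact: Cc_inf_mfun.
  - by apply: emeasurable_funD; apply/measurable_EFinP; [exact: mT1|exact: mT2].
  - by move=> w _; rewrite -EFinD lee_fin; exact: cutoff_kernel_le.
rewrite ge0_integralD //; last 4 first.
- by move=> w _; rewrite lee_fin mulr_ge0.
- by apply/measurable_EFinP; exact: mT1.
- by move=> w _; rewrite lee_fin mulr_ge0 ?ball_ind_ge0.
- by apply/measurable_EFinP; exact: mT2.
rewrite (integral_muP_convolution mA mK A0 K0).
rewrite (integral_muP_product (mfun_ball_ind 1) mB (ball_ind_ge0 1) B0).
by apply: lte_add_pinfty; apply: prod_lty => //; apply: Ige0 => //; exact: ball_ind_ge0.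
Qed.
End CutoffEnergy.

(** * Approximation at two prescribed points *)

Section MollifierClose.
Variables (R : realType) (n : nat).
Local Notation V := 'rV[R]_n.
Local Notation mu := (muN R n).
Implicit Types (f g u k chi : V -> R) (x y z : V).

Lemma continuous_eucl_near u x (e : R) : continuous u -> 0 < e ->
  exists2 r, 0 < r & forall z, eucl z <= r -> `|u (z + x) - u x| <= e.
Proof.
move=> cu e0; have /nbhs_ballP[r /= r0 hr] : \forall y \near x, `|u x - u y| < e.
  by have /cvgrPdist_lt := cu x; apply.
exists (r / 2) => [|z zr]; first by rewrite divr_gt0.
rewrite distrC ltW //; apply: hr; rewrite /= mx_norm_ball /ball_ /=.
rewrite opprD addrCA subrr addr0 normrN (le_lt_trans (norm_le_eucl z)) // (le_lt_trans zr) //.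
by rewrite ltr_pdivrMr // ltr_pMr // ltr1n.
Qed.

(** One kernel serves both points if its support radius is the smaller of the two radii of
    continuity. *)
Lemma mconv_close u x y (e : R) : continuous u -> compact_support u -> 0 < e ->
  exists k, [/\ Cc_inf k, forall z, 0 <= k z, \int[mu]_z k z = 1 &
    `|mconv k u x - u x| <= e /\ `|mconv k u y - u y| <= e].
Proof.
move=> cu su e0; have iu : integ u by exact: integrable_Cc.
have [rx rx0 hx] := continuous_eucl_near x cu e0.
have [ry ry0 hy] := continuous_eucl_near y cu e0.
have r0 : 0 < Num.min rx ry by rewrite lt_min rx0 ry0.
have [k [ck k0 ks k1]] := @mollifier_exists R n _ r0.
have ik : integ k by apply: integrable_Cc; [exact: Cc_inf_continuous|case: ck].
have close v : (forall z, eucl z <= Num.min rx ry -> `|u (z + v) - u v| <= e) ->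
    `|mconv k u v - u v| <= e.
  move=> hv; rewrite (convE _ ck iu).
  have ish : integ (fun z => u (z + v) * k z).
    have [M _ kM] := Cc_inf_bounded ck; have mk := Cc_inf_mfun ck.
    by apply: (integ_bounded (M := M)) => //; exact: integ_shift.
  have -> : u v = \int[mu]_z (u v * k z) by rewrite (RintZ _ ik) k1 mulr1.
  rewrite -(RintB ish (integZ _ ik)).
  have i12 := integB ish (integZ (u v) ik).
  apply: (le_trans (le_normr_Rintegral measurableT i12)).
  rewrite -[leRHS]mulr1 -k1 -(RintZ _ ik).
  apply: le_Rint; [exact: integ_norm|exact: integZ|].
  move=> z; rewrite -mulrBl normrM (ger0_norm (k0 z)).
  have [zr|rz] := lerP (eucl z) (Num.min rx ry); first by rewrite ler_wpM2r // hv.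
  by rewrite ks ?(ltW rz) // !mulr0.
exists k; split => //; split; apply: close => z; rewrite le_min => /andP[h1 h2]; first exact: hx.
exact: hy.
Qed.
(** Half of [e] pays for the cutoff, whose error at a point is [1 - avg_cutoff] times the value of
    [u], and half for the mollification. *)
Lemma mollified_cutoff_close chi r u x y (e : R) : continuous u -> is_cutoff chi -> (0 < size r)%N ->
  0 < e ->
  1 - avg_cutoff chi r x <= e / (2 * (1 + `|u x| + `|u y|)) ->
  1 - avg_cutoff chi r y <= e / (2 * (1 + `|u x| + `|u y|)) ->
  exists k, [/\ Cc_inf k, forall z, 0 <= k z, \int[mu]_z k z = 1 &
    `|mconv k (fun z => avg_cutoff chi r z * u z) x - u x| <= e /\
    `|mconv k (fun z => avg_cutoff chi r z * u z) y - u y| <= e].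
Proof.
move=> cu cc r0 e0 rx ry; pose phi := avg_cutoff chi r; pose uc z := phi z * u z.
have cphi : Cc_inf phi by exact: Cc_inf_avg_cutoff.
have cuc : continuous uc.
  by move=> z; rewrite /uc; apply: (@cvgM R V (nbhs z) _ phi u); [apply: Cc_inf_continuous|exact: cu].
have suc : compact_support uc.
  by have [_ [b Hb]] := cphi; exists b => z /Hb; rewrite /uc => ->; rewrite mul0r.
have d0 : 0 < 1 + `|u x| + `|u y| by rewrite -addrA ltr_pwDl // addr_ge0.
have e20 : 0 < e / 2 by rewrite divr_gt0.
have [k [ck k0 k1 [kx ky]]] := mconv_close x y cuc suc e20.
have closeu z : 1 - phi z <= e / (2 * (1 + `|u x| + `|u y|)) -> `|u z| <= 1 + `|u x| + `|u y| ->
    `|uc z - u z| <= e / 2.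
  move=> hz fz; have /andP[p_0 p_1] := avg_cutoff_bound z cc r0.
  have -> : uc z - u z = - ((1 - phi z) * u z) by rewrite /uc; ring.
  rewrite normrN normrM ger0_norm ?subr_ge0 //.
  apply: (@le_trans _ _ (e / (2 * (1 + `|u x| + `|u y|)) * (1 + `|u x| + `|u y|))).
    by apply: ler_pM => //; rewrite subr_ge0.
  by rewrite le_eqVlt; apply/orP; left; apply/eqP; field; rewrite gt_eqF.
exists k; split => //; split.
- have -> : mconv k uc x - u x = (mconv k uc x - uc x) + (uc x - u x) by ring.
  rewrite (splitr e) (le_trans (ler_normD _ _)) // lerD // closeu //.
  by rewrite addrAC lerDr addr_ge0.
- have -> : mconv k uc y - u y = (mconv k uc y - uc y) + (uc y - u y) by ring.
  rewrite (splitr e) (le_trans (ler_normD _ _)) // lerD // closeu //.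
  by rewrite lerDr addr_ge0.
Qed.
End MollifierClose.

(* Only increments of [f] matter, so [f] is approximated up to the constant [f 0]. *)
Definition approximable (R : realType) (n : nat) (s p : R) (f : 'rV[R]_n -> R) (v : \bar R) :=
  forall (e : R) (x y : 'rV[R]_n), 0 < e -> exists w, [/\ Cc_inf w,
    (Wsp_smooth_p s p w <= (1 + e)%:E * v + e%:E)%E,
    `|w x - (f x - f 0)| <= e & `|w y - (f y - f 0)| <= e].

Section FractionalApproximation.
Variables (R : realType) (n : nat) (s p : R).
Local Notation V := 'rV[R]_n.
Local Notation mu := (muN R n).
Implicit Types (f g u chi : V -> R) (x y z : V) (a c : R) (w : V * V).
Hypotheses (n1 : (1 <= n)%N) (s0 : 0 < s) (s1 : s < 1) (p1 : 1 < p) (nsp : n%:R < s * p).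
Let p0 : 0 < p. Proof. exact: lt_trans ltr01 p1. Qed.
Let alpha := alpha_sp n s p.

Lemma alpha_scaling : (alpha - (n%:R / p + s)) * p = - (n%:R + n%:R).
Proof. by rewrite /alpha /alpha_sp; field; rewrite gt_eqF. Qed.

(** The second term of the discrete product rule [phi x * (f x - f y) + f y * (phi x - phi y)], the
    one in which the cutoff is differenced. *)
Definition cutoff_error chi f (k : nat) w : R := `|f w.2| * gquot s p (dilate chi k) w.

Lemma cutoff_error_ge0 chi f k w : 0 <= cutoff_error chi f k w.
Proof. by rewrite mulr_ge0 // gquot_ge0. Qed.

Lemma mfun_cutoff_error chi f k : Cc_inf chi -> mfun_rV f -> mfun_pair (cutoff_error chi f k).
Proof.
move=> cc mf; apply: measurable_funM.
  by apply: measurableT_comp => //; exact: mfun_pair_snd.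
by apply: mfun_gquot; apply: Cc_inf_mfun; exact: Cc_inf_dilate.
Qed.

(** Substituting [l x] with [l = k + 1] and using [|f y| <= |y|^alpha], the error is at most
    [l^(alpha - n / p - s)] times the kernel of the undilated cutoff. Its p-th power [l^(- 2 n)]
    cancels the Jacobian exactly: the bound is uniform in [k] but does not decay. *)
Lemma Epow_cutoff_error chi f k : is_cutoff chi -> mfun_rV f ->
  (forall y, `|f y| <= eucl y `^ alpha) ->
  (Epow (muP R n) p (cutoff_error chi f k) <= Epow (muP R n) p (cutoff_kernel s p chi))%E.
Proof.
move=> cc mf fa; have cinf : Cc_inf chi by case: cc.
pose l : R := (k.+1)%:R; have l0 : 0 < l by rewrite ltr0n.
have mA := mfun_cutoff_error k cinf mf.
have mK := mfun_cutoff_kernel s p (Cc_inf_mfun cinf).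
have a0 : 0 < alpha by exact: alpha_gt0.
have E1 := Epow_muP_affine p (0 : V) l0 mA.
set A' := (fun w => cutoff_error chi f k (l *: w.1 + 0, l *: w.2 + 0)) in E1.
have E2 : (Epow (muP R n) p A' <=
    Epow (muP R n) p (fun w => l `^ (alpha - (n%:R / p + s)) * cutoff_kernel s p chi w)%R)%E.
  apply: le_Epow.
  - exact: ltW.
  - exact: mfun_pair_affine.
  - by apply: measurable_funM; [exact: measurable_cst|exact: mK].
  - by move=> w; exact: cutoff_error_ge0.
  move=> w; rewrite /A' /cutoff_error /= /cutoff_kernel.
  have -> : gquot s p (dilate chi k) (l *: w.1 + 0, l *: w.2 + 0) =
      l `^ (- (n%:R / p + s)) * gquot s p chi w.
    have := @gquot_affine R n s p (dilate chi k) l 0 w l0.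
    have -> : (fun x => dilate chi k (l *: x + 0)) = chi.
      by apply/funext => x; rewrite /dilate addr0 scalerA mulVf ?scale1r // gt_eqF.
    by move=> ->; rewrite mulrA -powRD ?addNr ?powRr0 ?mul1r // (gt_eqF l0) implybT.
  rewrite powRD; last by rewrite (gt_eqF l0) implybT.
  rewrite mulrCA.
  have -> : l `^ alpha * l `^ (- (n%:R / p + s)) * (Num.max 1 (eucl w.2) `^ alpha_sp n s p * gquot s p chi w) =
    l `^ (- (n%:R / p + s)) * (l `^ alpha * Num.max 1 (eucl w.2) `^ alpha * gquot s p chi w).
    by rewrite /alpha; ring.
  rewrite ler_wpM2l ?powR_ge0 // ler_wpM2r ?gquot_ge0 //.
  rewrite addr0 (le_trans (fa _)) // euclZ (gtr0_norm l0) powRM ?(ltW l0) ?eucl_ge0 //.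
  rewrite ler_wpM2l ?powR_ge0 //; apply: powR_mono; rewrite ?eucl_ge0 ?(ltW a0) //.
  by rewrite le_max lexx orbT.
have E3 := @EpowZ _ _ R (muP R n) p _ _ (powR_ge0 l (alpha - (n%:R / p + s))) mK (cutoff_kernel_ge0 s p chi).
rewrite E1; apply: (@le_trans _ _ ((l ^+ n * l ^+ n)%:E *
    ((l `^ (alpha - (n%:R / p + s)) `^ p)%:E * Epow (muP R n) p (cutoff_kernel s p chi)))%E).
  apply: lee_wpmul2l; first by rewrite lee_fin mulr_ge0 // exprn_ge0 // ltW.
  by rewrite -E3.
rewrite muleA -EFinM -powRrM alpha_scaling -!powR_mulrn ?(ltW l0) // -!powRD.
- by rewrite subrr powRr0 mul1e.
- by rewrite (gt_eqF l0) implybT.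
- by rewrite (gt_eqF l0) implybT.
Qed.

Lemma cutoff_error_cvg chi f w : is_cutoff chi -> (fun k => cutoff_error chi f k w) @ \oo --> (0 : R).
Proof.
move=> cc; rewrite /cutoff_error -[X in _ --> X](mulr0 `|f w.2|); apply: cvgMl_tmp.
rewrite -[X in _ --> X](mul0r (eucl (w.1 - w.2) `^ (n%:R / p + s))^-1); apply: cvgMr_tmp.
rewrite -[X in _ --> X](@normr0 R R) -(subrr (1 : R)).
by apply: cvg_norm; apply: cvgB; exact: dilate_cvg.
Qed.

Lemma approximable_fractional f : continuous f ->
  (forall x y, `|f x - f y| <= eucl (x - y) `^ alpha) ->
  (gagliardo_p s p f < +oo)%E -> approximable s p f (gagliardo_p s p f).
Proof.
move=> cf fa fE e x y e0.
have mf : mfun_rV f by exact: continuous_measurable_rV.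
have EE := gagliardoE s p0 mf.
pose f0 z := f z - f 0.
have cf0 : continuous f0 by move=> z; rewrite /f0; apply: (@cvgB R R V (nbhs z) _ f (fun=> f 0)); [exact: (cf z)|exact: cvg_cst].
have mf0 : mfun_rV f0 by exact: continuous_measurable_rV.
have f0a z : `|f0 z| <= eucl z `^ alpha by have := fa z 0; rewrite subr0.
have g0E : gquot s p f0 = gquot s p f.
  by apply/funext => w; rewrite /gquot /f0 opprB addrA subrK.
have [chi cc] := @cutoff_exists R n; have cc' : is_cutoff chi by [].
have cinf : Cc_inf chi by case: cc.
have Kfin := Epow_cutoff_kernel_lty n1 s0 s1 p1 nsp cc'.
pose C := fine (Epow (muP R n) p (cutoff_kernel s p chi)).
have AC k : (Epow (muP R n) p (cutoff_error chi f0 k) <= C%:E)%E.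
  rewrite /C fineK; first exact: Epow_cutoff_error.
  by rewrite ge0_fin_numE // Epow_ge0.
have [D D0 HD] := le_EpowD (muP R n) p0 e0.
pose h := e / (2 * (1 + `|f0 x| + `|f0 y|)).
have d0 : 0 < 1 + `|f0 x| + `|f0 y| by rewrite -addrA ltr_pwDl // addr_ge0.
have h0 : 0 < h by rewrite divr_gt0 // mulr_gt0.
(* [h] is the tolerance of [mollified_cutoff_close]. The other bound keeps the error energy, which
   [le_EpowD] multiplies by [D], below [e]; the [+ 1] covers [D = 0]. *)
have m0 : 0 < Num.min h (e / (D + 1)) by rewrite lt_min h0 divr_gt0 // ltr_wpDl.
have [r [r0 rE rx ry]] := cutoff_average x y p1 cc' (fun k => mfun_cutoff_error k cinf mf0)
  (cutoff_error_ge0 chi f0) AC (fun w => cutoff_error_cvg f0 w cc') m0.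
pose phi := avg_cutoff chi r; pose u z := phi z * f0 z.
have cphi : Cc_inf phi by exact: Cc_inf_avg_cutoff.
have cu : continuous u.
  by move=> z; rewrite /u; apply: (@cvgM R V (nbhs z) _ phi f0); [apply: Cc_inf_continuous|exact: cf0].
have su : compact_support u.
  by have [_ [b Hb]] := cphi; exists b => z /Hb; rewrite /u => ->; rewrite mul0r.
have mu_ : mfun_rV u by exact: continuous_measurable_rV.
pose B w := (size r)%:R^-1 * \sum_(k <- r) cutoff_error chi f0 k w.
have mB : mfun_pair B.
  apply: measurable_funM; first exact: measurable_cst.
  by apply: measurable_sum => k; exact: mfun_cutoff_error.
have B0 w : 0 <= B w.
  by rewrite mulr_ge0 ?invr_ge0 // sumr_ge0 // => k _; exact: cutoff_error_ge0.
have mg := mfun_gquot s p mf.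
have uB w : gquot s p u w <= gquot s p f w + B w.
  rewrite -g0E /gquot /B /cutoff_error /gquot.
  under eq_bigr do rewrite mulrA.
  rewrite -mulr_suml mulrA -mulrDl ler_wpM2r ?invr_ge0 ?powR_ge0 //.
  have -> : u w.1 - u w.2 = phi w.1 * (f0 w.1 - f0 w.2) + f0 w.2 * (phi w.1 - phi w.2).
    by rewrite /u; ring.
  rewrite (le_trans (ler_normD _ _)) // lerD //.
    rewrite normrM -[leRHS]mul1r ler_wpM2r //.
    by have /andP[? ?] := avg_cutoff_bound w.1 cc' r0; rewrite ger0_norm.
  rewrite normrM -mulr_sumr mulrCA ler_wpM2l // /phi /avg_cutoff -mulrBr -sumrB normrM.
  rewrite ger0_norm ?invr_ge0 // ler_wpM2l ?invr_ge0 //; exact: ler_norm_sum.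
have uE : (Epow (muP R n) p (gquot s p u) <= (1 + e)%:E * Epow (muP R n) p (gquot s p f) + e%:E)%E.
  apply: (@le_trans _ _ (Epow (muP R n) p (fun w => gquot s p f w + B w)%R)).
    apply: le_Epow => //; [exact: ltW|exact: mfun_gquot|exact: measurable_funD|].
    by move=> w; exact: gquot_ge0.
  apply: (le_trans (HD _ _ mg mB (gquot_ge0 s p f) B0)); apply: leeD => //.
  apply: (@le_trans _ _ (D%:E * (Num.min h (e / (D + 1)))%:E)%E).
    by apply: lee_wpmul2l; rewrite ?lee_fin.
  rewrite -EFinM lee_fin (@le_trans _ _ (D * (e / (D + 1)))) //.
    by rewrite ler_wpM2l // ge_min lexx orbT.
  by rewrite mulrCA ler_piMr ?(ltW e0) // ler_pdivrMr ?ltr_wpDl // mul1r lerDl.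
have weaken z : 1 - avg_cutoff chi r z <= Num.min h (e / (D + 1)) -> 1 - avg_cutoff chi r z <= h.
  by move=> hz; rewrite (le_trans hz) // ge_min lexx.
have [k [ck k0 k1 [kx ky]]] := mollified_cutoff_close cf0 cc' r0 e0 (weaken x rx) (weaken y ry).
exists (mconv k u); split => //.
- apply: Cc_inf_conv => //; exact: integrable_Cc.
- rewrite /Wsp_smooth_p (lt_eqF s1) EE.
  have -> : gagliardo_p s p (mconv k u) = Epow (muP R n) p (gquot s p (mconv k u)).
    apply: gagliardoE => //; apply: continuous_measurable_rV; apply: smooth_continuous.
    by apply: smooth_conv => //; exact: integrable_Cc.
  exact: le_trans (Epow_gquot_conv s p0 p1 ck k0 k1 cu su) uE.
Qed.
End FractionalApproximation.

(** * Weak gradients *)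

Section IntegrationByParts.
Variables (R : realType) (n : nat).
Local Notation V := 'rV[R]_n.
Local Notation mu := (muN R n).
Implicit Types (f h psi : V -> R) (x y v : V) (r : R).

Lemma integ_Cc_inf h : Cc_inf h -> integ h.
Proof. by move=> ch; apply: integrable_Cc; [exact: Cc_inf_continuous|case: ch]. Qed.

Lemma integ_ball_ind r : integ (@ball_ind R n r).
Proof.
apply/integrableP; split; first by apply/measurable_EFinP; exact: mfun_ball_ind.
rewrite (eq_integral (fun x : rVB R n => (ball_ind r x)%:E)) ?integral_ball_ind_lty // => x _.
by rewrite /= ger0_norm // ball_ind_ge0.
Qed.

(** Difference quotients of [h] have integral 0 by translation invariance, and they differ from the
    derivative by [O(t)] on a bounded set. *)
Lemma Rintegral_derive_Cc h v : Cc_inf h -> \int[mu]_x derive h x v = 0.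
Proof.
move=> ch; have [C C0 HC] := Cc_inf_taylor ch; have [_ [r hr]] := ch.
have ih := integ_Cc_inf ch; have iDh := integ_Cc_inf (Cc_inf_derive v ch).
(* For [0 < t <= 1] the derivative and the difference quotient vanish outside the ball of radius
   [r + |v|], so the Taylor error is integrated over a ball independent of [t]. *)
pose K := C * `|v| ^+ 2 * \int[mu]_x ball_ind (r + eucl v) x.
have bound t : 0 < t <= 1 -> `|\int[mu]_x derive h x v| <= t * K.
  move=> /andP[t0 t1].
  have ish := integ_shift (t *: v) ih.
  have idq : integ (fun x => t^-1 * (h (x + t *: v) - h x)) by apply: integZ; exact: integB.
  have dq0 : \int[mu]_x (t^-1 * (h (x + t *: v) - h x)) = 0.
    by rewrite (RintZ _ (integB ish ih)) (RintB ish ih) -(Rintegral_shift _ ih) subrr mulr0.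
  rewrite -[X in `|X|]subr0 -dq0 -(RintB iDh idq).
  apply: (le_trans (le_normr_Rintegral measurableT (integB iDh idq))).
  rewrite /K mulrCA mulrA -(RintZ _ (integ_ball_ind _)).
  apply: le_Rint; [exact/integ_norm/integB|exact/integZ/integ_ball_ind|].
  move=> x; rewrite /ball_ind; have [xr|xr] := leP (eucl x) (r + eucl v); rewrite ?mulr1 ?mulr0; last first.
    have xr' : r < eucl x by rewrite (le_lt_trans _ xr) // lerDl eucl_ge0.
    have xtr : r < eucl (x + t *: v).
      have := ler_euclB x (x + t *: v) 0; rewrite !subr0 => h1.
      rewrite opprD addrA subrr add0r euclN euclZ (gtr0_norm t0) in h1.
      rewrite -(ltrD2l (eucl v)) [eucl v + r]addrC (lt_le_trans xr) // (le_trans h1) //.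
      by rewrite lerD2r ler_piMl ?eucl_ge0.
    by rewrite (derive_support _ hr xr') (hr _ xr') (hr _ xtr) subrr mulr0 subr0 normr0.
  have := HC x (t *: v); rewrite deriveZdir; last by apply: smooth_differentiable; case: ch.
  rewrite normrZ (gtr0_norm t0) exprMn => h1.
  have -> : derive h x v - t^-1 * (h (x + t *: v) - h x) =
      - (t^-1 * (h (x + t *: v) - h x - t * derive h x v)) by field; rewrite gt_eqF.
  rewrite normrN normrM gtr0_norm ?invr_gt0 // ler_pdivrMl //.
  by rewrite (le_trans h1) // le_eqVlt; apply/orP; left; apply/eqP; ring.
apply/eqP; rewrite -normr_le0; apply/ler_addgt0Pl => e e0; rewrite addr0.
have K0 : 0 <= K.
  have /bound : 0 < (1 : R) <= 1 by rewrite ltr01 lexx.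
  by rewrite mul1r; exact: le_trans.
have d0 : 0 < K + 1 by rewrite ltr_wpDl.
have /bound h1 : 0 < Num.min 1 (e / (K + 1)) <= 1.
  by rewrite lt_min ltr01 divr_gt0 //= ge_min lexx.
apply: (le_trans h1); apply: (@le_trans _ _ (e / (K + 1) * K)).
  by rewrite ler_wpM2r // ge_min lexx orbT.
by rewrite -mulrA ler_piMr ?(ltW e0) // mulrC ler_pdivrMr // mul1r lerDl.
Qed.

Lemma derive_mul f h x v : smooth f -> smooth h ->
  derive (fun y => f y * h y) x v = f x * derive h x v + h x * derive f x v.
Proof.
move=> sf sh; have := @deriveM R V f h x v.
rewrite /GRing.scale /= => ->//; apply: diff_derivable; exact: smooth_differentiable.
Qed.

Lemma integration_by_parts f psi v : smooth f -> Cc_inf psi ->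
  \int[mu]_x (f x * derive psi x v) = - \int[mu]_x (derive f x v * psi x).
Proof.
move=> sf cp; have := Rintegral_derive_Cc v (Cc_infM sf cp).
have [sp _] := cp.
have i1 := integ_Cc_inf (Cc_infM sf (Cc_inf_derive v cp)).
have i2 := integ_Cc_inf (Cc_infM (smooth_derive v sf) cp).
under eq_Rintegral do rewrite (derive_mul _ _ sf sp) [psi _ * _]mulrC.
by rewrite (RintD i1 i2) => /eqP; rewrite addr_eq0 => /eqP.
Qed.
End IntegrationByParts.

Section WeakGradient.
Variables (R : realType) (n : nat).
Local Notation V := 'rV[R]_n.
Local Notation mu := (muN R n).
Local Notation e_ i := (delta_mx ord0 i : V).
Implicit Types (f u k psi : V -> R) (g G : V -> V) (x y v a : V) (r c : R).

(* [weak_grad] with real-valued integrals against [muN] instead of iterated ones *)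
Definition wgrad f g := [/\ forall i, mfun_rV (fun x => g x ord0 i),
  forall i, locint (fun x => g x ord0 i) &
  forall psi, Cc_inf psi -> forall i,
    \int[mu]_x (f x * derive psi x (e_ i)) = - \int[mu]_x (g x ord0 i * psi x)].

Lemma integ_cont_Cc f psi : continuous f -> Cc_inf psi -> integ (fun x => f x * psi x).
Proof.
move=> cf cp; apply: integrable_locint_Cc; [exact: continuous_measurable_rV|exact: locint_continuous| |].
- exact: Cc_inf_continuous.
- by case: cp.
Qed.

Lemma integ_locint_Cc h psi : mfun_rV h -> locint h -> Cc_inf psi -> integ (fun x => h x * psi x).
Proof.
by move=> mh lh cp; apply: integrable_locint_Cc => //; [exact: Cc_inf_continuous|case: cp].
Qed.

(** The iterated and the [muN] integrals agree because the tested products are absolutely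
    integrable: [f] is continuous, [g] locally integrable, and the test function has compact
    support. *)
Lemma weak_gradP f g : continuous f -> weak_grad f g <-> wgrad f g.
Proof.
move=> cf.
have E2 i : mfun_rV (fun x => g x ord0 i) -> forall r,
    intN (fun x => (if eucl x <= r then `|g x ord0 i| else 0)%:E) =
    (\int[mu]_x (if eucl x <= r then `|g x ord0 i| else 0)%:E)%E.
  move=> mg r; rewrite ge0_intN //; last by move=> x; rewrite lee_fin; case: ifP.
  by apply/measurable_EFinP; exact: measurable_restr_ball.
have E3 psi i : Cc_inf psi -> mfun_rV (fun x => g x ord0 i) -> locint (fun x => g x ord0 i) ->
    intN (fun x => (f x * derive psi x (e_ i))%:E) = (\int[mu]_x (f x * derive psi x (e_ i)))%:E /\
    intN (fun x => (g x ord0 i * psi x)%:E) = (\int[mu]_x (g x ord0 i * psi x))%:E.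
  move=> cp mg lg.
  have i1 := integ_cont_Cc cf (Cc_inf_derive (e_ i) cp); have i2 := integ_locint_Cc mg lg cp.
  rewrite (integrable_intN i1) (integrable_intN i2) /Rintegral.
  by rewrite !fineK //; apply: integrable_fin_num.
split=> [[mg [lg H]]|[mg lg H]].
  have mg' i : mfun_rV (fun x => g x ord0 i) := proj1 (borel_funP _) (mg i).
  have lg' i : locint (fun x => g x ord0 i) by move=> r; rewrite -E2.
  split => // psi cp i; have := H psi cp i.
  by have [-> ->] := E3 psi i cp (mg' i) (lg' i); rewrite -EFinN => -[].
split; first by move=> i; exact: (proj2 (borel_funP _) (mg i)).
split; first by move=> i r; rewrite E2 //; exact: lg.
move=> psi cp i; have [-> ->] := E3 psi i cp (mg i) (lg i).
by rewrite H.
Qed.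

Lemma mfun_eucl g : (forall i, mfun_rV (fun x => g x ord0 i)) -> mfun_rV (fun x => eucl (g x)).
Proof. by move=> mg; exact: (measurableT_comp (@measurable_eucl R n) (measurable_rVP mg)). Qed.

Lemma Lp_pE p g : (forall i, mfun_rV (fun x => g x ord0 i)) ->
  Lp_p p g = Epow mu p (fun x => eucl (g x)).
Proof.
move=> mg; apply: ge0_intN; last by move=> x; rewrite lee_fin powR_ge0.
by apply: measurable_Epow; exact: mfun_eucl.
Qed.

Lemma wgrad_smooth f : smooth f -> wgrad f (grad f).
Proof.
move=> sf.
have E i : (fun x => grad f x ord0 i) = (fun x => derive f x (e_ i)).
  by apply/funext => x; rewrite mxE.
have cd i : continuous (fun x => derive f x (e_ i)).
  by apply: smooth_continuous; exact: smooth_derive.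
split=> [i|i|psi cp i].
- by rewrite E; exact: continuous_measurable_rV.
- by rewrite E; exact: locint_continuous.
- rewrite (integration_by_parts _ sf cp); congr (- _).
  by apply: eq_Rintegral => x _; rewrite mxE.
Qed.

Lemma locintD (h1 h2 : V -> R) : mfun_rV h1 -> mfun_rV h2 -> locint h1 -> locint h2 ->
  locint (fun x => h1 x + h2 x).
Proof.
move=> m1 m2 l1 l2 r.
apply: (@le_lt_trans _ _ (\int[mu]_x ((if eucl x <= r then `|h1 x| else 0) +
    (if eucl x <= r then `|h2 x| else 0))%R%:E)%E).
  apply: ge0_le_integral => //.
  - by move=> x _; rewrite lee_fin; case: ifP.
  - by apply/measurable_EFinP; apply: measurable_restr_ball; exact: measurable_funD.
  - by apply/measurable_EFinP; apply: measurable_funD; exact: measurable_restr_ball.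
  - by move=> x _; rewrite lee_fin; case: ifP => _; rewrite ?addr0 // ler_normD.
under eq_integral do rewrite EFinD.
rewrite ge0_integralD //; last 4 first.
- by move=> x _; rewrite lee_fin; case: ifP.
- by apply/measurable_EFinP; exact: measurable_restr_ball.
- by move=> x _; rewrite lee_fin; case: ifP.
- by apply/measurable_EFinP; exact: measurable_restr_ball.
by apply: lte_add_pinfty; [exact: l1|exact: l2].
Qed.

Lemma locint_scale c (h : V -> R) : mfun_rV h -> locint h -> locint (fun x => c * h x).
Proof.
move=> mh lh r.
rewrite (_ : (\int[mu]_x _)%E = (`|c|%:E * \int[mu]_x (if eucl x <= r then `|h x| else 0)%:E)%E).
  by apply: lte_mul_pinfty; [rewrite lee_fin| |exact: lh].
rewrite -ge0_integralZl ?lee_fin //; last 2 first.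
- by apply/measurable_EFinP; exact: measurable_restr_ball.
- by move=> x _; rewrite lee_fin; case: ifP.
by apply: eq_integral => x _; rewrite -EFinM; case: ifP => _; rewrite ?mulr0 // normrM.
Qed.

Lemma wgrad_comb c1 c2 f1 f2 g1 g2 : continuous f1 -> continuous f2 -> wgrad f1 g1 -> wgrad f2 g2 ->
  wgrad (fun x => c1 * f1 x + c2 * f2 x) (fun x => c1 *: g1 x + c2 *: g2 x).
Proof.
move=> cf1 cf2 [m1 l1 H1] [m2 l2 H2].
have E i : (fun x => (c1 *: g1 x + c2 *: g2 x) ord0 i) = (fun x => c1 * g1 x ord0 i + c2 * g2 x ord0 i).
  by apply/funext => x; rewrite !mxE.
have mz c (h : V -> R) : mfun_rV h -> mfun_rV (fun x => c * h x).
  by move=> mh; apply: measurable_funM => //; exact: measurable_cst.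
split=> [i|i|psi cp i].
- by rewrite E; apply: measurable_funD; exact: mz.
- by rewrite E; apply: locintD; [exact: mz|exact: mz|exact: locint_scale|exact: locint_scale].
have i1 := integ_cont_Cc cf1 (Cc_inf_derive (e_ i) cp).
have i2 := integ_cont_Cc cf2 (Cc_inf_derive (e_ i) cp).
have j1 := integ_locint_Cc (m1 i) (l1 i) cp; have j2 := integ_locint_Cc (m2 i) (l2 i) cp.
under eq_Rintegral do rewrite mulrDl -!mulrA.
rewrite (RintD (integZ c1 i1) (integZ c2 i2)) (RintZ _ i1) (RintZ _ i2) H1 // H2 //.
under [in RHS]eq_Rintegral do rewrite !mxE mulrDl -!mulrA.
by rewrite (RintD (integZ c1 j1) (integZ c2 j2)) (RintZ _ j1) (RintZ _ j2) !mulrN opprD.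
Qed.

Lemma locint_affine c a (h : V -> R) : 0 < c -> mfun_rV h -> locint h ->
  locint (fun x => h (c *: x + a)).
Proof.
move=> c0 mh lh r; pose H x := if eucl x <= c * r + eucl a then `|h x| else 0.
have mH : mfun_rV H by exact: measurable_restr_ball.
have H0 x : 0 <= H x by rewrite /H; case: ifP.
apply: (@le_lt_trans _ _ (\int[mu]_x (H (c *: x + a))%:E)%E).
  apply: ge0_le_integral => //.
  - by move=> x _; rewrite lee_fin; case: ifP.
  - by apply/measurable_EFinP; apply: measurable_restr_ball; exact: mfun_affine.
  - by apply/measurable_EFinP; exact: mfun_affine.
  move=> x _; rewrite lee_fin; case: ifP => // xr; rewrite /H ifT //.
  by rewrite (le_trans (ler_euclD _ _)) // lerD2r euclZ (gtr0_norm c0) ler_pM2l.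
have := lh (c * r + eucl a).
rewrite (@ge0_integral_muN_affine _ _ c a (fun x => (H x)%:E)) //; last by apply/measurable_EFinP.
have cn : 0 < c ^+ n by rewrite exprn_gt0.
by move=> h2; rewrite ltey; apply/eqP => E; move: h2; rewrite E gt0_muley ?lte_fin.
Qed.

Lemma continuous_comp_affine f c a : continuous f -> continuous (fun x => f (c *: x + a)).
Proof.
move=> cf x; apply: (@continuous_comp _ _ _ (fun x => c *: x + a) f); last exact: cf.
apply: differentiable_continuous; have da := is_diff_affine c a x; exact: ex_diff.
Qed.

Lemma wgrad_affine c a f g : 0 < c -> continuous f -> wgrad f g ->
  wgrad (fun x => f (c *: x + a)) (fun x => c *: g (c *: x + a)).
Proof.
move=> c0 cf [mg lg Hg]; have c0' : c != 0 by rewrite gt_eqF.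
have E i : (fun x => (c *: g (c *: x + a)) ord0 i) = (fun x => c * g (c *: x + a) ord0 i).
  by apply/funext => x; rewrite mxE.
have ma i : mfun_rV (fun x => g (c *: x + a) ord0 i) by exact: (mfun_affine c a (mg i)).
split=> [i|i|psi cp i].
- by rewrite E; apply: measurable_funM; [exact: measurable_cst|exact: ma].
- by rewrite E; apply: locint_scale => //; exact: (locint_affine a c0 (mg i) (lg i)).
(* The test function is carried back by the inverse affine map, so that after the change of
   variables it becomes [psi] again. *)
pose psi' y := psi (c^-1 *: y + (- (c^-1 *: a))).
have cp' : Cc_inf psi' by apply: Cc_inf_affine => //; rewrite invr_eq0.
have K x : c^-1 *: (c *: x + a) + - (c^-1 *: a) = x.
  by rewrite scalerDr scalerA mulVf // scale1r addrK.
have D x : derive psi' (c *: x + a) (e_ i) = c^-1 * derive psi x (e_ i).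
  by rewrite /psi' derive_affine K //; apply: smooth_differentiable; case: cp.
have := Hg psi' cp' i.
rewrite (Rintegral_affine a c0 (integ_cont_Cc cf (Cc_inf_derive (e_ i) cp'))).
rewrite (Rintegral_affine a c0 (integ_locint_Cc (mg i) (lg i) cp')).
under eq_Rintegral do rewrite D mulrCA.
under [X in _ = - (_ * X)]eq_Rintegral do rewrite /psi' K.
have cn : c ^+ n != 0 by rewrite expf_neq0.
have if' : integ (fun x => f (c *: x + a) * derive psi x (e_ i)).
  by apply: (integ_cont_Cc _ (Cc_inf_derive (e_ i) cp)); exact: continuous_comp_affine.
have ig' := integ_locint_Cc (ma i) (locint_affine a c0 (mg i) (lg i)) cp.
rewrite (RintZ _ if') -mulrN => /(mulfI cn) h.
under [in RHS]eq_Rintegral do rewrite mxE -mulrA.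
by rewrite (RintZ _ ig') -mulrN -h mulVKf.
Qed.

Lemma wgrad_cst c : wgrad (fun _ => c) (fun _ => 0).
Proof.
have -> : (fun _ : V => (0 : V)) = grad (fun _ => c).
  by apply/funext => x; apply/rowP => i; rewrite !mxE derive_cst.
exact/wgrad_smooth/smooth_cst.
Qed.

Lemma wgrad_mul_smooth phi f g : Cc_inf phi -> continuous f -> wgrad f g ->
  wgrad (fun x => phi x * f x) (fun x => phi x *: g x + f x *: grad phi x).
Proof.
move=> cphi cf [mg lg Hg]; have [sphi _] := cphi.
have mphi := Cc_inf_mfun cphi; have [M _ HM] := Cc_inf_bounded cphi.
have E i : (fun x => (phi x *: g x + f x *: grad phi x) ord0 i) =
    (fun x => phi x * g x ord0 i + f x * derive phi x (e_ i)).
  by apply/funext => x; rewrite !mxE.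
have cd i : continuous (fun x => derive phi x (e_ i)).
  by apply: smooth_continuous; exact: smooth_derive.
have cfd i : continuous (fun x => f x * derive phi x (e_ i)).
  by move=> x; apply: (@cvgM R V (nbhs x) _ f (fun x => derive phi x (e_ i))); [exact: cf|exact: cd].
have m1 i : mfun_rV (fun x => phi x * g x ord0 i) by apply: measurable_funM; [exact: mphi|exact: mg].
have m2 i : mfun_rV (fun x => f x * derive phi x (e_ i)) by exact: continuous_measurable_rV.
split=> [i|i|psi cp i].
- by rewrite E; apply: measurable_funD; [exact: m1|exact: m2].
- rewrite E; apply: (locintD (m1 i) (m2 i)); last exact: locint_continuous.
  have mM : mfun_rV (fun x => M * g x ord0 i) by apply: measurable_funM; [exact: measurable_cst|exact: mg].
  apply: (locint_le (m1 i) mM); last exact: locint_scale.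
  by move=> x; rewrite !normrM ler_wpM2r // (le_trans (HM x)) // ler_norm.
have [sp _] := cp.
have i1 := integ_cont_Cc cf (Cc_infM sphi (Cc_inf_derive (e_ i) cp)).
have i2 := integ_cont_Cc (cfd i) cp.
have cpp := Cc_infM sphi cp; have j1 := integ_locint_Cc (mg i) (lg i) cpp.
under eq_Rintegral do rewrite mulrAC mulrC.
(* The Leibniz rule is used backwards: [phi * psi] is the test function for [f], and the extra term
   becomes the part [f * grad phi] of the new gradient. *)
transitivity (\int[mu]_x (f x * derive (fun y => phi y * psi y) x (e_ i) -
    f x * derive phi x (e_ i) * psi x)).
  by apply: eq_Rintegral => x _; rewrite (derive_mul _ _ sphi sp); ring.
rewrite (RintB (integ_cont_Cc cf (Cc_inf_derive (e_ i) cpp)) i2) (Hg _ cpp i) -opprD -(RintD j1 i2).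
by congr (- _); apply: eq_Rintegral => x _; rewrite !mxE; ring.
Qed.
End WeakGradient.

(** * Mollification of weak gradients *)

Section SobolevMollification.
Variables (R : realType) (n : nat).
Local Notation V := 'rV[R]_n.
Local Notation mu := (muN R n).
Local Notation e_ i := (delta_mx ord0 i : V).
Implicit Types (f u k psi : V -> R) (g G : V -> V) (x y z v a : V) (r c : R).

(** The translate [k (y - x)] is itself a test function, so the definition of the weak gradient
    moves the derivative from the kernel onto [G]. Its minus sign cancels that of [derive_conv]. *)
Lemma grad_mconv k u G x i : Cc_inf k -> continuous u -> compact_support u -> wgrad u G ->
  grad (mconv k u) x ord0 i = \int[mu]_z (G (z + x) ord0 i * k z).
Proof.
move=> ck cu su [mG lG HG]; have iu : integ u by exact: integrable_Cc.
have [_ E] := derive_conv x (e_ i) ck iu; rewrite mxE E.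
have cks : Cc_inf (fun y => k (y - x)) by exact: Cc_inf_shift.
have Dk y : derive (fun y => k (y - x)) y (e_ i) = derive k (y - x) (e_ i).
  have := @derive_affine R n k 1 (- x) y (e_ i).
  under eq_fun do rewrite scale1r.
  rewrite scale1r mul1r; apply; apply: smooth_differentiable; by case: ck.
have := HG _ cks i; rewrite /mconv.
under eq_Rintegral do rewrite Dk.
move=> ->; rewrite opprK (Rintegral_shift x (integ_locint_Cc (mG i) (lG i) cks)).
by apply: eq_Rintegral => z _; rewrite addrK.
Qed.

Lemma integ_le f (h : V -> R) : mfun_rV f -> integ h -> (forall x, `|f x| <= h x) -> integ f.
Proof.
move=> mf ih fh; apply: (le_integrable measurableT _ _ ih); first exact/measurable_EFinP.
by move=> x _; rewrite /= lee_fin (le_trans (fh x)) // ler_norm.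
Qed.

(** The length of an averaged vector is at most the averaged length: pair the vector [w] with
    itself, bring the pairing inside the integral, apply Cauchy-Schwarz there and cancel one factor
    [|w|]. *)
Lemma eucl_grad_mconv k u G x : Cc_inf k -> (forall z, 0 <= k z) -> continuous u -> compact_support u ->
  wgrad u G -> integ (fun z => eucl (G (z + x)) * k z) /\
  eucl (grad (mconv k u) x) <= \int[mu]_z (eucl (G (z + x)) * k z).
Proof.
move=> ck k0 cu su wG; have [mG lG HG] := wG.
have mk := Cc_inf_mfun ck.
have mGs i : mfun_rV (fun z => G (z + x) ord0 i) by exact: (mfun_shift x (mG i)).
have lGs i : locint (fun z => G (z + x) ord0 i).
  have := locint_affine x ltr01 (mG i) (lG i); by under eq_fun do rewrite scale1r.
have iG i := integ_locint_Cc (mGs i) (lGs i) ck.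
have mE : mfun_rV (fun z => eucl (G (z + x)) * k z).
  by apply: measurable_funM => //; exact: (mfun_eucl mGs).
have iE : integ (fun z => eucl (G (z + x)) * k z).
  apply: (integ_le mE (h := fun z => \sum_(i < n) `|G (z + x) ord0 i * k z|)).
    by apply: integ_sum => i; exact: integ_norm.
  move=> z; rewrite normrM (ger0_norm (k0 z)) ger0_norm ?eucl_ge0 //.
  under eq_bigr do rewrite normrM (ger0_norm (k0 z)).
  by rewrite -mulr_suml ler_wpM2r // eucl_le_sum.
split => //; set w := grad (mconv k u) x; set I := \int[mu]_z _.
have wE i : w ord0 i = \int[mu]_z (G (z + x) ord0 i * k z) by exact: grad_mconv.
have I0 : 0 <= I by apply: Rintegral_ge0 => // z _; rewrite mulr_ge0 ?eucl_ge0.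
have [->|wn] := eqVneq (eucl w) 0 => //.
have w0 : 0 < eucl w by rewrite lt_neqAle eq_sym wn eucl_ge0.
rewrite -(ler_pM2l w0) -expr2 sqr_eucl.
have -> : \sum_(i < n) w ord0 i ^+ 2 = \int[mu]_z (\sum_(i < n) w ord0 i * (G (z + x) ord0 i * k z)).
  rewrite (Rintegral_sum _ (fun i => integZ _ (iG i))); apply: eq_bigr => i _.
  by rewrite (RintZ _ (iG i)) -wE expr2.
rewrite -(RintZ _ iE); apply: le_Rint; [by apply: integ_sum => i; exact: integZ|exact: integZ|].
move=> z; under eq_bigr do rewrite mulrA.
rewrite -mulr_suml mulrA ler_wpM2r //.
by apply: cauchy_schwarz_sum; rewrite ?eucl_ge0 // sqr_eucl.
Qed.

Lemma Epow_grad_mconv p k u G : 1 < p -> Cc_inf k -> (forall x, 0 <= k x) -> \int[mu]_x k x = 1 ->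
  continuous u -> compact_support u -> wgrad u G ->
  (Lp_p p (grad (mconv k u)) <= Epow mu p (fun x => eucl (G x)))%E.
Proof.
move=> p1 ck k0 k1 cu su wG; have [mG lG HG] := wG.
have iu : integ u by exact: integrable_Cc.
have ik := integ_Cc_inf ck.
have mE : mfun_rV (fun x => eucl (G x)) by exact: mfun_eucl.
have [mw _ _] := wgrad_smooth (smooth_conv ck iu).
rewrite (Lp_pE p mw).
pose tau x z : V := z + x.
have mtau : measurable_fun setT ((fun w => eucl (G (tau w.1 w.2))) : (rVB R n * rVB R n)%type -> R).
  by apply: (measurableT_comp mE); apply: measurable_rVB_add; [exact: measurable_snd|exact: measurable_fst].
have Etau z : Epow mu p (fun x => eucl (G (tau x z))) = Epow mu p (fun x => eucl (G x)).
  rewrite /Epow [in RHS](ge0_integral_shift z (measurable_Epow p mE)).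
    by apply: eq_integral => x _; rewrite /tau addrC.
  by move=> x; rewrite lee_fin powR_ge0.
apply: (mollify_Epow p1 ik k0 k1 mE (fun x => eucl_ge0 (G x)) (mfun_eucl mw) (fun x => eucl_ge0 _) mtau Etau).
- by move=> x; have [] := eucl_grad_mconv x ck k0 cu su wG.
- by move=> x; have [] := eucl_grad_mconv x ck k0 cu su wG.
Qed.
End SobolevMollification.

(** * Approximation in the case of first derivatives *)

Section SobolevApproximation.
Variables (R : realType) (n : nat) (p : R).
Local Notation V := 'rV[R]_n.
Local Notation mu := (muN R n).
Local Notation e_ i := (delta_mx ord0 i : V).
Implicit Types (f u chi : V -> R) (g G : V -> V) (x y z : V) (r : seq nat).
Hypotheses (p1 : 1 < p) (np : n%:R < p).
Let p0 : 0 < p. Proof. exact: lt_trans ltr01 p1. Qed.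
Let alpha := alpha_sp n 1 p.
Let a0 : 0 < alpha.
Proof. by rewrite /alpha /alpha_sp subr_gt0 ltr_pdivrMr // mul1r. Qed.

Definition cutoff_grad chi f (k : nat) x : R := `|f x| * eucl (grad (dilate chi k) x).

Lemma grad_dilate chi k x : Cc_inf chi ->
  grad (dilate chi k) x = (k.+1)%:R^-1 *: grad chi ((k.+1)%:R^-1 *: x).
Proof.
move=> [sc _]; apply/rowP => i; rewrite !mxE.
have := @derive_affine R n chi (k.+1)%:R^-1 0 x (e_ i).
rewrite addr0 => <-; last exact: smooth_differentiable.
by congr (derive _ x _); apply/funext => y; rewrite /dilate addr0.
Qed.

Lemma mfun_grad f : smooth f -> mfun_rV (fun x => eucl (grad f x)).
Proof. by move=> sf; apply: mfun_eucl; have [] := wgrad_smooth sf. Qed.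

Lemma grad_bounded f : Cc_inf f -> exists2 M, 0 <= M & forall x, eucl (grad f x) <= M.
Proof.
move=> cf.
have b i : exists M, forall x, `|derive f x (e_ i)| <= M.
  by have [M _ HM] := Cc_inf_bounded (Cc_inf_derive (e_ i) cf); exists M.
have [M HM] := choice b.
have M0 i : 0 <= M i by apply: le_trans (HM i 0).
exists (\sum_(i < n) M i) => [|x]; first exact: sumr_ge0.
by rewrite (le_trans (eucl_le_sum _)) // ler_sum // => i _; rewrite mxE.
Qed.

Lemma grad_support f (b : R) x : (forall x, b < eucl x -> f x = 0) -> b < eucl x -> grad f x = 0.
Proof. by move=> hf bx; apply/rowP => i; rewrite !mxE (derive_support _ hf). Qed.

Lemma mfun_cutoff_grad chi f k : Cc_inf chi -> mfun_rV f -> mfun_rV (cutoff_grad chi f k).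
Proof.
move=> cc mf; apply: measurable_funM; first exact: measurableT_comp.
by apply: mfun_grad; have [] := Cc_inf_dilate k cc.
Qed.

Lemma cutoff_grad_ge0 chi f k x : 0 <= cutoff_grad chi f k x.
Proof. by rewrite mulr_ge0 // eucl_ge0. Qed.

Lemma cutoff_grad_cvg chi f x : is_cutoff chi -> (fun k => cutoff_grad chi f k x) @ \oo --> (0 : R).
Proof.
move=> cc; have cinf : Cc_inf chi by case: cc.
have [M M0 HM] := grad_bounded cinf.
have hc : (fun k : nat => `|f x| * M * harmonic k) @ \oo --> (0 : R).
  by rewrite -[X in _ --> X](mulr0 (`|f x| * M)); apply: cvgMl_tmp; exact: cvg_harmonic.
apply: (squeeze_cvgr _ (cvg_cst 0) hc); near=> k.
rewrite cutoff_grad_ge0 /= /cutoff_grad grad_dilate // euclZ [`|_^-1|]ger0_norm ?invr_ge0 //.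
by rewrite -[leRHS]mulrA ler_wpM2l // [leLHS]mulrC /= ler_wpM2r ?invr_ge0.
Unshelve. all: by end_near. Qed.

(** Rescaling by [l = k + 1] compares the error with the fixed function [K], bounded and supported
    in the unit ball. Since [alpha = 1 - n / p], the factor [l^((alpha - 1) p)] cancels the Jacobian
    [l^n]. *)
Lemma Epow_cutoff_grad chi f : is_cutoff chi -> mfun_rV f -> (forall y, `|f y| <= eucl y `^ alpha) ->
  exists C, forall k, (Epow mu p (cutoff_grad chi f k) <= C%:E)%E.
Proof.
move=> cc mf fa; have [cinf _ _ csupp] := cc; have [sc _] := cinf.
pose K x := eucl x `^ alpha * eucl (grad chi x).
have mK : mfun_rV K.
  apply: measurable_funM; last exact: mfun_grad.
  exact: (measurableT_comp (measurable_powR _) (@measurable_eucl R n)).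
have [M M0 HM] := grad_bounded cinf.
have csupp' x : 1 < eucl x -> chi x = 0 by move=> /ltW; exact: csupp.
have K0 x : 0 <= K x by rewrite mulr_ge0 ?powR_ge0 ?eucl_ge0.
have [|||C HC] := @integral_bounded_ball R n (fun x => K x `^ p) (M `^ p) 1.
- exact: (measurableT_comp (measurable_powR p) mK).
- move=> x; rewrite powR_ge0 /=; apply: powR_mono => //; first exact: ltW.
  rewrite /K; have [x1|x1] := leP (eucl x) 1.
    rewrite -[leRHS]mul1r; apply: ler_pM; rewrite ?powR_ge0 ?eucl_ge0 //.
    by have := @powR_mono _ alpha _ _ (ltW a0) (eucl_ge0 x) x1; rewrite powR1.
  by rewrite (grad_support csupp' x1) eucl0 mulr0.
- by move=> x x1; rewrite /K (grad_support csupp' x1) eucl0 mulr0 powR0 // gt_eqF.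
exists C => k; apply: le_trans HC.
pose l : R := (k.+1)%:R; have l0 : 0 < l by rewrite ltr0n.
have mA := mfun_cutoff_grad k cinf mf.
have -> : Epow mu p (cutoff_grad chi f k) =
    ((l ^+ n)%:E * \int[mu]_x (cutoff_grad chi f k (l *: x + 0) `^ p)%:E)%E.
  apply: (ge0_integral_muN_affine 0 l0 (measurable_Epow p mA)) => x.
  by rewrite lee_fin powR_ge0.
have le : (Epow mu p (fun x => cutoff_grad chi f k (l *: x + 0)) <=
    Epow mu p (fun x => (l `^ (alpha - 1) * K x)%R))%E.
  apply: le_Epow.
  - exact: ltW.
  - exact: (mfun_affine l 0 mA).
  - by apply: measurable_funM; [exact: measurable_cst|exact: mK].
  - by move=> x; exact: cutoff_grad_ge0.
  move=> x; rewrite addr0 /cutoff_grad grad_dilate // scalerA mulVf ?gt_eqF // scale1r euclZ.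
  rewrite powRD; last by rewrite (gt_eqF l0) implybT.
  rewrite powR_inv1 ?(ltW l0) // [`|l^-1|]ger0_norm ?invr_ge0 ?(ltW l0) //.
  have -> : l `^ alpha / l * K x = (l `^ alpha * eucl x `^ alpha) * (l^-1 * eucl (grad chi x)).
    by rewrite /K; ring.
  rewrite ler_wpM2r ?mulr_ge0 ?invr_ge0 ?(ltW l0) ?eucl_ge0 //.
  by rewrite (le_trans (fa _)) // euclZ (gtr0_norm l0) powRM ?(ltW l0) ?eucl_ge0.
apply: (@le_trans _ _ ((l ^+ n)%:E * Epow mu p (fun x => (l `^ (alpha - 1) * K x)%R))%E).
  by apply: lee_wpmul2l => //; rewrite lee_fin exprn_ge0 // ltW.
have c1 : l ^+ n * (l `^ (alpha - 1)) `^ p = 1.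
  rewrite -powRrM -powR_mulrn ?(ltW l0) // -powRD; last by rewrite (gt_eqF l0) implybT.
  rewrite (_ : n%:R + _ = 0) ?powRr0 // /alpha /alpha_sp; field; by rewrite gt_eqF.
by rewrite (@EpowZ _ _ R mu p _ K (powR_ge0 l (alpha - 1)) mK K0) muleA -EFinM c1 mul1e.
Qed.

Lemma eucl_grad_avg_cutoff chi r x : is_cutoff chi ->
  eucl (grad (avg_cutoff chi r) x) <= (size r)%:R^-1 * \sum_(k <- r) eucl (grad (dilate chi k) x).
Proof.
move=> cc; have cinf : Cc_inf chi by case: cc.
have sd k : smooth (dilate chi k) by have [] := Cc_inf_dilate k cinf.
have E v : derive (avg_cutoff chi r) x v = (size r)%:R^-1 * \sum_(k <- r) derive (dilate chi k) x v.
  rewrite /avg_cutoff [LHS]deriveZ; last first.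
    by apply: diff_derivable; apply: smooth_differentiable; exact: smooth_sum.
  congr (_ * _); elim: r => [|k r IH].
    by rewrite big_nil; under eq_fun do rewrite big_nil; exact: derive_cst.
  rewrite big_cons -IH; under eq_fun do rewrite big_cons.
  by rewrite [LHS]deriveD //; apply: diff_derivable; apply: smooth_differentiable => //; exact: smooth_sum.
have -> : grad (avg_cutoff chi r) x = (size r)%:R^-1 *: \sum_(k <- r) grad (dilate chi k) x.
  apply/rowP => i; rewrite !mxE E summxE; congr (_ * _).
  by apply: eq_bigr => k _; rewrite mxE.
rewrite euclZ ger0_norm ?invr_ge0 // ler_wpM2l ?invr_ge0 //.
elim: r {E} => [|k r IH]; first by rewrite !big_nil eucl0.
by rewrite !big_cons (le_trans (ler_euclD _ _)) // lerD2l.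
Qed.

Lemma approximable_sobolev f g : continuous f ->
  (forall x y, `|f x - f y| <= eucl (x - y) `^ alpha) -> wgrad f g ->
  approximable 1 p f (Epow mu p (fun x => eucl (g x))).
Proof.
move=> cf fa wg e x y e0.
pose f0 z := f z - f 0.
have f0E : f0 = (fun z => 1 * f z + (-1) * f 0) by apply/funext => z; rewrite /f0 mul1r mulN1r.
have ccst : continuous (fun _ : V => f 0) by exact: cst_continuous.
have wg0 : wgrad f0 g.
  have := wgrad_comb 1 (-1) cf ccst wg (wgrad_cst n (f 0)).
  rewrite -f0E; congr wgrad; by apply/funext => z; rewrite scale1r scaler0 addr0.
have cf0 : continuous f0.
  by move=> z; apply: (@cvgB R R V (nbhs z) _ f (fun=> f 0)); [exact: (cf z)|exact: cvg_cst].
have mf0 : mfun_rV f0 by exact: continuous_measurable_rV.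
have f0a z : `|f0 z| <= eucl z `^ alpha by have := fa z 0; rewrite subr0.
have [chi cc] := @cutoff_exists R n; have cc' : is_cutoff chi by [].
have cinf : Cc_inf chi by case: cc.
have [C AC] := Epow_cutoff_grad cc' mf0 f0a.
have [D D0 HD] := le_EpowD mu p0 e0.
pose h := e / (2 * (1 + `|f0 x| + `|f0 y|)).
have d0 : 0 < 1 + `|f0 x| + `|f0 y| by rewrite -addrA ltr_pwDl // addr_ge0.
have h0 : 0 < h by rewrite divr_gt0 // mulr_gt0.
have m0 : 0 < Num.min h (e / (D + 1)) by rewrite lt_min h0 divr_gt0 // ltr_wpDl.
have [r [r0 rE rx ry]] := cutoff_average x y p1 cc' (fun k => mfun_cutoff_grad k cinf mf0)
  (cutoff_grad_ge0 chi f0) AC (fun w => cutoff_grad_cvg f0 w cc') m0.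
pose phi := avg_cutoff chi r; pose u z := phi z * f0 z.
have cphi : Cc_inf phi by exact: Cc_inf_avg_cutoff.
have cu : continuous u.
  by move=> z; rewrite /u; apply: (@cvgM R V (nbhs z) _ phi f0); [apply: Cc_inf_continuous|exact: cf0].
have su : compact_support u.
  by have [_ [b Hb]] := cphi; exists b => z /Hb; rewrite /u => ->; rewrite mul0r.
have wu := wgrad_mul_smooth cphi cf0 wg0.
set G := (fun z => _ *: _ + _) in wu.
pose B z := (size r)%:R^-1 * \sum_(k <- r) cutoff_grad chi f0 k z.
have mB : mfun_rV B.
  apply: measurable_funM; first exact: measurable_cst.
  by apply: measurable_sum => k; exact: mfun_cutoff_grad.
have B0 w : 0 <= B w.
  by rewrite mulr_ge0 ?invr_ge0 // sumr_ge0 // => k _; exact: cutoff_grad_ge0.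
have [mg _ _] := wg; have meg := mfun_eucl mg; have [mG _ _] := wu.
have GB z : eucl (G z) <= eucl (g z) + B z.
  rewrite /G (le_trans (ler_euclD _ _)) // !euclZ lerD //.
    rewrite -[leRHS]mul1r ler_wpM2r ?eucl_ge0 //.
    by have /andP[? ?] := avg_cutoff_bound z cc' r0; rewrite ger0_norm.
  rewrite /B /cutoff_grad -mulr_sumr mulrCA ler_wpM2l //; exact: eucl_grad_avg_cutoff.
have uE : (Epow mu p (fun z => eucl (G z)) <= (1 + e)%:E * Epow mu p (fun z => eucl (g z)) + e%:E)%E.
  apply: (@le_trans _ _ (Epow mu p (fun w => eucl (g w) + B w)%R)).
    apply: le_Epow => //; [exact: ltW|exact: mfun_eucl|exact: measurable_funD|].
    by move=> w; exact: eucl_ge0.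
  apply: (le_trans (HD _ _ meg mB (fun z => eucl_ge0 (g z)) B0)); apply: leeD => //.
  apply: (@le_trans _ _ (D%:E * (Num.min h (e / (D + 1)))%:E)%E).
    by apply: lee_wpmul2l; rewrite ?lee_fin.
  rewrite -EFinM lee_fin (@le_trans _ _ (D * (e / (D + 1)))) //.
    by rewrite ler_wpM2l // ge_min lexx orbT.
  by rewrite mulrCA ler_piMr ?(ltW e0) // ler_pdivrMr ?ltr_wpDl // mul1r lerDl.
have weaken z : 1 - avg_cutoff chi r z <= Num.min h (e / (D + 1)) -> 1 - avg_cutoff chi r z <= h.
  by move=> hz; rewrite (le_trans hz) // ge_min lexx.
have [k [ck k0 k1 [kx ky]]] := mollified_cutoff_close cf0 cc' r0 e0 (weaken x rx) (weaken y ry).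
exists (mconv k u); split => //.
- apply: Cc_inf_conv => //; exact: integrable_Cc.
- rewrite /Wsp_smooth_p eqxx.
  exact: le_trans (Epow_grad_mconv p1 ck k0 k1 cu su wu) uE.
Qed.
End SobolevApproximation.

Lemma continuous_of_dist (R : realType) (W : normedModType R) (f : W -> R) :
  (forall x e, 0 < e -> exists2 r, 0 < r & forall y, `|x - y| < r -> `|f x - f y| <= e) ->
  continuous f.
Proof.
move=> H x; apply/cvgrPdist_le => /= e e0; have [r r0 hr] := H x e e0.
by apply/nbhs_normP; exists r => // y xy; exact: hr.
Qed.

(** * Equality of the infima *)

Section HolderSeminorm.
Variables (R : realType) (n : nat).
Local Notation V := 'rV[R]_n.
Implicit Types (f w : V -> R) (x y z a : V) (al c h : R).

Definition holder_le al c f := forall x y, `|f x - f y| <= c * eucl (x - y) `^ al.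

Lemma holder_semi_le al c f : 0 <= c -> holder_le al c f -> (holder_semi al f <= c%:E)%E.
Proof.
move=> c0 hf; apply: ge_ereal_sup => _ [x [y [xy ->]]].
by rewrite lee_fin ler_pdivrMr // powR_gt0 // eucl_subr_gt0.
Qed.

Lemma holder_semi_ge al f x y : x != y ->
  ((`|f x - f y| / eucl (x - y) `^ al)%:E <= holder_semi al f)%E.
Proof. by move=> xy; apply: ereal_sup_ubound; exists x, y. Qed.

Lemma holder_semi_fin al f h : (0 <= h) -> (holder_semi al f <= h%:E)%E -> holder_le al h f.
Proof.
move=> h0 hf x y; have [->|xy] := eqVneq x y.
  by rewrite subrr normr0 mulr_ge0 // powR_ge0.
have := le_trans (holder_semi_ge al f xy) hf.
by rewrite lee_fin ler_pdivrMr // powR_gt0 // eucl_subr_gt0.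
Qed.

Lemma holder_leZ al c (b : R) f : holder_le al c f -> holder_le al (`|b| * c) (fun x => b * f x).
Proof. by move=> hf x y; rewrite -mulrBr normrM -mulrA ler_wpM2l. Qed.

(** The seminorm [h] is finite by [holder_le] and at least [theta] because of the pair [x], [y].
    Division by [h] turns a nearly admissible function into an admissible one. *)
Lemma holder_semi_normalize al f c (theta : R) x y : holder_le al c f -> x != y -> 0 < theta ->
  theta * eucl (x - y) `^ al <= `|f x - f y| ->
  exists2 h, theta <= h & holder_semi al (fun z => h^-1 * f z) = 1%E.
Proof.
move=> hf xy th0 hth; have exy : 0 < eucl (x - y) `^ al by rewrite powR_gt0 // eucl_subr_gt0.
have c0 : 0 <= c by have := le_trans (normr_ge0 _) (hf x y); rewrite pmulr_lge0.
have fin : holder_semi al f \is a fin_num.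
  apply/fin_numP; split.
    apply/eqP => E; have := holder_semi_ge al f xy; rewrite E; by rewrite leeNy_eq.
  by apply/eqP => E; have := holder_semi_le c0 hf; rewrite E leye_eq.
pose h := fine (holder_semi al f); have hE : holder_semi al f = h%:E by rewrite /h fineK.
have thh : theta <= h.
  rewrite -lee_fin -hE; apply: le_trans (holder_semi_ge al f xy).
  by rewrite lee_fin ler_pdivlMr.
have h0 : 0 < h by exact: lt_le_trans thh.
exists h => //; apply/eqP; rewrite eq_le; apply/andP; split.
  apply: holder_semi_le => //.
  have hh : holder_le al h f by apply: holder_semi_fin; [exact: ltW|rewrite hE].
  by have := holder_leZ h^-1 hh; rewrite ger0_norm ?invr_ge0 ?(ltW h0) // mulVf // gt_eqF.
(* Every quotient of [f] is at most [h * S], hence so is their supremum [h]. Cancelling [h] requires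
   cases on the extended real [S]. *)
set S := holder_semi _ _; have Sx := holder_semi_ge al (fun z => h^-1 * f z).
have : (h%:E <= h%:E * S)%E.
  rewrite -{1}hE; apply: ge_ereal_sup => _ [u [v [uv ->]]].
  have := Sx _ _ uv; rewrite -mulrBr normrM ger0_norm ?invr_ge0 ?(ltW h0) // => h1.
  have := @lee_wpmul2l R h%:E (ltW h0) _ _ h1.
  by rewrite -EFinM -mulrA mulVKf // gt_eqF.
case: S {Sx} => [t| |] //.
- by rewrite -EFinM !lee_fin ler_pMr.
- by move=> _; exact: leey.
- by rewrite mulr_infty gtr0_sg // mul1e.
Qed.

Lemma holder_continuous al c f : 0 < al -> holder_le al c f -> continuous f.
Proof.
move=> al0 hf; apply: continuous_of_dist => x e e0.
have c1 : 0 < `|c| + 1 by rewrite ltr_wpDl.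
have d0 : 0 < (e / (`|c| + 1)) `^ al^-1 by rewrite powR_gt0 // divr_gt0.
have n0 : 0 < (n%:R + 1 : R) by rewrite ltr_wpDl.
exists ((e / (`|c| + 1)) `^ al^-1 / (n%:R + 1)); first by rewrite divr_gt0.
move=> y; rewrite ltr_pdivlMr // => xy; apply: (le_trans (hf x y)).
have lt : eucl (x - y) < (e / (`|c| + 1)) `^ al^-1.
  by rewrite (le_lt_trans (eucl_le_norm _)) // (le_lt_trans _ xy) // mulrC ler_wpM2l // lerDl.
have h1 : eucl (x - y) `^ al <= e / (`|c| + 1).
  have := powR_mono (ltW al0) (eucl_ge0 _) (ltW lt).
  by rewrite powRK // divr_ge0 // ltW.
apply: (@le_trans _ _ ((`|c| + 1) * (e / (`|c| + 1)))); last by rewrite mulrC divfK // gt_eqF.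
apply: (@le_trans _ _ ((`|c| + 1) * eucl (x - y) `^ al)); last by rewrite ler_wpM2l // ltW.
by rewrite ler_wpM2r ?powR_ge0 // (le_trans (ler_norm c)) // lerDl.
Qed.

(** At distance at most 1 the Lipschitz bound suffices because [t <= t^al] for [al <= 1]; at larger
    distance the sup bound does. *)
Lemma Cc_inf_holder al w : 0 < al -> al <= 1 -> Cc_inf w -> exists2 c, 0 <= c & holder_le al c w.
Proof.
move=> al0 al1 cw; have [C C0 HC] := Cc_inf_lipschitz cw; have [M M0 HM] := Cc_inf_bounded cw.
exists (C + (M + M)) => [|x y]; first by rewrite !addr_ge0.
have lip : `|w x - w y| <= C * eucl (x - y).
  have := HC y (x - y); rewrite [y + _]addrC subrK => h; apply: (le_trans h).
  by rewrite ler_wpM2l // norm_le_eucl.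
have [d1|d1] := leP (eucl (x - y)) 1; rewrite mulrDl.
  apply: (le_trans lip); rewrite ler_wpDr ?mulr_ge0 ?addr_ge0 ?powR_ge0 // ler_wpM2l //.
  have [->|/negbTE d0] := eqVneq (eucl (x - y)) 0; first exact: powR_ge0.
  rewrite -[leLHS]powRr1 ?eucl_ge0 //; apply: ger_powR => //.
  by rewrite d1 lt_neqAle eq_sym d0 eucl_ge0.
apply: (@le_trans _ _ (M + M)); first by rewrite (le_trans (ler_normB _ _)) // lerD.
rewrite ler_wpDl ?mulr_ge0 ?powR_ge0 // ler_peMr ?addr_ge0 //.
have := @powR_mono _ al 1 _ (ltW al0) ler01 (ltW d1); by rewrite powR1.
Qed.
End HolderSeminorm.

Section Energy.
Variables (R : realType) (n : nat) (s p : R).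
Local Notation V := 'rV[R]_n.
Local Notation mu := (muN R n).
Implicit Types (f w : V -> R) (g : V -> V) (x y z a : V) (b c h : R) (v : \bar R).
Hypotheses (n1 : (1 <= n)%N) (s0 : 0 < s) (sle1 : s <= 1) (p1 : 1 < p) (nsp : n%:R < s * p).
Let p0 : 0 < p. Proof. exact: lt_trans ltr01 p1. Qed.
Let alpha := alpha_sp n s p.
Let a0 : 0 < alpha.
Proof. by rewrite /alpha /alpha_sp subr_gt0 ltr_pdivrMr. Qed.
Let a1 : alpha <= 1.
Proof. by rewrite (le_trans _ sle1) // /alpha /alpha_sp lerBlDr lerDl divr_ge0 // ltW. Qed.

(* [Wsp_val] for continuous [f], with iterated integrals replaced by product measures *)
Definition has_energy f v : Prop :=
  if s == 1 then exists2 g, wgrad f g & v = Epow mu p (fun x => eucl (g x))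
  else v = Epow (muP R n) p (gquot s p f).

Lemma Wsp_valP f v : continuous f -> Wsp_val s p f v <-> has_energy f v.
Proof.
move=> cf; rewrite /Wsp_val /has_energy; case: eqP => _.
  split=> [[g [/(weak_gradP _ cf) wg ->]]|[g wg ->]].
    by exists g => //; apply: Lp_pE; case: wg.
  exists g; split; first exact/weak_gradP.
  by rewrite Lp_pE //; case: wg.
by rewrite gagliardoE //; exact: continuous_measurable_rV.
Qed.

Lemma has_energy_ge0 f v : has_energy f v -> (0 <= v)%E.
Proof. by rewrite /has_energy; case: eqP => _ => [[g _ ->]|->]; exact: Epow_ge0. Qed.

Lemma has_energy_smooth f : smooth f -> has_energy f (Wsp_smooth_p s p f).
Proof.
move=> sf; rewrite /has_energy /Wsp_smooth_p; case: eqP => _.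
  exists (grad f); first exact: wgrad_smooth.
  by apply: Lp_pE; have [] := wgrad_smooth sf.
by apply: gagliardoE => //; apply: continuous_measurable_rV; exact: smooth_continuous.
Qed.

Lemma has_energyZ b d f v : continuous f -> has_energy f v ->
  has_energy (fun x => b * (f x - d)) ((`|b| `^ p)%:E * v)%E.
Proof.
move=> cf; rewrite /has_energy; case: eqP => _ => [[g wg ->]|->].
  exists (fun x => b *: g x).
    have := wgrad_comb b (- (b * d)) cf (@cst_continuous V R 1) wg (wgrad_cst n 1).
    congr wgrad; apply/funext => x; rewrite ?mulr1 ?mulrBr //.
    by rewrite scaler0 addr0.
  have [mg _ _] := wg.
  rewrite -(@EpowZ _ _ R mu p _ _ (normr_ge0 b) (mfun_eucl mg) (fun x => eucl_ge0 _)).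
  by apply: eq_integral => x _; rewrite euclZ.
have mg := mfun_gquot s p (continuous_measurable_rV cf).
rewrite -(@EpowZ _ _ R (muP R n) p _ _ (normr_ge0 b) mg (gquot_ge0 s p f)).
congr Epow; apply/funext => w; rewrite /gquot -mulrBr normrM mulrA.
by congr (_ * `|_| / _); ring.
Qed.

Lemma has_energy_affine c a f v : 0 < c -> continuous f -> has_energy f v ->
  has_energy (fun x => f (c *: x + a)) ((c `^ (s * p - n%:R))%:E * v)%E.
Proof.
move=> c0 cf; rewrite /has_energy; case: eqP => [sE|_] => [[g wg ->]|->].
  exists (fun x => c *: g (c *: x + a)); first exact: wgrad_affine.
  have [mg _ _] := wg; have meg := mfun_eucl mg.
  have mga : mfun_rV (fun x => eucl (g (c *: x + a))) by exact: (mfun_affine c a meg).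
  have E1 : Epow mu p (fun x => eucl (g x)) =
      ((c ^+ n)%:E * Epow mu p (fun x => eucl (g (c *: x + a)%R)))%E.
    apply: (ge0_integral_muN_affine a c0 (measurable_Epow p meg)) => x.
    by rewrite lee_fin powR_ge0.
  have E2 : Epow mu p (fun x => eucl (c *: g (c *: x + a)%R)) =
      ((c `^ p)%:E * Epow mu p (fun x => eucl (g (c *: x + a)%R)))%E.
    rewrite -(@EpowZ _ _ R mu p _ _ (ltW c0) mga (fun x => eucl_ge0 _)).
    by apply: eq_integral => x _; rewrite euclZ (gtr0_norm c0).
  have c1 : c `^ (s * p - n%:R) * c ^+ n = c `^ p.
    rewrite -powR_mulrn ?(ltW c0) // -powRD ?subrK ?sE ?mul1r //.
    by rewrite (gt_eqF c0) implybT.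
  by rewrite E1 E2 muleA -EFinM c1.
by rewrite Epow_gquot_affine //; exact: continuous_measurable_rV.
Qed.

Lemma has_energy_approximable f v : holder_le alpha 1 f -> has_energy f v -> (v < +oo)%E ->
  approximable s p f v.
Proof.
move=> hf; have cf := holder_continuous a0 hf.
have hf' x y : `|f x - f y| <= eucl (x - y) `^ alpha by have := hf x y; rewrite mul1r.
rewrite /has_energy; case: eqP => [sE|/eqP sN]; last first.
  have slt : s < 1 by rewrite lt_neqAle sN.
  have E := gagliardoE s p0 (continuous_measurable_rV cf).
  by move=> ->; rewrite -E => vf; exact: approximable_fractional.
move=> [g wg ->] _; have := @approximable_sobolev R n p p1 _ f g cf _ wg.
rewrite -sE; apply; last exact: hf'.
by move: nsp; rewrite sE mul1r.
Qed.

Lemma Wsp_smooth_pZ c w : 0 <= c -> smooth w ->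
  Wsp_smooth_p s p (fun x => c * w x) = ((c `^ p)%:E * Wsp_smooth_p s p w)%E.
Proof.
move=> c0 sw; have scw : smooth (fun x => c * w x) by exact: smoothZ.
rewrite /Wsp_smooth_p; case: eqP => _.
  have [m1 _ _] := wgrad_smooth scw; have [m2 _ _] := wgrad_smooth sw.
  rewrite (Lp_pE p m1) (Lp_pE p m2).
  rewrite -(@EpowZ _ _ R mu p _ _ c0 (mfun_eucl m2) (fun x => eucl_ge0 _)).
  apply: eq_integral => x _; congr (_ `^ _)%:E.
  rewrite -[c in RHS]ger0_norm // -euclZ; congr eucl; apply/rowP => i; rewrite !mxE.
  by rewrite [LHS]deriveZ //; apply: diff_derivable; exact: smooth_differentiable.
have m1 := continuous_measurable_rV (smooth_continuous scw).
have m2 := continuous_measurable_rV (smooth_continuous sw).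
rewrite (gagliardoE s p0 m1) (gagliardoE s p0 m2).
rewrite -(@EpowZ _ _ R (muP R n) p _ _ c0 (mfun_gquot s p m2) (gquot_ge0 s p w)).
by congr Epow; apply/funext => z; rewrite gquotZ ger0_norm.
Qed.

Lemma powR_cancel_le (theta h : R) v v' : 0 < theta -> theta <= h -> (0 <= v')%E ->
  (v' <= (h^-1 `^ p)%:E * v)%E -> ((theta `^ p)%:E * v' <= v)%E.
Proof.
move=> th0 thh v0 hv; have h0 : 0 < h by exact: lt_le_trans thh.
have hp : (0 <= (h `^ p)%:E)%E by rewrite lee_fin powR_ge0.
apply: (@le_trans _ _ ((h `^ p)%:E * v')%E).
  by apply: lee_wpmul2r => //; rewrite lee_fin; apply: powR_mono => //; exact: ltW.
apply: (le_trans (lee_wpmul2l hp hv)); rewrite muleA -EFinM -powRM ?invr_ge0 ?(ltW h0) //.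
by rewrite divff ?gt_eqF // powR1 mul1e.
Qed.

Lemma Wsp_smooth_p_ge0 w : smooth w -> (0 <= Wsp_smooth_p s p w)%E.
Proof. by move=> /has_energy_smooth; exact: has_energy_ge0. Qed.

Lemma m_sp_ge0 : (0 <= m_sp n s p)%E.
Proof. by apply: le_ereal_inf_tmp => _ [f [[sf _] _] <-]; exact: Wsp_smooth_p_ge0. Qed.

Lemma inf_calW_ge0 : (0 <= inf_calW n s p)%E.
Proof.
by apply: le_ereal_inf_tmp => v [f [[cf _] [_ /(Wsp_valP _ cf)]]]; exact: has_energy_ge0.
Qed.

(** The seminorm of [w] is at least [theta] and the energy is homogeneous of degree [p], so a test
    function with one large increment already bounds the infimum. *)
Lemma m_sp_le_energy w (theta : R) x y : Cc_inf w -> x != y -> 0 < theta ->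
  theta * eucl (x - y) `^ alpha <= `|w x - w y| ->
  ((theta `^ p)%:E * m_sp n s p <= Wsp_smooth_p s p w)%E.
Proof.
move=> cw xy th0 hw; have [c c0 hc] := Cc_inf_holder a0 a1 cw.
have [h thh hE] := holder_semi_normalize hc xy th0 hw; have h0 : 0 < h by exact: lt_le_trans thh.
apply: (powR_cancel_le th0 thh m_sp_ge0).
have [sw _] := cw; rewrite -Wsp_smooth_pZ ?invr_ge0 ?(ltW h0) //.
by apply: ereal_inf_lbound; exists (fun z => h^-1 * w z) => //; split => //; exact: Cc_infZ.
Qed.

Lemma inf_calW_le_energy f c (theta : R) x y v : holder_le alpha c f -> has_energy f v ->
  x != y -> 0 < theta -> theta * eucl (x - y) `^ alpha <= `|f x - f y| ->
  ((theta `^ p)%:E * inf_calW n s p <= v)%E.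
Proof.
move=> hf fv xy th0 hth; have cf := holder_continuous a0 hf.
have [->|vN] := eqVneq v +oo%E; first exact: leey.
have [h thh hE] := holder_semi_normalize hf xy th0 hth; have h0 : 0 < h by exact: lt_le_trans thh.
apply: (powR_cancel_le th0 thh inf_calW_ge0).
have fv' := has_energyZ h^-1 0 cf fv.
have E : (fun x => h^-1 * (f x - 0)) = (fun x => h^-1 * f x).
  by apply/funext => z; rewrite subr0.
rewrite E [`|h^-1|]ger0_norm ?invr_ge0 ?(ltW h0) // in fv'.
have chf : continuous (fun x => h^-1 * f x) := holder_continuous a0 (holder_leZ _ hf).
apply: ereal_inf_lbound; exists (fun z => h^-1 * f z); split; last first.
  by split => //; apply/Wsp_valP.
split => //; split; first by rewrite hE ltry.
exists ((h^-1 `^ p)%:E * v)%E; split; first exact/Wsp_valP.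
by apply: lte_mul_pinfty; rewrite ?lee_fin ?powR_ge0 // ltey.
Qed.

(** The limit of the approximation estimate for tolerance [e = 1 / (k + 4)]; the shift by 4 keeps
    [1 - 3 e] positive from [k = 0] on. *)
Lemma le_of_powR_approx (m t : R) : 0 <= t ->
  (forall k : nat, (1 - 3 * (k.+4)%:R^-1) `^ p * m <= (1 + (k.+4)%:R^-1) * t + (k.+4)%:R^-1) -> m <= t.
Proof.
move=> t0 H.
have hk : (fun k : nat => (k.+4)%:R^-1 : R) @ \oo --> (0 : R).
  have := @cvg_harmonic R; rewrite -(cvg_shiftn 3).
  by under eq_fun do rewrite /= addn3.
have L : (fun k : nat => (1 - 3 * (k.+4)%:R^-1) `^ p * m) @ \oo --> m.
  rewrite -[X in _ --> X]mul1r; apply: cvgMr_tmp.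
  have := @cvg_powR R p (fun k : nat => 1 - 3 * (k.+4)%:R^-1) 1 p0; rewrite powR1; apply.
    by move=> k; rewrite subr_ge0 ler_pdivrMr ?ltr0n // mul1r ler_nat.
  rewrite -[X in _ --> X]subr0 -[in X in _ --> X](mulr0 3).
  by apply: cvgB; [exact: cvg_cst|exact: cvgMl_tmp].
have U : (fun k : nat => (1 + (k.+4)%:R^-1) * t + (k.+4)%:R^-1) @ \oo --> t.
  have : (fun k : nat => (1 + (k.+4)%:R^-1) * t + (k.+4)%:R^-1) @ \oo --> (1 + 0) * t + 0.
    by apply: cvgD => //; apply: cvgMr_tmp; apply: cvgD => //; exact: cvg_cst.
  by rewrite !addr0 mul1r.
rewrite -(cvg_lim _ L) // -(cvg_lim _ U) //; apply: ler_lim.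
- by apply/cvg_ex; exists m.
- by apply/cvg_ex; exists t.
- by near=> k; exact: H.
Unshelve. all: by end_near. Qed.

Lemma near_optimal_pair f (d : R) : holder_semi alpha f = 1%E -> 0 < d -> exists x y, x != y /\
  (1 - d) * eucl (x - y) `^ alpha <= `|f x - f y|.
Proof.
move=> hf d0; have : ((1 - d)%:E < holder_semi alpha f)%E by rewrite hf lte_fin gtrBl.
move=> /ereal_sup_gt[_ [x [y [xy ->]]]]; rewrite lte_fin => h; exists x, y; split => //.
by rewrite -ler_pdivlMr ?powR_gt0 ?eucl_subr_gt0 // ltW.
Qed.

Lemma m_sp_le_of_energy f v : holder_semi alpha f = 1%E -> has_energy f v -> (m_sp n s p <= v)%E.
Proof.
move=> hf fv; have [->|vN] := eqVneq v +oo%E; first exact: leey.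
have hl : holder_le alpha 1 f by apply: holder_semi_fin; rewrite ?hf.
have v0 := has_energy_ge0 fv; have vf : (v < +oo)%E by rewrite ltey.
have ap := has_energy_approximable hl fv vf.
have vfin : v \is a fin_num by rewrite ge0_fin_numE.
have key (k : nat) : (((1 - 3 * (k.+4)%:R^-1) `^ p)%:E * m_sp n s p <=
    ((1 + (k.+4)%:R^-1) * fine v + (k.+4)%:R^-1)%:E)%E.
  pose e : R := (k.+4)%:R^-1; have e0 : 0 < e by rewrite invr_gt0.
  have e4 : 3 * e < 1 by rewrite ltr_pdivrMr ?ltr0n // mul1r ltr_nat.
  have [x [y [xy hxy]]] := near_optimal_pair hf e0.
  pose D := eucl (x - y) `^ alpha; have D0 : 0 < D by rewrite powR_gt0 // eucl_subr_gt0.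
  (* The bound [e] controls the energy and [e * D] the increment: near-optimality of the pair costs
     [e * D], and so does the approximation at each of [x] and [y], whence the factor [1 - 3 e]. *)
  have m0 : 0 < Num.min e (e * D) by rewrite lt_min e0 mulr_gt0.
  have [w [cw wE wx wy]] := ap _ x y m0.
  have mE : Num.min e (e * D) <= e by rewrite ge_min lexx.
  have mD : Num.min e (e * D) <= e * D by rewrite ge_min lexx orbT.
  have wxy : (1 - 3 * e) * D <= `|w x - w y|.
    have -> : (1 - 3 * e) * D = (1 - e) * D - (e * D + e * D) by ring.
    rewrite lerBlDr (le_trans hxy) //.
    have -> : f x - f y = (w x - w y) + ((w y - (f y - f 0)) - (w x - (f x - f 0))) by ring.
    rewrite (le_trans (ler_normD _ _)) // lerD2l (le_trans (ler_normB _ _)) //.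
    by rewrite lerD // (le_trans _ mD).
  apply: (le_trans (m_sp_le_energy cw xy _ wxy)); first by rewrite subr_gt0.
  apply: (le_trans wE); rewrite -[v in leLHS]fineK // -EFinM -EFinD lee_fin.
  by rewrite lerD // ler_wpM2r ?fine_ge0 // lerD2l.
(* Finiteness follows from the estimate at [k = 0], whose factor [(1 - 3 / 4)^p] is positive. *)
have mfin : m_sp n s p \is a fin_num.
  rewrite ge0_fin_numE ?m_sp_ge0 // ltey; apply/eqP => E; have := key 0%N.
  have pos : 0 < (1 - 3 * 4%:R^-1 : R) `^ p.
    by rewrite powR_gt0 // subr_gt0 ltr_pdivrMr ?ltr0n // mul1r ltr_nat.
  by rewrite E gt0_muley ?lte_fin // leye_eq.
rewrite -(fineK mfin) -(fineK vfin) lee_fin; apply: le_of_powR_approx; first exact: fine_ge0.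
by move=> k; have := key k; rewrite -{1}(fineK mfin) -EFinM lee_fin.
Qed.

Lemma m_sp_eq_inf_calW : m_sp n s p = inf_calW n s p.
Proof.
apply/eqP; rewrite eq_le; apply/andP; split.
  apply: le_ereal_inf_tmp => v [f [[cf _] [hf /(Wsp_valP _ cf) fv]]].
  exact: m_sp_le_of_energy fv.
apply: le_ereal_inf_tmp => _ [f [[sf sc] hf] <-].
have [->|vN] := eqVneq (Wsp_smooth_p s p f) +oo%E; first exact: leey.
have cf := smooth_continuous sf.
have fv : Wsp_val s p f (Wsp_smooth_p s p f) by apply/Wsp_valP => //; exact: has_energy_smooth.
apply: ereal_inf_lbound; exists f; split => //; split => //; split; first by rewrite hf ltry.
by exists (Wsp_smooth_p s p f); rewrite ltey.
Qed.

Lemma inf_calW_lty : (inf_calW n s p < +oo)%E.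
Proof.
have [chi cc] := @cutoff_exists R n; have cc' : is_cutoff chi by [].
have [cinf c01 chi0 csupp] := cc; have [sc _] := cinf.
have [c c0 hc] := Cc_inf_holder a0 a1 cinf.
have fin : (Wsp_smooth_p s p chi < +oo)%E.
  rewrite /Wsp_smooth_p; case: eqP => [sE|/eqP sN].
    have [mg _ _] := wgrad_smooth sc; rewrite Lp_pE //.
    have [M M0 HM] := grad_bounded cinf.
    have [|||I0 h] := @integral_bounded_ball R n (fun x => eucl (grad chi x) `^ p) (M `^ p) 1.
    - exact: (measurableT_comp (measurable_powR p) (mfun_eucl mg)).
    - by move=> z; rewrite powR_ge0; apply: powR_mono; rewrite ?(ltW p0) ?eucl_ge0.
    - move=> z z1; rewrite (@grad_support _ _ _ 1) ?eucl0 ?powR0 ?gt_eqF // => y /ltW.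
      exact: csupp.
    by apply: le_lt_trans h _; rewrite ltry.
  have slt : s < 1 by rewrite lt_neqAle sN.
  have mc := Cc_inf_mfun cinf; rewrite (gagliardoE s p0 mc).
  apply: le_lt_trans (Epow_cutoff_kernel_lty n1 s0 slt p1 nsp cc').
  apply: le_Epow; [exact: ltW|exact: mfun_gquot|exact: mfun_cutoff_kernel|exact: gquot_ge0|].
  move=> w; rewrite /cutoff_kernel ler_peMl ?gquot_ge0 //.
  have m1 : 1 <= Num.max 1 (eucl w.2) by rewrite le_max lexx.
  by have := @powR_mono _ alpha 1 _ (ltW a0) ler01 m1; rewrite powR1.
(* As [n >= 1] this vector has length at least 1, so the cutoff drops from 1 at the origin to 0
   there and has a positive Hoelder quotient. *)
pose y : V := const_mx 1.
have y1 : 1 <= eucl y by have := coord_le_eucl y (Ordinal n1); rewrite mxE normr1.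
have y0 : 0 != y by rewrite eq_sym -eucl_gt0 (lt_le_trans ltr01).
have D0 : 0 < eucl (0 - y) `^ alpha by rewrite powR_gt0 // eucl_subr_gt0.
have th0 : 0 < (eucl (0 - y) `^ alpha)^-1 by rewrite invr_gt0.
have := inf_calW_le_energy hc (has_energy_smooth sc) y0 th0 _.
rewrite mulVf ?gt_eqF // chi0 (csupp y y1) subr0 normr1 => /(_ (lexx _)) h.
rewrite ltey; apply/eqP => E; move: (le_lt_trans h fin).
by rewrite E gt0_muley ?lte_fin ?powR_gt0 // ltxx.
Qed.
End Energy.

(** * Uniform convexity *)

Section UniformConvexity.
Variable R : realType.
Implicit Types (p q a b c e x y m d t A B eta : R).

(** A lower bound for the growth of [t^q] over a step of length [e] that ends in [[1/2, 1]],
    obtained from [c - e <= c (1 - e)]. It holds for every [q > 0] and is used with [q = p - 1] and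
    [q = p]. *)
Definition pow_gap q e := (1 / 2) `^ q * (1 - (1 - e) `^ q).

Lemma pow_gap_gt0 q e : 0 < q -> 0 < e <= 1 -> 0 < pow_gap q e.
Proof.
move=> q0 /andP[e0 e1]; rewrite mulr_gt0 ?powR_gt0 // subr_gt0.
have := @gt0_ltr_powR R q q0 (1 - e) 1; rewrite powR1; apply; rewrite ?nnegrE ?subr_ge0 //.
by rewrite gtrBl.
Qed.

Lemma pow_gap_le q c x e : 0 < q -> 0 <= x -> 0 < e -> x <= c - e -> 1 / 2 <= c -> c <= 1 ->
  pow_gap q e <= c `^ q - x `^ q.
Proof.
move=> q0 x0 e0 xc c2 c1; have e1 : 0 < e <= 1 by rewrite e0 /=; lra.
have c0 : 0 <= c by lra.
have ce : c * e <= e by rewrite ler_piMl // ltW.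
have h1 : x <= c * (1 - e) by rewrite mulrBr mulr1 (le_trans xc) // lerB.
have h2 := powR_mono (ltW q0) x0 h1; rewrite powRM in h2 => //; last by lra.
apply: (@le_trans _ _ (c `^ q * (1 - (1 - e) `^ q))); last first.
  by rewrite mulrBr mulr1 lerB.
have := pow_gap_gt0 q0 e1; rewrite /pow_gap pmulr_rgt0 ?powR_gt0 // => /ltW h3.
by rewrite ler_wpM2r //; apply: powR_mono => //; rewrite ?divr_ge0 ?(ltW q0).
Qed.

(* Pushing [b] towards [1] lowers the midpoint defect of [t^p]; the amount lost between
   [b] and [b'] is bounded below by comparing tangents at [b'] and at [c]. *)
Lemma midpoint_defect p b e : 1 < p -> 0 <= b -> 0 < e -> b <= 1 - e ->
  p / 2 * (e / 4) * pow_gap (p - 1) (e / 4) <= (1 + b `^ p) / 2 - ((1 + b) / 2) `^ p.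
Proof.
move=> p1 b0 e0 be; pose c := (1 + b) / 2; pose b' := (b + c) / 2; pose c' := (1 + b') / 2.
have b'0 : 0 <= b' by rewrite /b' /c; lra.
have c0 : 0 <= c by rewrite /c; lra.
have c'0 : 0 <= c' by rewrite /c'; lra.
have T1 := powR_tangent p1 b0 b'0.
have T2 := powR_tangent p1 c'0 c0.
have T3 := powR_tangent p1 b'0 c'0.
have T4 := powR_tangent p1 ler01 c'0; rewrite powR1 in T4.
have gap : pow_gap (p - 1) (e / 4) <= c `^ (p - 1) - b' `^ (p - 1).
  by apply: pow_gap_le => //; rewrite /b' /c; lra.
have g0 : 0 <= pow_gap (p - 1) (e / 4) by apply/ltW/pow_gap_gt0; lra.
have h1 : p / 2 * (e / 4) * pow_gap (p - 1) (e / 4) <=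
    p / 2 * (b' - b) * (c `^ (p - 1) - b' `^ (p - 1)).
  apply: ler_pM => //; first by rewrite mulr_ge0 //; lra.
  by rewrite ler_wpM2l //; [lra|rewrite /b' /c; lra].
apply: (le_trans h1); rewrite -/c.
have E1 : c' - c = (b' - b) / 2 by rewrite /c' /c; lra.
rewrite E1 in T2.
move: T1 T2 T3 T4; set X := b' `^ (p - 1); set Y := c `^ (p - 1); set Z := c' `^ (p - 1).
(* The linear terms of the two tangents at [c'] cancel because [c'] is the midpoint of [b'] and 1;
   this makes the defect at [b'] nonnegative. *)
have E2 : p * Z * (b' - c') + p * Z * (1 - c') = 0 by rewrite /c'; field.
have E3 : p / 2 * (b' - b) * (Y - X) = p * Y * ((b' - b) / 2) + (p * X * (b - b')) / 2 by field.
move=> T1 T2 T3 T4; rewrite E3; lra.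
Qed.

(** Here 1 and [b] are the lengths of two vectors, [m] that of their midpoint and [d] that of their
    difference, linked by the parallelogram law. Either the defect is at least [dl], because [b] is
    far from 1 or [m] far from [(1 + b) / 2], and then [d <= 2] is enough; or [d^2 <= 2 e]. This
    does the work of Clarkson's inequalities for all [p > 1] at once. *)
Lemma uniform_convexity_normalized p eta : 1 < p -> 0 < eta -> exists2 C, 0 <= C &
  forall b m d, 0 <= b <= 1 -> 0 <= m -> m <= (1 + b) / 2 -> 0 <= d ->
    d ^+ 2 = 2 * (1 + b ^+ 2) - 4 * m ^+ 2 ->
    d `^ p <= eta + C * ((1 + b `^ p) / 2 - m `^ p).
Proof.
move=> p1 eta0; have p0 : 0 < p by lra.
(* Chosen so that [(2 e)^(p / 2) <= eta], which bounds [d^p] in the case [d^2 <= 2 e]. *)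
pose e := Num.min (1 / 2) (eta `^ (2 / p) / 2).
have e0 : 0 < e by rewrite lt_min divr_gt0 //= divr_gt0 // powR_gt0.
have e2 : e <= 1 / 2 by rewrite ge_min lexx.
have eeta : (2 * e) `^ (p / 2) <= eta.
  have h : 2 * e <= eta `^ (2 / p).
    by rewrite mulrC -ler_pdivlMr // ge_min lexx orbT.
  have := @powR_mono _ (p / 2) _ _ _ _ h; rewrite -powRrM.
  have -> : 2 / p * (p / 2) = 1 by field; rewrite gt_eqF.
  rewrite powRr1 ?(ltW eta0) //; apply; lra.
pose d1 := p / 2 * (e / 4) * pow_gap (p - 1) (e / 4).
have d10 : 0 < d1.
  apply: mulr_gt0; first by rewrite mulr_gt0 //; lra.
  by apply: pow_gap_gt0; lra.
pose d2 := pow_gap p (e / 8); have d20 : 0 < d2 by apply: pow_gap_gt0; lra.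
pose dl := Num.min d1 d2; have dl0 : 0 < dl by rewrite lt_min d10.
exists (2 `^ p / dl) => [|b m d /andP[b0 b1] m0 mb d0 dE]; first by rewrite divr_ge0 ?powR_ge0 // ltW.
have cvx : ((1 + b) / 2) `^ p <= (1 + b `^ p) / 2.
  have c0 : 0 <= (1 + b) / 2 by lra.
  have T3 := powR_tangent p1 b0 c0; have T4 := powR_tangent p1 ler01 c0; rewrite powR1 in T4.
  have E2 : p * ((1 + b) / 2) `^ (p - 1) * (b - (1 + b) / 2) + p * ((1 + b) / 2) `^ (p - 1) * (1 - (1 + b) / 2) = 0.
    by field.
  lra.
have mp : m `^ p <= ((1 + b) / 2) `^ p by apply: powR_mono => //; exact: ltW.
have d2le : d <= 2.
  by rewrite -(@ler_pXn2r _ 2) ?nnegrE // dE; nra.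
have big : dl <= (1 + b `^ p) / 2 - m `^ p -> d `^ p <= eta + 2 `^ p / dl * ((1 + b `^ p) / 2 - m `^ p).
  move=> h; apply: (@le_trans _ _ (2 `^ p)); first by apply: powR_mono => //; exact: ltW.
  rewrite ler_wpDl ?(ltW eta0) // mulrAC ler_pdivlMr // ler_wpM2l ?powR_ge0 //.
have [be|be] := leP b (1 - e).
  apply: big; rewrite (@le_trans _ _ d1) ?ge_min ?lexx //.
  by rewrite (le_trans (midpoint_defect p1 b0 e0 be)) // lerB.
have [me|me] := leP m ((1 + b) / 2 - e / 8).
  apply: big; rewrite (@le_trans _ _ d2) ?ge_min ?lexx ?orbT //.
  apply: (@le_trans _ _ (((1 + b) / 2) `^ p - m `^ p)); last by rewrite lerB.
  by apply: pow_gap_le => //; lra.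
rewrite ler_wpDr //; first by rewrite mulr_ge0 ?divr_ge0 ?powR_ge0 ?(ltW dl0) // subr_ge0 (le_trans mp).
apply: le_trans eeta.
have -> : d `^ p = (d ^+ 2) `^ (p / 2).
  by rewrite -powR_mulrn // -powRrM; congr (_ `^ _); field.
apply: powR_mono; [lra|exact: sqr_ge0|].
have -> : d ^+ 2 = (1 - b) ^+ 2 + 4 * ((1 + b) / 2 - m) * ((1 + b) / 2 + m) by rewrite dE; field.
have h1 : (1 - b) ^+ 2 <= e.
  rewrite expr2 -[leRHS]mulr1; apply: ler_pM; lra.
have h2 : 4 * ((1 + b) / 2 - m) * ((1 + b) / 2 + m) <= e / 2 * 2.
  by apply: ler_pM; lra.
by apply: (le_trans (lerD h1 h2)); lra.
Qed.

Lemma uniform_convexity_scalar p eta : 1 < p -> 0 < eta -> exists2 C, 0 <= C &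
  forall A B m d, 0 <= A -> 0 <= B -> 0 <= m -> m <= (A + B) / 2 -> 0 <= d ->
    d ^+ 2 = 2 * (A ^+ 2 + B ^+ 2) - 4 * m ^+ 2 ->
    d `^ p <= eta * (A `^ p + B `^ p) + C * ((A `^ p + B `^ p) / 2 - m `^ p).
Proof.
move=> p1 eta0; have p0 : 0 < p by lra.
have [C C0 HC] := uniform_convexity_normalized p1 eta0; exists C => // A B m d A0 B0 m0.
wlog BA : A B A0 B0 / B <= A => [IH mAB d0 dE|].
  have [BA|/ltW AB] := leP B A; first exact: IH.
  rewrite [A `^ p + _]addrC; apply: IH => //; first by rewrite addrC.
  by rewrite dE [A ^+ 2 + _]addrC.
move=> mAB d0 dE; have [A00|An] := eqVneq A 0.
  have B00 : B = 0 by apply/eqP; rewrite eq_le B0 -A00 BA.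
  have m00 : m = 0 by apply/eqP; rewrite eq_le m0 (le_trans mAB) // A00 B00 addr0 mul0r.
  have d00 : d = 0.
    by apply/eqP; rewrite -sqrf_eq0 dE A00 B00 m00 expr0n /= !addr0 !mulr0 subrr.
  by rewrite A00 B00 m00 d00 powR0 ?gt_eqF // !addr0 mul0r subrr !mulr0 addr0.
have Ap : 0 < A by rewrite lt_neqAle eq_sym An.
have h : (d / A) `^ p <= eta + C * ((1 + (B / A) `^ p) / 2 - (m / A) `^ p).
  apply: HC; rewrite ?divr_ge0 //.
  - by rewrite ler_pdivrMr // mul1r.
  - by rewrite ler_pdivrMr //; apply: (le_trans mAB); rewrite le_eqVlt; apply/orP; left; apply/eqP; field.
  - by rewrite expr_div_n dE; field.
have ApP : 0 < A `^ p by rewrite powR_gt0.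
rewrite !powR_div // ler_pdivrMr // in h; apply: (le_trans h).
have -> : (eta + C * ((1 + B `^ p / A `^ p) / 2 - m `^ p / A `^ p)) * A `^ p =
    eta * A `^ p + C * ((A `^ p + B `^ p) / 2 - m `^ p) by field; rewrite gt_eqF.
by rewrite lerD2r ler_wpM2l ?(ltW eta0) // lerDl powR_ge0.
Qed.
End UniformConvexity.

Lemma Epow_comb d (Z : measurableType d) (R : realType) (nu : {measure set Z -> \bar R})
    (p c1 c2 : R) (F G : Z -> R) : 0 <= c1 -> 0 <= c2 ->
  measurable_fun setT F -> measurable_fun setT G ->
  (\int[nu]_z (c1 * F z `^ p + c2 * G z `^ p)%:E = c1%:E * Epow nu p F + c2%:E * Epow nu p G)%E.
Proof.
move=> c10 c20 mF mG; rewrite /Epow -!ge0_integralZl ?lee_fin //;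
  try exact: measurable_Epow; try exact: powR_EFin_ge0.
rewrite -ge0_integralD //.
- by move=> z _; rewrite lee_fin mulr_ge0 // powR_ge0.
- by apply: emeasurable_funM => //; exact: measurable_Epow.
- by move=> z _; rewrite lee_fin mulr_ge0 // powR_ge0.
- by apply: emeasurable_funM => //; exact: measurable_Epow.
Qed.

(** The energy [m] of the midpoint may be infinite, so it is first replaced by its finite lower
    bound [L] and only then moved across the inequality. *)
Lemma absorb_lower_bound (R : realType) (a c K L : R) (x m e1 e2 : \bar R) : 0 <= a -> 0 <= c ->
  (e1 <= K%:E)%E -> (e2 <= K%:E)%E -> (L%:E <= m)%E ->
  (x + c%:E * m <= a%:E * e1 + a%:E * e2)%E -> (x <= (a * K + a * K - c * L)%:E)%E.
Proof.
move=> a0 c0 h1 h2 hL h; rewrite EFinB leeBrDr // EFinM; apply: (@le_trans _ _ (x + c%:E * m)%E).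
  by apply: leeD => //; apply: lee_wpmul2l.
by apply: (le_trans h); rewrite EFinD !EFinM; apply: leeD; apply: lee_wpmul2l; rewrite ?lee_fin.
Qed.

(** * Uniform convexity for vector fields *)

Section LpUniformConvexity.
Variables (R : realType) (n : nat) (p : R).
Local Notation V := 'rV[R]_n.
Local Notation mu := (muN R n).
Implicit Types (g : V -> V) (eta K L : R).
Hypothesis p1 : 1 < p.
Let p0 : 0 < p. Proof. exact: lt_trans ltr01 p1. Qed.

Definition mfun_vec g := forall i, mfun_rV (fun x => g x ord0 i).

Lemma mfun_vec_comb (c1 c2 : R) g1 g2 : mfun_vec g1 -> mfun_vec g2 ->
  mfun_vec (fun x => c1 *: g1 x + c2 *: g2 x).
Proof.
move=> m1 m2 i; under eq_fun do rewrite !mxE.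
apply: measurable_funD; apply: measurable_funM;
  by [exact: measurable_cst|exact: m1|exact: m2].
Qed.

(** The scalar estimate is integrated pointwise. Fields of energy at most [K] are close if their
    midpoint has energy at least [L] with [K - L] small. Differences are written with coefficients
    [1] and [-1], so that they share [mfun_vec_comb] with midpoints. *)
Lemma Epow_uniform_convexity eta : 0 < eta -> exists2 C, 0 <= C & forall g1 g2 K L,
  mfun_vec g1 -> mfun_vec g2 ->
  (Epow mu p (fun x => eucl (g1 x)) <= K%:E)%E -> (Epow mu p (fun x => eucl (g2 x)) <= K%:E)%E ->
  (L%:E <= Epow mu p (fun x => eucl (2^-1 *: g1 x + 2^-1 *: g2 x)))%E ->
  (Epow mu p (fun x => eucl (1 *: g1 x + (-1) *: g2 x)) <= (2 * eta * K + C * (K - L))%:E)%E.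
Proof.
move=> eta0; have [C C0 HC] := uniform_convexity_scalar p1 eta0; exists C => // g1 g2 K L m1 m2 h1 h2 hL.
pose D x := eucl (1 *: g1 x + (-1) *: g2 x); pose M x := eucl (2^-1 *: g1 x + 2^-1 *: g2 x).
have mD : mfun_rV D by apply: mfun_eucl; exact: mfun_vec_comb.
have mM : mfun_rV M by apply: mfun_eucl; exact: mfun_vec_comb.
have mg1 := mfun_eucl m1; have mg2 := mfun_eucl m2.
have pt x : D x `^ p + C * M x `^ p <= (eta + C / 2) * (eucl (g1 x) `^ p + eucl (g2 x) `^ p).
  have E : M x = eucl (g1 x + g2 x) / 2.
    by rewrite /M -scalerDr euclZ ger0_norm ?invr_ge0 // mulrC.
  have := HC (eucl (g1 x)) (eucl (g2 x)) (M x) (D x) (eucl_ge0 _) (eucl_ge0 _) (eucl_ge0 _) _ (eucl_ge0 _).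
  rewrite E /D scale1r scaleN1r => h.
  have hm : eucl (g1 x + g2 x) / 2 <= (eucl (g1 x) + eucl (g2 x)) / 2.
    by rewrite ler_wpM2r ?invr_ge0 // ler_euclD.
  have hd : eucl (g1 x - g2 x) ^+ 2 = 2 * (eucl (g1 x) ^+ 2 + eucl (g2 x) ^+ 2) -
      4 * (eucl (g1 x + g2 x) / 2) ^+ 2.
    by rewrite -parallelogram_eucl; field.
  have := h hm hd.
  set u := _ `^ p; set v := _ `^ p; set w := _ `^ p; set z := _ `^ p => hh.
  have -> : (eta + C / 2) * (v + w) = eta * (v + w) + C * ((v + w) / 2 - z) + C * z by field.
  by rewrite lerD2r.
have ec : 0 <= eta + C / 2 by rewrite addr_ge0 ?(ltW eta0) // divr_ge0.
have EL := @Epow_comb _ _ R mu p 1 C D M ler01 C0 mD mM.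
have ER := @Epow_comb _ _ R mu p _ _ (fun x => eucl (g1 x)) (fun x => eucl (g2 x)) ec ec mg1 mg2.
have mcomb c1 c2 F G : mfun_rV F -> mfun_rV G ->
    measurable_fun setT ((fun x => (c1 * F x `^ p + c2 * G x `^ p)%:E) : rVB R n -> \bar R).
  move=> mF mG; apply/measurable_EFinP; apply: measurable_funD;
  apply: measurable_funM; first [exact: measurable_cst|exact: (measurableT_comp (measurable_powR p))].
have I : (\int[mu]_x (1 * D x `^ p + C * M x `^ p)%:E <= \int[mu]_x
    ((eta + C / 2) * eucl (g1 x) `^ p + (eta + C / 2) * eucl (g2 x) `^ p)%:E)%E.
  apply: ge0_le_integral => //.
  - by move=> x _; rewrite lee_fin addr_ge0 ?mulr_ge0 ?powR_ge0.
  - exact: mcomb.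
  - exact: mcomb.
  - by move=> x _; rewrite lee_fin mul1r -mulrDr.
rewrite EL ER mul1e in I.
apply: (le_trans (absorb_lower_bound ec C0 h1 h2 hL I)).
by rewrite lee_fin le_eqVlt; apply/orP; left; apply/eqP; field.
Qed.
End LpUniformConvexity.

(** * Limits of weak gradients *)

Section FastConvergence.
Variables (d : measure_display) (Z : measurableType d) (R : realType).
Variable nu : {measure set Z -> \bar R}.
Implicit Types (h : nat -> Z -> R) (p t : R).

Lemma halves_sum_le (k : nat) : \sum_(0 <= j < k) (2^-1 ^+ j : R) <= 2.
Proof.
suff -> : \sum_(0 <= j < k) (2^-1 ^+ j : R) = 2 - 2 * 2^-1 ^+ k by rewrite gerBl mulr_ge0 // exprn_ge0 // invr_ge0.
elim: k => [|k IH]; first by rewrite big_nil expr0 mulr1 subrr.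
by rewrite big_nat_recr //= IH exprS; field.
Qed.

(* Weighting the [j]-th term by [2^j] keeps the series [sum_j 2^j h_j^p] integrable, so that
   it converges off a null set and forces geometric decay of [h_j] there. *)
Lemma fast_convergence p h : 0 < p -> (forall j, measurable_fun setT (h j)) ->
  (forall j z, 0 <= h j z) -> (forall j, (Epow nu p (h j) <= (4^-1 ^+ j)%:E)%E) ->
  exists E, [/\ measurable E, nu (~` E) = 0%E &
    forall z, E z -> exists2 t, 0 <= t & forall j, h j z <= t * (2^-1 `^ p^-1) ^+ j].
Proof.
move=> p0 mh h0 hE; pose F j z : \bar R := (2 ^+ j * h j z `^ p)%:E.
have mF j : measurable_fun setT (F j).
  by apply/measurable_EFinP; apply: measurable_funM => //; exact: (measurableT_comp (measurable_powR p)).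
have F0 j z : (0 <= F j z)%E by rewrite lee_fin mulr_ge0 ?powR_ge0 // exprn_ge0.
pose T z := (\sum_(0 <= j <oo) F j z)%E.
have T0 z : (0 <= T z)%E by apply: nneseries_ge0.
have mT : measurable_fun setT T by apply: ge0_emeasurable_sum.
have IT : (\int[nu]_z T z <= 2%:E)%E.
  rewrite /T integral_nneseries //.
  apply: lime_le; first by apply: is_cvg_nneseries => j _ _; apply: integral_ge0.
  near=> k; apply: (@le_trans _ _ (\sum_(0 <= j < k) (2^-1 ^+ j)%:E)%E).
    apply: lee_sum => j _; rewrite /F.
    have -> : (\int[nu]_z (2 ^+ j * h j z `^ p)%:E = (2 ^+ j)%:E * Epow nu p (h j))%E.
      rewrite /Epow -ge0_integralZl ?lee_fin ?exprn_ge0 //; first exact: measurable_Epow.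
      by move=> z _; rewrite lee_fin powR_ge0.
    have e2 : (0 <= (2 ^+ j : R)%:E)%E by rewrite lee_fin exprn_ge0.
    apply: (le_trans (lee_wpmul2l e2 (hE j))); rewrite -EFinM lee_fin -exprMn.
    by rewrite le_eqVlt; apply/orP; left; apply/eqP; congr (_ ^+ _); field.
  by rewrite sumEFin lee_fin halves_sum_le.
have iT : nu.-integrable setT T.
  apply/integrableP; split => //; under eq_integral do rewrite gee0_abs //.
  by apply: le_lt_trans IT _; rewrite ltry.
have [N [mN N0 subN]] := integrable_ae measurableT iT.
exists (~` N); split; [exact: measurableC|by rewrite setCK|].
move=> z Nz; have Tfin : T z \is a fin_num.
  by apply: contrapT => Tz; apply: Nz; apply: subN => /(_ Logic.I).
exists (fine (T z) `^ p^-1) => [|j]; first exact: powR_ge0.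
have Fj : (F j z <= T z)%E.
  apply: le_trans (nneseries_lim_ge j.+1 (fun k _ _ => F0 k z)).
  by rewrite big_nat_recr //= leeDr // sume_ge0.
rewrite -(fineK Tfin) lee_fin mulrC -ler_pdivlMr ?exprn_gt0 // in Fj.
rewrite -[leLHS](powRVK p0 (h0 j z)).
have pV : 0 <= p^-1 by rewrite invr_ge0 ltW.
apply: (le_trans (powR_mono pV (powR_ge0 _ _) Fj)).
rewrite powRM ?fine_ge0 ?invr_ge0 ?exprn_ge0 // -exprVn ler_wpM2l ?powR_ge0 //.
by rewrite -!powR_mulrn ?powR_ge0 ?invr_ge0 // -!powRrM mulrC.
Unshelve. all: by end_near. Qed.

Lemma cvg_of_geometric_steps (a : nat -> R) t rho : 0 <= rho -> rho < 1 ->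
  (forall j, `|a j.+1 - a j| <= t * rho ^+ j) -> exists l : R, a @ \oo --> l.
Proof.
move=> r0 r1 ha; have t0 : 0 <= t by have := le_trans (normr_ge0 _) (ha 0%N); rewrite expr0 mulr1.
have cs : cvgn (series (telescope a)).
  apply: normed_cvg; apply: (@series_le_cvg _ _ (geometric t rho)).
  - by move=> j; exact: normr_ge0.
  - by move=> j; rewrite /geometric /= mulr_ge0 // exprn_ge0.
  - by move=> j; exact: ha.
  - by apply: is_cvg_geometric_series; rewrite ger0_norm.
move: cs => /cvg_ex[l hl]; exists (a 0%N + l).
have E : (fun j => a 0%N + series (telescope a) j) = a.
  by apply/funext => j; rewrite -eq_sum_telescope.
by rewrite -[X in X @ _ --> _]E; apply: cvgD => //; exact: cvg_cst.
Qed.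
End FastConvergence.

Section WeakGradientLimit.
Variables (R : realType) (n : nat) (p : R).
Local Notation V := 'rV[R]_n.
Local Notation mu := (muN R n).
Local Notation e_ i := (delta_mx ord0 i : V).
Implicit Types (f u psi b : V -> R) (g G : V -> V) (x y z : V) (E : set (rVB R n)) (la K eta : R).
Hypothesis p1 : 1 < p.
Let p0 : 0 < p. Proof. exact: lt_trans ltr01 p1. Qed.

(** Replacing gradients by 0 off a set of full measure turns almost everywhere convergence into
    convergence at every point, so the limit is measurable; weak gradients and energies are
    unaffected. *)
Definition restr E g x : V := (\1_E x : R) *: g x.

Lemma mfun_restr E g : measurable E -> mfun_vec g -> mfun_vec (restr E g).
Proof.
move=> mE mg i; rewrite /restr; under eq_fun do rewrite mxE.
by apply: measurable_funM; [exact: measurable_indic|exact: mg].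
Qed.

Lemma null_compl_ae E : measurable E -> mu (~` E) = 0%E -> {ae mu, forall x, E x}.
Proof. by move=> mE nE; exists (~` E); split => //; exact: measurableC. Qed.

Lemma indic_in E x : E x -> \1_E x = 1 :> R.
Proof. by move=> Ex; rewrite indicE mem_set. Qed.

Lemma Epow_restr E g G : measurable E -> mu (~` E) = 0%E -> mfun_vec g -> mfun_vec G ->
  (forall x, E x -> g x = G x) ->
  Epow mu p (fun x => eucl (g x)) = Epow mu p (fun x => eucl (G x)).
Proof.
move=> mE nE mg mG gG; apply: ge0_ae_eq_integral => //.
- by apply: measurable_Epow; exact: mfun_eucl.
- by apply: measurable_Epow; exact: mfun_eucl.
- by move=> x _; rewrite lee_fin powR_ge0.
- by move=> x _; rewrite lee_fin powR_ge0.
- by apply: (filterS _ (null_compl_ae mE nE)) => x Ex _; rewrite gG.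
Qed.

Lemma wgrad_restr E f g : measurable E -> mu (~` E) = 0%E -> wgrad f g -> wgrad f (restr E g).
Proof.
move=> mE nE [mg lg Hg]; have mr := mfun_restr mE mg.
split => [i|i|psi cp i]; first exact: mr.
  apply: (locint_le (mr i) (mg i)) => // x.
  by rewrite /restr mxE normrM indicE; case: (x \in E); rewrite ?normr1 ?normr0 ?mul1r ?mul0r.
rewrite Hg //; congr (- _); congr fine; apply: ae_eq_integral => //.
- apply/measurable_EFinP; apply: measurable_funM; [exact: mg|exact: Cc_inf_mfun].
- apply/measurable_EFinP; apply: measurable_funM; [exact: mr|exact: Cc_inf_mfun].
- by apply: (filterS _ (null_compl_ae mE nE)) => x Ex _; rewrite /restr mxE indic_in // mul1r.
Qed.

(** Beyond [la] one has [t / la >= 1], hence [t <= t * (t / la)^(p - 1)]. With the free parameter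
    [la] this replaces Hoelder's inequality when [L^p] bounds are tested against functions of
    compact support. *)
Lemma le_young la (t : R) : 0 < la -> 0 <= t -> t <= la + la `^ (1 - p) * t `^ p.
Proof.
move=> la0 t0; have [tl|lt] := leP t la.
  by rewrite (le_trans tl) // lerDl mulr_ge0 ?powR_ge0.
have tp : 0 < t by exact: lt_trans lt.
rewrite ler_wpDl ?(ltW la0) //.
have -> : la `^ (1 - p) * t `^ p = t * (t / la) `^ (p - 1).
  have e1 : la `^ (1 - p) = (la `^ (p - 1))^-1 by rewrite -powRN opprB.
  have e2 : t `^ p = t * t `^ (p - 1).
    have := @powRD _ t 1 (p - 1); rewrite addrC subrK (powRr1 (ltW tp)); apply.
    by rewrite (gt_eqF tp) implybT.
  by rewrite e1 e2 powR_div ?(ltW la0) // mulrC -!mulrA.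
rewrite ler_peMr //; have h : 1 <= t / la by rewrite ler_pdivlMr // mul1r ltW.
have q0 : 0 <= p - 1 by rewrite subr_ge0 ltW.
by have := powR_mono q0 ler01 h; rewrite powR1.
Qed.

Lemma locint_Epow g i : mfun_vec g -> (Epow mu p (fun x => eucl (g x)) < +oo)%E ->
  locint (fun x => g x ord0 i).
Proof.
move=> mg gE r; have meg := mfun_eucl mg.
apply: (@le_lt_trans _ _ (\int[mu]_x (ball_ind r x + eucl (g x) `^ p)%:E)%E).
  apply: ge0_le_integral => //.
  - by move=> x _; rewrite lee_fin; case: ifP.
  - by apply/measurable_EFinP; apply: measurable_restr_ball; exact: mg.
  - apply/measurable_EFinP; apply: measurable_funD; first exact: mfun_ball_ind.
    exact: (measurableT_comp (measurable_powR p) meg).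
  move=> x _; rewrite lee_fin /ball_ind; case: ifP => _; last by rewrite addr_ge0 ?powR_ge0.
  have := le_young ltr01 (eucl_ge0 (g x)); rewrite powR1 mul1r; apply: le_trans.
  exact: coord_le_eucl.
under eq_integral do rewrite EFinD.
rewrite ge0_integralD //; last 4 first.
- by move=> x _; rewrite lee_fin ball_ind_ge0.
- by apply/measurable_EFinP; exact: mfun_ball_ind.
- by move=> x _; rewrite lee_fin powR_ge0.
- exact: (measurable_Epow p meg).
apply: lte_add_pinfty; [exact: integral_ball_ind_lty|exact: gE].
Qed.

(** The pointwise bound [le_young], multiplied by [|psi|] and integrated. The parameter [la] can be
    fixed first, small against the integral of [|psi|], and [eta] afterwards. *)
Lemma wgrad_test_close g G psi i la M eta : mfun_vec g -> mfun_vec G ->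
  locint (fun x => g x ord0 i) -> locint (fun x => G x ord0 i) -> Cc_inf psi -> 0 < la ->
  (forall x, `|psi x| <= M) -> 0 <= M ->
  (Epow mu p (fun x => eucl (1 *: g x + (-1) *: G x)) <= eta%:E)%E ->
  `|\int[mu]_x (g x ord0 i * psi x) - \int[mu]_x (G x ord0 i * psi x)| <=
    la * \int[mu]_x `|psi x| + la `^ (1 - p) * M * eta.
Proof.
move=> mg mG lg lG cp la0 psiM M0 hE.
have i1 := integ_locint_Cc (mg i) lg cp; have i2 := integ_locint_Cc (mG i) lG cp.
have ip := integ_norm (integ_Cc_inf cp).
rewrite -(RintB i1 i2); set D := fun x => _ - _.
have iD : integ D by exact: integB.
have mdiff := mfun_vec_comb 1 (-1) mg mG; have mE := mfun_eucl mdiff.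
have c0 : 0 <= la `^ (1 - p) * M by rewrite mulr_ge0 ?powR_ge0.
rewrite -lee_fin; apply: (@le_trans _ _ (\int[mu]_x `|D x|%:E)%E).
  rewrite /Rintegral -abse_EFin fineK; last by apply: integrable_fin_num.
  by apply: le_abse_integral => //; apply/measurable_EFinP; exact: integ_mfun.
apply: (@le_trans _ _ (\int[mu]_x (la * `|psi x| +
    la `^ (1 - p) * M * eucl (1 *: g x + (-1) *: G x) `^ p)%:E)%E).
  have mpsi : mfun_rV (fun x => `|psi x|) by exact: integ_mfun.
  apply: ge0_le_integral => //.
  - by apply/measurable_EFinP; apply: measurableT_comp => //; exact: integ_mfun.
  - apply/measurable_EFinP; apply: measurable_funD; apply: measurable_funM;
    first [exact: measurable_cst|exact: mpsi|exact: (measurableT_comp (measurable_powR p) mE)].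
  move=> x _; rewrite lee_fin /D -mulrBl normrM.
  have h1 : `|g x ord0 i - G x ord0 i| <= eucl (1 *: g x + (-1) *: G x).
    by have := coord_le_eucl (1 *: g x + (-1) *: G x) i; rewrite !mxE mul1r mulN1r.
  apply: (le_trans (ler_wpM2r (normr_ge0 _) (le_trans h1 (le_young la0 (eucl_ge0 _))))).
  rewrite mulrDl lerD2l -[leRHS]mulrA [M * _]mulrC mulrA.
  by rewrite ler_wpM2l // mulr_ge0 ?powR_ge0.
under eq_integral do rewrite EFinD.
rewrite ge0_integralD //; last 4 first.
- by move=> x _; rewrite lee_fin mulr_ge0 // ltW.
- apply/measurable_EFinP; apply: measurable_funM; first exact: measurable_cst.
  exact: (integ_mfun ip).
- by move=> x _; rewrite lee_fin mulr_ge0 ?powR_ge0.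
- apply/measurable_EFinP; apply: measurable_funM; first exact: measurable_cst.
  exact: (measurableT_comp (measurable_powR p) mE).
rewrite EFinD; apply: leeD.
  have := RintZ la ip; rewrite /Rintegral => <-; rewrite fineK //.
  by apply: integrable_fin_num => //; exact: integZ.
under eq_integral do rewrite EFinM.
rewrite ge0_integralZl ?lee_fin //.
- by rewrite [leRHS]EFinM; apply: lee_wpmul2l.
- exact: (measurable_Epow p mE).
- by move=> x _; rewrite lee_fin powR_ge0.
Qed.

(** The envelope [b] is only continuous; multiplied by the test function it becomes an integrable
    dominating function. *)
Lemma Rintegral_cvg_bounded (u : nat -> V -> R) f b psi : (forall j, continuous (u j)) ->
  continuous b -> (forall j x, `|u j x| <= b x) -> (forall x, u ^~ x @ \oo --> f x) -> Cc_inf psi ->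
  (fun j => \int[mu]_x (u j x * psi x)) @ \oo --> \int[mu]_x (f x * psi x).
Proof.
move=> cu cb ub uf cp.
have mf : mfun_rV f.
  by apply: (@measurable_fun_cvg _ (rVB R n) R setT u f) => [j|x _]; [exact: continuous_measurable_rV|exact: uf].
have ib := integ_norm (integ_cont_Cc cb cp).
have fb x : `|f x| <= `|b x|.
  have L : (fun j => `|u j x|) @ \oo --> `|f x| by apply: cvg_norm; exact: uf.
  rewrite -(cvg_lim _ L) //; apply: limr_le; first by apply/cvg_ex; exists `|f x|.
  by near=> j; rewrite (le_trans (ub j x)) // ler_norm.
have if_ : integ (fun x => f x * psi x).
  apply: (integ_le _ ib); last by move=> x; rewrite !normrM ler_wpM2r.
  by apply: measurable_funM; [exact: mf|exact: Cc_inf_mfun].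
have C := @dominated_cvg _ _ R mu setT measurableT (fun j x => (u j x * psi x)%:E)
  (fun x => (f x * psi x)%:E) (fun x => `|b x * psi x|%:E) _ _ _ ib _.
apply: fine_cvg; rewrite fineK; last by apply: integrable_fin_num.
apply: C => //.
- by move=> j; apply/measurable_EFinP; apply: measurable_funM; [exact: continuous_measurable_rV|exact: Cc_inf_mfun].
- move=> x _; apply: cvg_EFin; first by near=> j.
  by apply: cvgMr_tmp; exact: uf.
- by move=> j x _; rewrite /= lee_fin !normrM ler_wpM2r // (le_trans (ub j x)) // ler_norm.
Unshelve. all: by end_near. Qed.

Lemma wgrad_limit (u : nat -> V -> R) (g : nat -> V -> V) f b G : (forall j, continuous (u j)) ->
  continuous b -> (forall j x, `|u j x| <= b x) -> (forall x, u ^~ x @ \oo --> f x) ->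
  (forall j, wgrad (u j) (g j)) -> mfun_vec G -> (Epow mu p (fun x => eucl (G x)) < +oo)%E ->
  (forall eta, 0 < eta -> exists M, forall j, (M <= j)%N ->
    (Epow mu p (fun x => eucl (1 *: g j x + (-1) *: G x)) <= eta%:E)%E) ->
  wgrad f G.
Proof.
move=> cu cb ub uf wg mG GE cG; have lG i := locint_Epow i mG GE.
split => // psi cp i.
have L1 := Rintegral_cvg_bounded cu cb ub uf (Cc_inf_derive (e_ i) cp).
suff L2 : (fun j => \int[mu]_x (u j x * derive psi x (e_ i))) @ \oo --> - \int[mu]_x (G x ord0 i * psi x).
  by rewrite -(cvg_lim _ L1) // -(cvg_lim _ L2).
apply/cvgrPdist_le => /= e e0.
have [M M0 psiM] := Cc_inf_bounded cp; pose I := \int[mu]_x `|psi x|.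
have I0 : 0 <= I by apply: Rintegral_ge0.
(* [la] and the tolerance [e / 2 / (c + 1)] give each term of [wgrad_test_close] at most half of
   [e]; the [+ 1] covers [I = 0] and [c = 0]. *)
pose la := e / 2 / (I + 1); have la0 : 0 < la by rewrite !divr_gt0 // ltr_wpDl.
pose c := la `^ (1 - p) * M; have c0 : 0 <= c by rewrite mulr_ge0 ?powR_ge0.
have eta0 : 0 < e / 2 / (c + 1) by rewrite !divr_gt0 // ltr_wpDl.
have [J HJ] := cG _ eta0; exists J => // j /= Jj.
have [mg lg Hg] := wg j; rewrite Hg // -opprB normrN opprK addrC.
have := wgrad_test_close mg mG (lg i) (lG i) cp la0 psiM M0 (HJ j Jj).
rewrite -normrN opprB => h; rewrite (le_trans h) //.
have h1 : la * I <= e / 2.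
  by rewrite /la mulrAC ler_pdivrMr ?ltr_wpDl // ler_wpM2l ?lerDl // ltW // divr_gt0.
have h2 : c * (e / 2 / (c + 1)) <= e / 2.
  by rewrite mulrA ler_pdivrMr ?ltr_wpDl // mulrC ler_wpM2l ?lerDl // ltW // divr_gt0.
by rewrite [leRHS](splitr e) lerD.
Qed.

Lemma eucl_cvg (a : nat -> V) (l : V) : (forall i, (fun j => a j ord0 i) @ \oo --> l ord0 i) ->
  (fun j => eucl (a j)) @ \oo --> eucl l.
Proof.
move=> al; rewrite /eucl; apply: continuous_cvg; first exact: sqrt_continuous.
elim: (index_enum _) => [|i r IH].
  by rewrite big_nil; under eq_fun do rewrite big_nil; exact: cvg_cst.
rewrite big_cons; under eq_fun do rewrite big_cons; apply: cvgD => //.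
by rewrite expr2; under eq_fun do rewrite expr2; apply: cvgM; exact: al.
Qed.

(** The argument of Riesz and Fischer: along a subsequence with steps of energy at most [4^(- j)],
    [fast_convergence] gives geometric decay of the increments off a null set. *)
Lemma lp_limit (g : nat -> V -> V) : (forall j, mfun_vec (g j)) ->
  (forall eta, 0 < eta -> exists M, forall j k, (M <= j)%N -> (M <= k)%N ->
    (Epow mu p (fun x => eucl (1 *: g j x + (-1) *: g k x)) <= eta%:E)%E) ->
  exists (sg : nat -> nat) E G, [/\ forall j, (j <= sg j)%N, measurable E, mu (~` E) = 0%E, mfun_vec G &
    forall x i, (fun j => restr E (g (sg j)) x ord0 i) @ \oo --> G x ord0 i].
Proof.
move=> mg cau.
have /choice[M HM] : forall j : nat, exists M, forall k l, (M <= k)%N -> (M <= l)%N ->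
    (Epow mu p (fun x => eucl (1 *: g k x + (-1) *: g l x)) <= (4^-1 ^+ j)%:E)%E.
  by move=> j; apply: cau; rewrite exprn_gt0 // invr_gt0.
(* The sum dominates every [M k] with [k <= j], and the summand [j] makes the indices tend to
   infinity. *)
pose sg j := (j + \sum_(0 <= k < j.+1) M k)%N.
have Msg j l : (j <= l)%N -> (M j <= sg l)%N.
  move=> jl; rewrite /sg (leq_trans _ (leq_addl _ _)) //.
  by rewrite (big_cat_nat (n := j.+1)) //= big_nat_recr //= -addnA addnCA leq_addr.
pose h j x := eucl (1 *: g (sg j) x + (-1) *: g (sg j.+1) x).
have [||| E [mE nE HE]] := @fast_convergence _ _ R mu p h p0.
- by move=> j; apply: mfun_eucl; exact: mfun_vec_comb.
- by move=> j x; exact: eucl_ge0.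
- by move=> j; apply: HM; apply: Msg.
have cv x : exists l : V, forall i, (fun j => restr E (g (sg j)) x ord0 i) @ \oo --> l ord0 i.
  have : forall i, exists l : R, (fun j => restr E (g (sg j)) x ord0 i) @ \oo --> l.
    move=> i; have [Ex|nEx] := pselect (E x); last first.
      exists 0; rewrite /restr; under eq_fun do rewrite mxE indicE memNset // mul0r.
      exact: cvg_cst.
    have [t t0 ht] := HE x Ex.
    apply: (@cvg_of_geometric_steps _ _ t (2^-1 `^ p^-1)); first exact: powR_ge0.
      have := @gt0_ltr_powR R p^-1; rewrite invr_gt0 => /(_ p0 2^-1 1).
      by rewrite powR1; apply; rewrite ?nnegrE ?invr_ge0 ?invf_lt1 // ltr1n.
    move=> j; rewrite (le_trans _ (ht j)) // /restr !mxE indic_in // !mul1r distrC.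
    by have := coord_le_eucl (1 *: g (sg j) x + (-1) *: g (sg j.+1) x) i; rewrite !mxE mul1r mulN1r.
  by move=> /choice[l hl]; exists (\row_i l i) => i; rewrite mxE.
have /choice[G HG] := cv.
exists sg, E, G; split => //; first by move=> j; exact: leq_addr.
move=> i; apply: (@measurable_fun_cvg _ (rVB R n) R setT (fun j x => restr E (g (sg j)) x ord0 i)).
  by move=> j; exact: mfun_restr.
by move=> x _; exact: HG.
Qed.
End WeakGradientLimit.

(** * Existence of a minimiser *)

Section HolderCompactness.
Variables (R : realType) (n : nat).
Local Notation V := 'rV[R]_n.
Implicit Types (f : V -> R) (x y z w : V) (al e : R).

(** Along an ultrafilter a cluster point is a limit: the preimage of a neighbourhood or its
    complement belongs to the filter. *)
Lemma ultra_cvg (T : topologicalType) (A : set T) (U : set_system nat) (u : nat -> T) :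
  UltraFilter U -> compact A -> (forall k, A (u k)) -> exists2 l, A l & u @ U --> l.
Proof.
move=> UU cA Au; have UP : ProperFilter U by exact: ultra_proper.
have UA : U (u @^-1` A) by apply: filterS filterT => k _; exact: Au.
have [l [Al cl]] := cA (u @ U) _ UA.
exists l => // B Bl; have [//|UB] := in_ultra_setVsetC (u @^-1` B) UU.
by have [x [nBx Bx]] := cl (~` B) B UB Bl.
Qed.

(** An enumeration of a countable dense set; numbers that code no rational vector give the
    origin. *)
Definition rational_point (j : nat) : V := map_mx ratr (odflt 0 (unpickle j : option 'rV[rat]_n)).

Lemma rational_point_dense x e : 0 < e -> exists j, eucl (x - rational_point j) <= e.
Proof.
move=> e0; have c0 : 0 < e / (n%:R + 1) by rewrite divr_gt0 // ltr_wpDl.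
have /choice[q hq] : forall i : 'I_n, exists q : rat, `|x ord0 i - ratr q| <= e / (n%:R + 1).
  move=> i; have lt : x ord0 i - e / (n%:R + 1) < x ord0 i + e / (n%:R + 1).
    by rewrite ltrD2l gt0_cp.
  have [q] := rat_in_itvoo lt; rewrite in_itv /= => /andP[h1 h2].
  by exists q; rewrite ler_distl; apply/andP; split; rewrite ltW // -?ltrBlDr ?ltrBlDr // -ltrBlDr.
exists (pickle (\row_i q i)); rewrite /rational_point pickleK /=.
rewrite (le_trans (eucl_le_sum _)) // (le_trans (sumr_le_natmul (b := e / (n%:R + 1)) _)) //.
  by move=> i; rewrite !mxE.
by rewrite mulrCA ler_piMr ?(ltW e0) // ler_pdivrMr ?ltr_wpDl // mul1r lerDl.
Qed.

(** A single ultrafilter defines the limit at all points at once, in place of a diagonal extraction.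
    A sequence of indices is then read off by matching the limit at stage [m] on the first [m]
    rational points, and the common Hoelder bound extends the convergence to every point. *)
Lemma holder_compactness al (F : nat -> V -> R) (om : nat -> V) : 0 < al ->
  (forall k, holder_le al 1 (F k)) -> (forall k, F k 0 = 0) -> (forall k, eucl (om k) <= 1) ->
  exists (sg : nat -> nat) f w, [/\ forall m, (m <= sg m)%N,
    forall x, (fun m => F (sg m) x) @ \oo --> f x, holder_le al 1 f &
    (fun m => eucl (om (sg m) - w)) @ \oo --> (0 : R)].
Proof.
move=> al0 hF F0 hom.
have [U [UU oU]] := ultraFilterLemma (@eventually_filter : ProperFilter \oo).
have UP : ProperFilter U by exact: ultra_proper.
have /choice[f hf] : forall x, exists l : R, (fun k => F k x) @ U --> l.
  move=> x; have [||l _ hl] := @ultra_cvg R `[- (eucl x `^ al), eucl x `^ al] U (fun k => F k x) UU.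
  - exact: segment_compact.
  - by move=> k; rewrite /= in_itv /= -ler_norml; have := hF k x 0; rewrite F0 !subr0 mul1r.
  by exists l.
have [w _ hw] := ultra_cvg UU (@compact_euclid_ball R n 1) hom.
have near_f x e : 0 < e -> U [set k | `|F k x - f x| <= e].
  by move=> e0; have /cvgrPdist_le/(_ e e0) := hf x; apply: filterS => k; rewrite /= distrC.
have near_w e : 0 < e -> U [set k | eucl (om k - w) <= e].
  move=> e0; have n0 : 0 < (n%:R + 1 : R) by rewrite ltr_wpDl.
  have : U (om @^-1` ball w (e / (n%:R + 1))) by apply: hw; apply: nbhsx_ballx; rewrite divr_gt0.
  apply: filterS => k; rewrite /= mx_norm_ball /ball_ /= => h.
  rewrite euclB_sym (le_trans (eucl_le_norm _)) //.
  have := ltW h; rewrite ler_pdivlMr // mulrC; apply: le_trans.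
  by rewrite ler_wpM2r // lerDl.
have hfl : holder_le al 1 f.
  move=> x y; apply/ler_addgt0Pl => e e0; have e2 : 0 < e / 2 by rewrite divr_gt0.
  have [k [kx ky]] := filter_ex (filterI (near_f x _ e2) (near_f y _ e2)).
  have -> : f x - f y = (F k x - F k y) + ((F k y - f y) - (F k x - f x)) by ring.
  rewrite (le_trans (ler_normD _ _)) // addrC lerD ?hF //.
  by rewrite [leRHS](splitr e) (le_trans (ler_normB _ _)) // lerD.
have inv0 m : 0 < (m.+1%:R^-1 : R) by rewrite invr_gt0.
have /choice[sg hsg] : forall m, exists k, [/\ (m <= k)%N, eucl (om k - w) <= m.+1%:R^-1 &
    forall j, (j < m)%N -> `|F k (rational_point j) - f (rational_point j)| <= m.+1%:R^-1].
  move=> m.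
  have fin q : U [set k | forall j, (j < q)%N ->
      `|F k (rational_point j) - f (rational_point j)| <= m.+1%:R^-1].
    elim: q => [|q IH]; first by apply: filterE.
    apply: (filterS _ (filterI IH (near_f (rational_point q) _ (inv0 m)))) => i [h1 h2] j.
    by rewrite ltnS leq_eqVlt => /orP[/eqP -> //|]; exact: h1.
  have ge : U [set k | (m <= k)%N] by apply: oU; exact: nbhs_infty_ge.
  have [i [[i1 i2] i3]] := filter_ex (filterI (filterI ge (near_w _ (inv0 m))) (fin m)).
  by exists i.
exists sg, f, w; split => //; first by move=> m; have [] := hsg m.
- move=> x; apply/cvgrPdist_le => /= e e0.
  have e4 : 0 < e / 4 by rewrite divr_gt0.
  have d0 : 0 < (e / 4) `^ al^-1 by rewrite powR_gt0.
  have [j hj] := rational_point_dense x d0.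
  have hj' : eucl (x - rational_point j) `^ al <= e / 4.
    by have := powR_mono (ltW al0) (eucl_ge0 _) hj; rewrite powRK // ltW.
  near=> m; have [_ _ hm] := hsg m.
  have jm : (j < m)%N by near: m; exact: nbhs_infty_gt.
  have me : m.+1%:R^-1 <= e / 4.
    by near: m; apply: (cvgr_le _ (@cvg_harmonic R)).
  set q := rational_point j in hj hj' hm *.
  have -> : f x - F (sg m) x = (f x - f q) - (F (sg m) x - F (sg m) q) - (F (sg m) q - f q) by ring.
  have -> : e = e / 4 + e / 4 + (e / 4 + e / 4) by field.
  have b1 := le_trans (hfl x q); rewrite mul1r in b1.
  have b2 := le_trans (hF (sg m) x q); rewrite mul1r in b2.
  rewrite (le_trans (ler_normB _ _)) // lerD //; last by rewrite (le_trans (hm j jm)) // ler_wpDr // ltW.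
  by rewrite (le_trans (ler_normB _ _)) // lerD //; [exact: b1|exact: b2].
- apply: (squeeze_cvgr _ (cvg_cst 0) (@cvg_harmonic R)); near=> m.
  by rewrite eucl_ge0 /=; have [] := hsg m.
Unshelve. all: by end_near. Qed.
End HolderCompactness.

(** * The normalised minimising sequence and its limit *)

Section Minimizer.
Variables (R : realType) (n : nat) (s p : R).
Local Notation V := 'rV[R]_n.
Local Notation mu := (muN R n).
Implicit Types (f u : V -> R) (g : V -> V) (x y z w : V) (e eta tau : R) (v : \bar R).
Hypotheses (n1 : (1 <= n)%N) (s0 : 0 < s) (sle1 : s <= 1) (p1 : 1 < p) (nsp : n%:R < s * p).
Let p0 : 0 < p. Proof. exact: lt_trans ltr01 p1. Qed.
Let alpha := alpha_sp n s p.
Let a0 : 0 < alpha.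
Proof. by rewrite /alpha /alpha_sp subr_gt0 ltr_pdivrMr. Qed.
Let I : R := fine (inf_calW n s p).
Let IE : inf_calW n s p = I%:E.
Proof. by rewrite /I fineK // ge0_fin_numE ?inf_calW_ge0 // inf_calW_lty. Qed.
Let I0 : 0 <= I. Proof. by rewrite fine_ge0 // inf_calW_ge0. Qed.

(** A nearly optimal pair at distance [D] is moved to 0 and a unit vector by [z -> D z + y], and
    values are divided by [D^alpha]. The energy is unchanged because [alpha p = s p - n]. *)
Lemma near_minimizer e : 0 < e -> exists f w v, [/\ holder_le alpha 1 f, f 0 = 0, eucl w = 1,
  1 - e <= f w & has_energy s p f v /\ (v <= (I + e)%:E)%E].
Proof.
move=> e0.
have [v [f [[cf _] [hf Wv]]] ve] : exists2 v, (exists f, calW s p f /\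
    holder_semi alpha f = 1%E /\ Wsp_val s p f v) & (v < (I + e)%:E)%E.
  have fin : inf_calW n s p \is a fin_num by rewrite IE.
  by have [v hv lv] := lb_ereal_inf_adherent e0 fin; exists v; rewrite // EFinD -IE.
have fv : has_energy s p f v by exact/(Wsp_valP s p1 v cf).
have hl : holder_le alpha 1 f by apply: holder_semi_fin; rewrite ?hf.
(* Exchanging the two points if necessary makes the increment nonnegative. A fixed sign is essential
   when two such functions are averaged. *)
have [x [y [xy hxy]]] : exists x y, x != y /\ (1 - e) * eucl (x - y) `^ alpha <= f x - f y.
  have [x [y [xy h]]] := near_optimal_pair hf e0.
  have [fxy|fyx] := leP 0 (f x - f y); first by exists x, y; rewrite -(ger0_norm fxy).
  exists y, x; rewrite eq_sym euclB_sym; split => //.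
  by rewrite -[f y - f x]opprB -(ltr0_norm fyx).
pose D := eucl (x - y); have D0 : 0 < D by rewrite eucl_subr_gt0.
pose b := (D `^ alpha)^-1; have b0 : 0 < b by rewrite invr_gt0 powR_gt0.
have cfa : continuous (fun z => f (D *: z + y)) by exact: continuous_comp_affine.
have fE := has_energyZ b (f y) cfa (has_energy_affine p1 y D0 cf fv).
exists (fun z => b * (f (D *: z + y) - f y)), (D^-1 *: (x - y)), v; split.
- move=> z1 z2; rewrite -mulrBr opprB addrA subrK normrM (gtr0_norm b0) mul1r.
  have := hl (D *: z1 + y) (D *: z2 + y).
  rewrite opprD addrACA subrr addr0 -scalerBr euclZ (gtr0_norm D0) mul1r.
  rewrite powRM ?(ltW D0) ?eucl_ge0 // => h.
  have DD := powR_gt0 alpha D0.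
  by rewrite /b (ler_pdivrMl _ _ DD); exact: h.
- by rewrite scaler0 add0r subrr mulr0.
- by rewrite euclZ ger0_norm ?invr_ge0 ?(ltW D0) // mulVf // gt_eqF.
- rewrite scalerA divff ?gt_eqF // scale1r subrK /b mulrC ler_pdivlMr ?powR_gt0 //.
split; last exact: ltW.
rewrite (gtr0_norm b0) muleA -EFinM in fE.
suff E : b `^ p * D `^ (s * p - n%:R) = 1 by rewrite E mul1e in fE.
rewrite /b -powRN -powRrM -powRD; last by rewrite (gt_eqF D0) implybT.
by rewrite (_ : _ + _ = 0) ?powRr0 // /alpha /alpha_sp; field; rewrite gt_eqF.
Qed.

(** Both functions vanish at 0 and are close to 1 at the same [w], so their midpoint keeps an
    increment of at least [1 - tau]. Near-extremality at different pairs would not survive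
    averaging. *)
Lemma midpoint_energy f1 f2 g1 g2 w tau : s = 1 -> holder_le alpha 1 f1 -> holder_le alpha 1 f2 ->
  f1 0 = 0 -> f2 0 = 0 -> eucl w = 1 -> tau < 1 -> 1 - tau <= f1 w -> 1 - tau <= f2 w ->
  wgrad f1 g1 -> wgrad f2 g2 ->
  (((1 - tau) `^ p * I)%:E <= Epow mu p (fun x => eucl (2^-1 *: g1 x + 2^-1 *: g2 x)))%E.
Proof.
move=> sE h1 h2 f10 f20 w1 t1 f1w f2w wg1 wg2.
have c1 := holder_continuous a0 h1; have c2 := holder_continuous a0 h2.
have w0 : w != 0 by rewrite -eucl_gt0 w1 ltr01.
rewrite EFinM -IE; apply: (@inf_calW_le_energy R n s p p1 nsp (fun x => 2^-1 * f1 x + 2^-1 * f2 x) 1 _ w 0) => //.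
- move=> x y.
  have -> : 2^-1 * f1 x + 2^-1 * f2 x - (2^-1 * f1 y + 2^-1 * f2 y) =
      2^-1 * (f1 x - f1 y) + 2^-1 * (f2 x - f2 y) by ring.
  rewrite (le_trans (ler_normD _ _)) // !normrM ger0_norm ?invr_ge0 // -mulrDr.
  rewrite mulrC ler_pdivrMr // mulr_natr mulr2n; exact: lerD.
- by rewrite /has_energy sE eqxx; exists (fun x => 2^-1 *: g1 x + 2^-1 *: g2 x) => //; exact: wgrad_comb.
- by rewrite subr_gt0.
- rewrite f10 f20 !mulr0 addr0 !subr0 w1 powR1 mulr1 (le_trans _ (ler_norm _)) //; lra.
Qed.

(** The term [C (K - L)] of [Epow_uniform_convexity] with [K = I + tau] and [L = (1 - tau)^p I],
    both of which tend to [I]. The choice [tau = 1 / (k + 2)] keeps [tau < 1]. *)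
Lemma small_defect (C eta : R) : 0 <= C -> 0 < eta ->
  exists2 tau, 0 < tau < 1 & C * (I + tau - (1 - tau) `^ p * I) <= eta.
Proof.
move=> C0 eta0.
have hk : (fun k : nat => (k.+2)%:R^-1 : R) @ \oo --> (0 : R).
  have := @cvg_harmonic R; rewrite -(cvg_shiftn 1).
  by under eq_fun do rewrite /= addn1.
have hp : (fun k : nat => (1 - (k.+2)%:R^-1) `^ p) @ \oo --> (1 : R).
  have := @cvg_powR R p (fun k : nat => 1 - (k.+2)%:R^-1) 1 p0; rewrite powR1; apply.
    by move=> k; rewrite subr_ge0 invf_le1 // ler1n.
  by rewrite -[X in _ --> X]subr0; apply: cvgB => //; exact: cvg_cst.
have L : (fun k : nat => C * (I + (k.+2)%:R^-1 - (1 - (k.+2)%:R^-1) `^ p * I)) @ \oo -->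
    C * (I + 0 - 1 * I).
  apply: cvgMl_tmp; apply: cvgB; last exact: cvgMr_tmp.
  by apply: cvgD => //; exact: cvg_cst.
rewrite addr0 mul1r subrr mulr0 in L.
have [k hk'] : exists k : nat, C * (I + (k.+2)%:R^-1 - (1 - (k.+2)%:R^-1) `^ p * I) <= eta.
  by apply: (@filter_ex _ \oo); apply: (cvgr_le _ L).
by exists (k.+2)%:R^-1 => //; rewrite invr_gt0 ltr0n /= invf_lt1 ?ltr1n // ltr0n.
Qed.

Lemma energy_limit (F : nat -> V -> R) f w (E : nat -> \bar R) :
  (forall j, holder_le alpha 1 (F j)) -> (forall j, F j 0 = 0) ->
  (forall j, has_energy s p (F j) (E j)) -> (forall j, (E j <= (I + j.+1%:R^-1)%:E)%E) ->
  (forall x, F ^~ x @ \oo --> f x) -> holder_le alpha 1 f -> eucl w = 1 -> 1 <= f w ->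
  exists2 v, has_energy s p f v & (v <= I%:E)%E.
Proof.
move=> hF F0 FE EI Ff hf w1 fw.
have cF j := holder_continuous a0 (hF j); have cf := holder_continuous a0 hf.
have inv_small e : 0 < e -> exists M, forall j, (M <= j)%N -> j.+1%:R^-1 <= e.
  move=> e0; have [M _ HM] : \forall j \near \oo, (j.+1%:R^-1 : R) <= e.
    by apply: (cvgr_le _ (@cvg_harmonic R)).
  by exists M.
move: FE; rewrite /has_energy; case: eqP => [sE|_] FE; last first.
  exists (Epow (muP R n) p (gquot s p f)) => //.
  apply/lee_addgt0Pr => e e0.
  apply: (@Epow_fatou _ _ R (muP R n) p (fun m => gquot s p (F m))) => //.
  - by move=> m; apply: mfun_gquot; exact: continuous_measurable_rV.
  - by move=> m; exact: gquot_ge0.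
  - move=> z; rewrite /gquot; apply: cvgMr_tmp; apply: cvg_norm; apply: cvgB; exact: Ff.
  move=> m0; have [M HM] := inv_small e e0; exists (maxn m0 M); first exact: leq_maxl.
  rewrite -FE; apply: (le_trans (EI _)); rewrite lee_fin lerD2l; apply: HM; exact: leq_maxr.
have /choice[g hg] : forall j, exists g, wgrad (F j) g /\ E j = Epow mu p (fun x => eucl (g x)).
  by move=> j; have [g wg Eg] := FE j; exists g.
have wg j : wgrad (F j) (g j) by have [] := hg j.
have Eg j : (Epow mu p (fun x => eucl (g j x)) <= (I + j.+1%:R^-1)%:E)%E.
  by have [_ <-] := hg j.
have mg j : mfun_vec (g j) by have [] := wg j.
have cau eta : 0 < eta -> exists M, forall j k, (M <= j)%N -> (M <= k)%N ->
    (Epow mu p (fun x => eucl (1 *: g j x + (-1) *: g k x)) <= eta%:E)%E.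
  (* Energies are at most [I + 1], so this parameter makes the first term [2 eta' (I + 1)] of the
     convexity estimate equal to [eta / 2]; [small_defect] provides the other half. *)
  move=> eta0; have eta10 : 0 < eta / (4 * (I + 1)) by rewrite divr_gt0 // mulr_gt0 // ltr_wpDl.
  have [C C0 HC] := @Epow_uniform_convexity R n p p1 _ eta10.
  have eta2 : 0 < eta / 2 by rewrite divr_gt0.
  have [tau /andP[t0 t1] ht] := small_defect C0 eta2.
  have [M1 HM1] := inv_small tau t0.
  have [M2 _ HM2] : \forall j \near \oo, 1 - tau <= F j w.
    by apply: (cvgr_ge _ (Ff w)); rewrite (lt_le_trans _ fw) // gtrBl.
  exists (maxn M1 M2) => j k; rewrite !geq_max => /andP[j1 j2] /andP[k1 k2].
  have hK i : (M1 <= i)%N -> (Epow mu p (fun x => eucl (g i x)) <= (I + tau)%:E)%E.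
    by move=> hi; apply: (le_trans (Eg i)); rewrite lee_fin lerD2l HM1.
  have mid := midpoint_energy sE (hF j) (hF k) (F0 j) (F0 k) w1 t1 (HM2 j j2) (HM2 k k2) (wg j) (wg k).
  apply: (le_trans (HC _ _ _ _ (mg j) (mg k) (hK j j1) (hK k k1) mid)); rewrite lee_fin.
  rewrite [leRHS](splitr eta) lerD //.
  have -> : eta / 2 = 2 * (eta / (4 * (I + 1))) * (I + 1).
    by field; rewrite gt_eqF // ltr_wpDl.
  by rewrite ler_wpM2l ?lerD2l ?(ltW t1) // mulr_ge0 // ltW.
have [sg [N [G [hsg mN nN mG cG]]]] := @lp_limit R n p p1 g mg cau.
pose gt j := restr N (g (sg j)).
have mgt j : mfun_vec (gt j) by exact: mfun_restr.
have gtE j x : N x -> gt j x = g (sg j) x by move=> Nx; rewrite /gt /restr indic_in // scale1r.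
have GE e : 0 < e -> (Epow mu p (fun x => eucl (G x)) <= (I + e)%:E)%E.
  move=> e0; apply: (@Epow_fatou _ _ R mu p (fun m x => eucl (gt m x))) => //.
  - by move=> m; exact: (mfun_eucl (mgt m)).
  - by move=> m x; exact: eucl_ge0.
  - by move=> x; apply: eucl_cvg => i; exact: cG.
  move=> m0; have [M HM] := inv_small e e0; exists (maxn m0 M); first exact: leq_maxl.
  rewrite (Epow_restr p mN nN (mgt _) (mg (sg (maxn m0 M)))); last by move=> x; exact: gtE.
  apply: (le_trans (Eg _)); rewrite lee_fin lerD2l; apply: HM.
  exact: leq_trans (leq_maxr m0 M) (hsg _).
have Gfin : (Epow mu p (fun x => eucl (G x)) < +oo)%E.
  by apply: le_lt_trans (GE 1 ltr01) _; rewrite ltry.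
exists (Epow mu p (fun x => eucl (G x))); last by apply/lee_addgt0Pr => e e0; rewrite -EFinD; exact: GE.
exists G => //.
(* The functions [F j] vanish at 0 and are 1-Hoelder, so [|x|^alpha] is a common envelope. The
   absolute value brings it into the form of [continuous_norm_powR]. *)
have cb : continuous (fun x : V => `|eucl x| `^ alpha).
  move=> x; apply: (@continuous_comp _ _ _ (@eucl R n) (fun t => `|t| `^ alpha)).
    exact: continuous_eucl.
  exact: continuous_norm_powR.
apply: (wgrad_limit p1 (fun j => cF (sg j)) cb _ _ (fun j => wgrad_restr mN nN (wg (sg j))) mG Gfin).
- by move=> j x; rewrite [`|eucl x|]ger0_norm ?eucl_ge0 //; have := hF (sg j) x 0; rewrite F0 !subr0 mul1r.
- move=> x; apply/cvgrPdist_le => /= e e0; have /cvgrPdist_le /(_ e e0) [M _ HM] := Ff x.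
  by exists M => // j /= Mj; apply: HM => /=; exact: leq_trans Mj (hsg j).
(* With [j] fixed, Fatou's lemma in the second index turns the Cauchy estimate into an estimate
   against the limit [G]. *)
move=> eta eta0; have [M HM] := cau eta eta0; exists M => j Mj.
apply: (@Epow_fatou _ _ R mu p (fun m x => eucl (1 *: gt j x + (-1) *: gt m x))) => //.
- by move=> m; exact: (mfun_eucl (mfun_vec_comb 1 (-1) (mgt j) (mgt m))).
- by move=> m x; exact: eucl_ge0.
- move=> x; apply: eucl_cvg => i.
  have coordE (a b : V) : (1 *: a + (-1) *: b) ord0 i = 1 * a ord0 i + (-1) * b ord0 i by rewrite !mxE.
  rewrite coordE; under eq_fun do rewrite coordE.
  by apply: cvgD; [exact: cvg_cst|apply: cvgMl_tmp; exact: cG].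
move=> m0; exists (maxn m0 M); first exact: leq_maxl.
rewrite (Epow_restr p mN nN (mfun_vec_comb 1 (-1) (mgt j) (mgt _))
  (mfun_vec_comb 1 (-1) (mg (sg j)) (mg (sg (maxn m0 M))))); last by move=> x Nx; rewrite !gtE.
apply: HM; first exact: leq_trans Mj (hsg j).
exact: leq_trans (leq_maxr m0 M) (hsg _).
Qed.

Lemma minimizer_exists : exists f v, calW s p f /\ holder_semi alpha f = 1%E /\ Wsp_val s p f v /\
  v = inf_calW n s p.
Proof.
have inv0 k : 0 < (k.+1%:R^-1 : R) by rewrite invr_gt0.
have /choice[F hF1] : forall k : nat, exists f, exists w v, [/\ holder_le alpha 1 f, f 0 = 0, eucl w = 1,
    1 - k.+1%:R^-1 <= f w & has_energy s p f v /\ (v <= (I + k.+1%:R^-1)%:E)%E].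
  by move=> k; exact: near_minimizer.
have /choice[om hF2] := hF1; have /choice[E hF] := hF2.
have Fh k : holder_le alpha 1 (F k) by have [] := hF k.
have F0 k : F k 0 = 0 by have [] := hF k.
have om1 k : eucl (om k) = 1 by have [] := hF k.
have Fom k : 1 - k.+1%:R^-1 <= F k (om k) by have [] := hF k.
have FE k : has_energy s p (F k) (E k) by have [_ _ _ _ []] := hF k.
have EI k : (E k <= (I + k.+1%:R^-1)%:E)%E by have [_ _ _ _ []] := hF k.
have om1' k : eucl (om k) <= 1 by rewrite om1.
have [sg [f [w [hsg cf hf cw]]]] := holder_compactness a0 Fh F0 om1'.
have inv_le m : ((sg m).+1%:R^-1 : R) <= m.+1%:R^-1.
  by rewrite lef_pV2 ?posrE ?ltr0n // ler_nat ltnS.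
have w1 : eucl w = 1.
  apply/eqP; rewrite eq_sym -subr_eq0 -normr_le0.
  rewrite -(cvg_lim _ cw) //; apply: limr_ge; first by apply/cvg_ex; exists 0.
  by near=> m; rewrite -(om1 (sg m)) ler_dist_eucl.
have f0 : f 0 = 0.
  rewrite -(cvg_lim _ (cf 0)) //; under eq_fun do rewrite F0.
  by apply: cvg_lim => //; exact: cvg_cst.
(* The unit vectors vary with the index; replacing [om (sg m)] by its limit [w] costs at most
   [|om (sg m) - w|^alpha] by the common Hoelder bound. *)
have fw : 1 <= f w.
  have L : (fun m => F (sg m) w + eucl (om (sg m) - w) `^ alpha + m.+1%:R^-1) @ \oo --> f w + 0 + 0.
    apply: cvgD; last exact: cvg_harmonic.
    apply: cvgD; first exact: cf.
    have := cvg_powR a0 (fun m => eucl_ge0 (om (sg m) - w)) cw; by rewrite powR0 // gt_eqF.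
  rewrite !addr0 in L; rewrite -(cvg_lim _ L) //.
  apply: limr_ge; first by apply/cvg_ex; exists (f w).
  near=> m; rewrite -lerBlDr (le_trans _ (_ : F (sg m) (om (sg m)) <= _)) //.
    by rewrite (le_trans _ (Fom _)) // lerB.
  rewrite addrC -lerBlDr; have := Fh (sg m) (om (sg m)) w; rewrite mul1r; apply: le_trans.
  exact: ler_norm.
have EI' m : (E (sg m) <= (I + m.+1%:R^-1)%:E)%E.
  by apply: (le_trans (EI (sg m))); rewrite lee_fin lerD2l.
have [v fv vI] := @energy_limit (fun m => F (sg m)) f w (fun m => E (sg m)) (fun m => Fh _)
  (fun m => F0 _) (fun m => FE _) EI' cf hf w1 fw.
have cof := holder_continuous a0 hf.
have h1 : holder_semi alpha f = 1%E.
  apply/eqP; rewrite eq_le; apply/andP; split; first exact: holder_semi_le.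
  have w0 : w != 0 by rewrite -eucl_gt0 w1 ltr01.
  apply: le_trans (holder_semi_ge alpha f w0).
  by rewrite lee_fin f0 !subr0 w1 powR1 divr1 (le_trans fw) // ler_norm.
have Wv : Wsp_val s p f v by exact/(Wsp_valP s p1 v cof).
have calf : calW s p f.
  split => //; split; first by rewrite h1 ltry.
  by exists v; split => //; apply: le_lt_trans vI _; rewrite ltry.
exists f, v; split => //; split => //; split => //.
apply/eqP; rewrite eq_le; apply/andP; split; first by rewrite IE.
by apply: ereal_inf_lbound; exists f.
Unshelve. all: by end_near. Qed.
End Minimizer.

Theorem theorem6p1 (R : realType) (N : nat) (s p : R) :
  (1 <= N)%N -> 0 < s -> s <= 1 -> 1 < p -> N%:R < s * p ->
  m_sp N s p = inf_calW N s p /\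
  exists (f : 'rV[R]_N -> R) (v : \bar R),
    calW s p f /\ holder_semi (alpha_sp N s p) f = 1%E /\ Wsp_val s p f v /\
    v = inf_calW N s p.
Proof.
move=> N1 s0 s1 p1 Nsp; split; first exact: m_sp_eq_inf_calW.
exact: minimizer_exists.
Qed.
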